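(* Let $\mathcal H$ be a separable complex Hilbert space. If $C\in B(\mathcal H)$ is a compact normal operator and $X\in B(\mathcal H)$, then the following are equivalent. (i) $X\in\overline{\mathcal U(C)}^{\|\cdot\|}$ (operator-norm closure); that is, $X$ is approximately unitarily equivalent to $C$. (ii) $X$ is compact normal and $\lambda(X)=\lambda(C)$ (up to a suitable permutation). (iii) $X\oplus \mathbf 0\in\mathcal U(C\oplus\mathbf 0)$, where $\mathbf 0$ is the zero operator on a separable infinite-dimensional Hilbert space. If in addition $C$ is trace-class, then these are also equivalent to (iv) $X\in\mathcal O(C)$. When $C\in B(\mathcal H)$ has finite rank, even if $C$ is not normal, then $$\overline{\mathcal U(C)}^{\|\cdot\|}=\mathcal O(C)=\mathcal U(C).$$
   Context: For an operator $C$ on a Hilbert space, $\mathcal U(C)=\{UCU^*: U \text{ unitary}\}$ is its unitary orbit. For trace-class $C$, $\mathcal O(C)$ denotes the closure of $\mathcal U(C)$ in the trace norm $\|\cdot\|_1$. For a compact operator $C$, $\lambda(C)$ is its eigenvalue sequence: the eigenvalues listed in order of decreasing modulus, repeated according to algebraic multiplicity, and concatenated with zeros if there are only finitely many nonzero eigenvalues; if there are infinitely many nonzero eigenvalues, the eigenvalue zero is omitted entirely. *)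

(* Defs.v *)
From HB Require Import structures.
From mathcomp Require Import all_boot all_order all_algebra sesquilinear.
From mathcomp Require Import complex ring.
From mathcomp Require Import boolp classical_sets functions cardinality reals.
From mathcomp Require Import ereal topology normedtype sequences.

Set Implicit Arguments.
Unset Strict Implicit.
Unset Printing Implicit Defensive.

Import Order.TTheory GRing.Theory Num.Theory.
Import numFieldNormedType.Exports.

Local Open Scope classical_set_scope.
Local Open Scope ring_scope.

(* A complex Hilbert space is a Banach space over [R[i]] whose norm comes from
   an inner product, linear in its first argument. *)
HB.mixin Record CompleteNormedModule_isHilbert (R : realType) (H : Type)
    & CompleteNormedModule R[i] H := {
  inner : {dot H for @Num.conj R[i]} ;
  sqr_normE : forall x : H, `|x| ^+ 2 = inner x x
}.

#[short(type="hilbertType")]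
HB.structure Definition Hilbert (R : realType) :=
  {H of CompleteNormedModule R[i] H & CompleteNormedModule_isHilbert R H}.

(* The Hilbert direct sum; an alias, because the library equips [H * K] with
   the maximum norm. *)
Definition hsum (R : realType) (H K : hilbertType R) : Type := (H * K)%type.

Section HilbertSum.
Variables (R : realType) (H K : hilbertType R).

HB.instance Definition _ := GRing.Lmodule.copy (hsum H K) (H * K)%type.

Definition hsum_inner (z w : hsum H K) : R[i] :=
  inner z.1 w.1 + inner z.2 w.2.

Fact hsum_inner_bilinear :
  bilinear_for *%R ((@Num.conj R[i]) \; *%R) hsum_inner.
Proof.
split=> w a u v; rewrite /hsum_inner /=.
  by rewrite !linearPl /= mulrDr addrACA.
by rewrite !linearPr /= mulrDr addrACA.
Qed.

HB.instance Definition _ := bilinear_isBilinear.Build R[i] (hsum H K)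
  (hsum H K) R[i] *%R ((@Num.conj R[i]) \; *%R) hsum_inner hsum_inner_bilinear.

Fact hsum_inner_hermitian (z w : hsum H K) :
  hsum_inner z w = (-1) ^+ false * Num.conj (hsum_inner w z).
Proof.
by rewrite /hsum_inner rmorphD /= [inner z.1 _]hermC [inner z.2 _]hermC !mul1r.
Qed.

HB.instance Definition _ := isHermitianSesquilinear.Build R[i] (hsum H K)
  false (@Num.conj R[i]) hsum_inner hsum_inner_hermitian.

Fact hsum_inner_gt0 (z : hsum H K) : z != 0 -> 0 < hsum_inner z z.
Proof.
case: z => x y; rewrite /hsum_inner /= => z0; rewrite lt_def addr_ge0 ?dnorm_ge0//.
rewrite andbT paddr_eq0 ?dnorm_ge0// !dnorm_eq0.
by apply: contra z0 => /andP[/eqP-> /eqP->].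
Qed.

HB.instance Definition _ := isDotProduct.Build R[i] (hsum H K)
  hsum_inner hsum_inner_gt0.

Definition hsum_norm (z : hsum H K) : R[i] := sqrtC (hsum_inner z z).

Lemma hsum_normE z : hsum_norm z = sqrtC (`|z.1| ^+ 2 + `|z.2| ^+ 2).
Proof. by rewrite /hsum_norm /hsum_inner !sqr_normE. Qed.

Fact minkowski2 (a b c d : R[i]) : 0 <= a -> 0 <= b -> 0 <= c -> 0 <= d ->
  sqrtC ((a + b) ^+ 2 + (c + d) ^+ 2)
    <= sqrtC (a ^+ 2 + c ^+ 2) + sqrtC (b ^+ 2 + d ^+ 2).
Proof.
move=> a0 b0 c0 d0.
have s0 x y : 0 <= x -> 0 <= y -> 0 <= x ^+ 2 + y ^+ 2 :> R[i].
  by move=> x0 y0; rewrite addr_ge0 ?exprn_ge0.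
rewrite -ler_sqr ?nnegrE ?addr_ge0 ?sqrtC_ge0 ?s0 ?addr_ge0//.
rewrite sqrtCK [leRHS]sqrrD !sqrtCK.
have -> : (a + b) ^+ 2 + (c + d) ^+ 2 =
    (a ^+ 2 + c ^+ 2) + (a * b + c * d) *+ 2 + (b ^+ 2 + d ^+ 2) by ring.
rewrite lerD2r lerD2l lerMn2r /= -sqrtCM ?nnegrE ?s0//.
rewrite -ler_sqr ?nnegrE ?sqrtC_ge0 ?mulr_ge0 ?s0 ?addr_ge0 ?mulr_ge0//.
rewrite sqrtCK -subr_ge0.
have -> : (a ^+ 2 + c ^+ 2) * (b ^+ 2 + d ^+ 2) - (a * b + c * d) ^+ 2 =
    (a * d - b * c) ^+ 2 by ring.
by rewrite real_exprn_even_ge0// rpredB// ger0_real// mulr_ge0.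
Qed.

Fact hsum_normD z w : hsum_norm (z + w) <= hsum_norm z + hsum_norm w.
Proof.
rewrite !hsum_normE /=.
apply: le_trans (minkowski2 (normr_ge0 _) (normr_ge0 _) (normr_ge0 _)
  (normr_ge0 _)).
rewrite ler_sqrtC ?nnegrE ?addr_ge0 ?exprn_ge0 ?addr_ge0//.
by rewrite lerD// ler_sqr ?nnegrE ?addr_ge0// ler_normD.
Qed.

Fact hsum_normZ (a : R[i]) z : hsum_norm (a *: z) = `|a| * hsum_norm z.
Proof.
rewrite !hsum_normE /= !normrZ !exprMn -mulrDr rootCMl ?exprn_ge0//.
by rewrite sqrCK.
Qed.

Fact hsum_norm_eq0 z : hsum_norm z = 0 -> z = 0.
Proof. by move/eqP; rewrite sqrtC_eq0 dnorm_eq0 => /eqP. Qed.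

HB.instance Definition _ := Lmodule_isNormed.Build R[i] (hsum H K)
  hsum_normD hsum_normZ hsum_norm_eq0.

Lemma hsum_norm_fst (z : hsum H K) : `|z.1| <= `|z|.
Proof.
rewrite [`|z|]hsum_normE -[leLHS]sqrCK//.
by rewrite ler_sqrtC ?nnegrE ?addr_ge0 ?exprn_ge0// lerDl exprn_ge0.
Qed.

Lemma hsum_norm_snd (z : hsum H K) : `|z.2| <= `|z|.
Proof.
rewrite [`|z|]hsum_normE -[leLHS]sqrCK//.
by rewrite ler_sqrtC ?nnegrE ?addr_ge0 ?exprn_ge0// lerDr exprn_ge0.
Qed.

Lemma hsum_norm_le (z : hsum H K) : `|z| <= `|z.1| + `|z.2|.
Proof.
rewrite [`|z|]hsum_normE -[leRHS]sqrCK ?addr_ge0//.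
rewrite ler_sqrtC ?nnegrE ?addr_ge0 ?exprn_ge0 ?addr_ge0//.
by rewrite sqrrD addrAC lerDl mulrn_wge0// mulr_ge0.
Qed.

Fact hsum_complete (F : set_system (hsum H K)) :
  ProperFilter F -> cauchy F -> cvg F.
Proof.
move=> FF /cauchy_ballP Fc.
have c1 : cvg (fst @ F : set_system H).
  apply: cauchy_cvg; apply/cauchy_ballP => e e0; near_simpl.
  have := Fc e e0; apply: filterS => -[z w] /=.
  by rewrite -!ball_normE /=; apply: le_lt_trans; exact: (hsum_norm_fst (z - w)).
have c2 : cvg (snd @ F : set_system K).
  apply: cauchy_cvg; apply/cauchy_ballP => e e0; near_simpl.
  have := Fc e e0; apply: filterS => -[z w] /=.
  by rewrite -!ball_normE /=; apply: le_lt_trans; exact: (hsum_norm_snd (z - w)).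
apply/cvg_ex; exists ((lim (fst @ F), lim (snd @ F)) : hsum H K).
apply/cvgrPdist_lt => e e0.
have e2 : 0 < e / 2 by rewrite divr_gt0.
have /cvgrPdist_lt/(_ _ e2) h1 := c1.
have /cvgrPdist_lt/(_ _ e2) h2 := c2.
near=> z; rewrite (le_lt_trans (hsum_norm_le _))// [ltRHS]splitr ltrD//=.
  by near: z.
by near: z.
Unshelve. all: by end_near. Qed.

HB.instance Definition _ := Uniform_isComplete.Build (hsum H K) hsum_complete.

Fact hsum_sqr_normE (z : hsum H K) : `|z| ^+ 2 = hsum_inner z z.
Proof. exact: sqrtCK. Qed.

HB.instance Definition _ :=
  CompleteNormedModule_isHilbert.Build R (hsum H K) hsum_sqr_normE.

End HilbertSum.

Definition separable (T : topologicalType) : Prop :=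
  exists2 D : set T, countable D & dense D.

Section Dimension.
Variables (K : fieldType) (V : lmodType K).

Definition lin_comb (n : nat) (v : 'I_n -> V) (c : 'I_n -> K) : V :=
  \sum_(i < n) c i *: v i.

Definition lin_indep (n : nat) (v : 'I_n -> V) : Prop :=
  forall c, lin_comb v c = 0 -> forall i, c i = 0.

Definition has_dim (E : set V) (n : nat) : Prop :=
  exists2 v : 'I_n -> V, lin_indep v & E = range (lin_comb v).

Definition infinite_dim : Prop := forall n, ~ has_dim setT n.

End Dimension.

Arguments infinite_dim {K} V.

Section Operators.
Variable R : realType.

Section TwoSpaces.
Variables H K : hilbertType R.
Implicit Type T : H -> K.

Definition bounded_op T : Prop := linear T /\ continuous T.

(* For bounded [T] this set is a singleton, by the Riesz representation
   theorem. *)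
Definition adjoint T : K -> H :=
  xget (fun=> 0) [set S | forall x y, inner (T x) y = inner x (S y)].

Definition opnorm T : R :=
  sup [set complex.Re `|T x| | x in [set x : H | `|x| <= 1]].

Definition compact_op T : Prop :=
  bounded_op T /\ precompact (T @` [set x : H | `|x| <= 1]).

Definition finite_rank T : Prop :=
  bounded_op T /\ exists n, has_dim (range T) n.

End TwoSpaces.

Definition dsum (H K : hilbertType R) (S : H -> H) (T : K -> K)
  (z : hsum H K) : hsum H K := (S z.1, T z.2).

Variable H : hilbertType R.
Implicit Types (S T U C : H -> H) (E : set (H -> H)).

Definition normal_op T : Prop :=
  bounded_op T /\ adjoint T \o T = T \o adjoint T.

Definition unitary_op U : Prop :=
  [/\ bounded_op U, adjoint U \o U = id & U \o adjoint U = id].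

Definition unitary_orbit C : set (H -> H) :=
  [set U \o C \o adjoint U | U in unitary_op].

Definition opnorm_closure E : set (H -> H) :=
  [set X | bounded_op X /\
    forall e : R, 0 < e -> exists2 Y, E Y & opnorm (X \- Y) < e].

Definition gen_eigenspace T (mu : R[i]) : set H :=
  [set x | exists k, iter k (fun y => T y - mu *: y) x = 0].

(* The dimension of [gen_eigenspace T mu] is the algebraic multiplicity of
   [mu]. As the moduli decrease, [l] contains [0] only when [T] has finitely
   many nonzero eigenvalues, and then ends with zeros. *)
Definition is_eigenvalue_seq T (l : nat -> R[i]) : Prop :=
  (forall n, `|l n.+1| <= `|l n|) /\
  (forall mu, mu != 0 -> exists2 m,
     has_dim (gen_eigenspace T mu) m & ([set n | l n = mu] #= `I_m)%card).

(* Such a sequence exists for compact [T], and is unique up to permuting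
   eigenvalues of equal modulus. *)
Definition eigenvalue_seq T : nat -> R[i] :=
  xget (fun=> 0) (is_eigenvalue_seq T).

(* The singular values are the eigenvalues of [|T|], the positive square root
   of [adjoint T \o T]. *)
Definition singular_value T (n : nat) : R :=
  Num.sqrt (complex.Re (eigenvalue_seq (adjoint T \o T) n)).

Definition trace_norm T : \bar R :=
  (\sum_(0 <= n <oo) (singular_value T n)%:E)%E.

Definition trace_class T : Prop :=
  compact_op T /\ (trace_norm T < +oo)%E.

(* [trace_norm] is meaningful only on compact operators, hence the closure is
   taken inside the space of trace-class operators. *)
Definition trace_norm_closure E : set (H -> H) :=
  [set X | trace_class X /\ forall e : R, 0 < e ->
    exists2 Y, E Y & (trace_norm (X \- Y)%R < e%:E)%E].

Definition trace_orbit C : set (H -> H) :=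
  trace_norm_closure (unitary_orbit C).

End Operators.

(* Main.v *)
Require Import Defs.
From HB Require Import structures.
From mathcomp Require Import all_boot all_order all_algebra sesquilinear.
From mathcomp Require Import complex ring lra.
From mathcomp Require Import boolp classical_sets functions cardinality reals.
From mathcomp Require Import ereal topology normedtype sequences.

(** Why the theorem holds. Every statement is reduced to one invariant of a
    compact normal operator, the dimensions of its eigenspaces for nonzero
    eigenvalues ([same_mult]).

    The tool behind all constructions of unitaries is that two finite families
    with equal Gram matrices are exchanged by a unitary of the whole space
    ([gram_unitary]): move the vectors one at a time, each by a reflection that
    fixes the vectors already placed. For two total sequences these unitaries
    converge strongly ([gram_unitary_total]).

    The spectral theorem ([spectral_theorem]) is obtained greedily. On a closed
    reducing subspace a compact normal [T] attains its norm at an eigenvector,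
    and orthogonal complements of eigenvectors reduce [T]. This yields
    orthonormal eigenvectors, beyond which [T] is arbitrarily small
    ([diagonalizes]); in particular eigenvalue sequences exist, and two of them
    differ by a permutation exactly when the multiplicities agree
    ([same_multP]).

    (i) implies (ii): norm limits of compact normal operators are compact and
    normal, and [T - mu] is bounded below on the complement of the
    [mu]-eigenspace ([spectral_gap]), so operators close to each other have
    eigenspaces of the same dimension ([close_mult_le]). Conversely, with equal
    multiplicities a unitary sending the first [N] eigenvectors of [C] to those
    of [X] makes [U C U^*] agree with [X] up to the two small tails
    ([diag_close]).

    (iii): a unitary equivalence of the enlarged operators gives equal
    multiplicities by the same argument on the direct sum. In the other
    direction, the summand [K] makes both complements of the eigenvectors
    infinite dimensional, so both systems of eigenvectors are completed to
    orthonormal bases by sequences of the same length, and the total version of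
    the Gram matrix argument applies ([dilation_orbit]).

    (iv): the trace norm is bounded by any bound of the pairings
    [sum_i <S a_i, b_i>] over orthonormal families ([trace_norm_le]), and for a
    tail of a diagonalised operator these pairings are at most the tail of the
    sum of the moduli of the eigenvalues ([diag_pairing]); so the unitaries of
    the norm estimate also approximate in the trace norm. In the other direction
    the trace norm dominates the operator norm ([trace_norm_lt_bound]).

    Finite rank: it remains to see that the unitary orbit is norm closed
    ([rank_form_orbit_closed]). A limit [X] of operators of rank [r] has rank at
    most [r]. If [C = sum_i <., u_i> w_i], only the finitely many vectors
    [U_n u_i], [U_n w_i] matter; composing [U_n] with unitaries that commute with
    [X] confines them to a fixed finite-dimensional space ([confine]), where they
    converge along an ultrafilter. The limits have the same Gram matrix as the
    [u_i], [w_i], hence come from a unitary [V], and [X = V C V^*]. *)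

Set Implicit Arguments.
Unset Strict Implicit.
Unset Printing Implicit Defensive.

Import Order.TTheory GRing.Theory Num.Theory.
Import numFieldNormedType.Exports.

Local Open Scope classical_set_scope.
Local Open Scope ring_scope.
Local Open Scope complex_scope.

Local Notation "'[ x , y ]" := (inner x y) : ring_scope.

(** * Real-valued norms and the inner product *)

Section RealNorm.
Variable R : realType.

(** Norms take values in [R[i]], whose order is partial; their real parts live
    in the totally ordered field [R], where estimates are linear arithmetic. *)
Definition nm (V : normedZmodType R[i]) (x : V) : R := complex.Re `|x|.

Lemma normE (V : normedZmodType R[i]) (x : V) : `|x| = (nm x)%:C.
Proof. by rewrite /nm RRe_real// normr_real. Qed.

Lemma norm_le1 (V : normedZmodType R[i]) (x : V) : (`|x| <= 1) = (nm x <= 1).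
Proof. by rewrite normE -lecR. Qed.

Lemma norm_lt1 (V : normedZmodType R[i]) (x : V) : (`|x| < 1) = (nm x < 1).
Proof. by rewrite normE -ltcR. Qed.

Lemma nm_ge0 (V : normedZmodType R[i]) (x : V) : 0 <= nm x.
Proof. by rewrite -ler0c -normE. Qed.

Lemma nm_eq0 (V : normedZmodType R[i]) (x : V) : nm x = 0 -> x = 0.
Proof. by move=> h; apply/eqP; rewrite -normr_eq0 normE h. Qed.

Lemma nm0 (V : normedZmodType R[i]) : nm (0 : V) = 0.
Proof. by rewrite /nm normr0. Qed.

Lemma nm_gt0 (V : normedZmodType R[i]) (x : V) : x != 0 -> 0 < nm x.
Proof.
move=> x0; rewrite lt_def nm_ge0 andbT; apply: contra x0 => /eqP/nm_eq0->.
exact: eqxx.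
Qed.

Lemma nmN (V : normedZmodType R[i]) (x : V) : nm (- x) = nm x.
Proof. by rewrite /nm normrN. Qed.

Lemma nmBC (V : normedZmodType R[i]) (x y : V) : nm (x - y) = nm (y - x).
Proof. by rewrite -nmN opprB. Qed.

Lemma nmD (V : normedZmodType R[i]) (x y : V) : nm (x + y) <= nm x + nm y.
Proof. by rewrite -lecR rmorphD/= -!normE ler_normD. Qed.

Lemma nmB (V : normedZmodType R[i]) (x y : V) : nm (x - y) <= nm x + nm y.
Proof. by rewrite -[nm y]nmN nmD. Qed.

Lemma nm_sum (V : normedZmodType R[i]) (I : Type) (r : seq I) (P : pred I)
    (F : I -> V) : nm (\sum_(i <- r | P i) F i) <= \sum_(i <- r | P i) nm (F i).
Proof.
elim/big_rec2: _ => [|i y x _ h]; first by rewrite nm0.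
by apply: le_trans (nmD _ _) _; rewrite lerD2l.
Qed.

Lemma nmM (a b : R[i]) : nm (a * b) = nm a * nm b.
Proof. by apply: complexI; rewrite rmorphM/= -!normE normrM. Qed.

Lemma nmV (a : R[i]) : nm a^-1 = (nm a)^-1.
Proof. by apply: complexI; rewrite fmorphV/= -!normE normfV. Qed.

Lemma nmJ (a : R[i]) : nm (Num.conj a) = nm a.
Proof. by apply: complexI; rewrite -!normE norm_conjC. Qed.

Lemma nmR (r : R) : nm r%:C = `|r|.
Proof. by apply: complexI; rewrite -normE normc_def/= expr0n addr0 sqrtr_sqr. Qed.

Lemma Re_le_nm (a : R[i]) : complex.Re a <= nm a.
Proof.
by apply: le_trans (ler_norm _) _; rewrite -lecR -normE normc_ge_Re.
Qed.

Lemma mulJr (a : R[i]) : a * Num.conj a = (nm a ^+ 2)%:C.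
Proof. by rewrite -normCK normE rmorphXn. Qed.

Lemma conjR (r : R) : Num.conj r%:C = r%:C :> R[i].
Proof. by apply: conj_Creal; rewrite complex_real. Qed.

Lemma addJr (a : R[i]) : a + Num.conj a = (2 * complex.Re a)%:C.
Proof.
have -> : Num.conj a = a^*%C.
  have [->|a0] := eqVneq a 0; first by rewrite rmorph0 conjc0.
  by apply: (mulfI a0); rewrite -sqr_normc normCK.
by rewrite addcJ rmorphM/= rmorph_nat.
Qed.

End RealNorm.

Section NormedModule.
Variables (R : realType) (V : normedModType R[i]).

Lemma nmZ (a : R[i]) (x : V) : nm (a *: x) = nm a * nm x.
Proof. by apply: complexI; rewrite rmorphM/= -!normE normrZ. Qed.

Lemma nmZr (r : R) (x : V) : 0 <= r -> nm (r%:C *: x) = r * nm x.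
Proof. by move=> r0; rewrite nmZ nmR ger0_norm. Qed.

End NormedModule.

Section InnerProduct.
Variables (R : realType) (H : hilbertType R).
Implicit Types (x y z : H) (a : R[i]).

Lemma ipDl x y z : '[x + y, z] = '[x, z] + '[y, z].
Proof. exact: linearDl. Qed.
Lemma ipBl x y z : '[x - y, z] = '[x, z] - '[y, z].
Proof. exact: linearBl. Qed.
Lemma ipZl a x z : '[a *: x, z] = a * '[x, z].
Proof. exact: linearZl_LR. Qed.
Lemma ip0l z : '[0 : H, z] = 0.
Proof. exact: linear0l. Qed.
Lemma ipDr x y z : '[z, x + y] = '[z, x] + '[z, y].
Proof. exact: linearDr. Qed.
Lemma ipBr x y z : '[z, x - y] = '[z, x] - '[z, y].
Proof. exact: linearBr. Qed.
Lemma ipZr a x z : '[z, a *: x] = Num.conj a * '[z, x].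
Proof. exact: linearZr_LR. Qed.
Lemma ip0r z : '[z, 0 : H] = 0.
Proof. exact: linear0r. Qed.
Lemma ip_suml (I : Type) (r : seq I) (P : pred I) (F : I -> H) z :
  '[\sum_(i <- r | P i) F i, z] = \sum_(i <- r | P i) '[F i, z].
Proof. exact: linear_sumlz. Qed.
Lemma ip_sumr (I : Type) (r : seq I) (P : pred I) (F : I -> H) z :
  '[z, \sum_(i <- r | P i) F i] = \sum_(i <- r | P i) '[z, F i].
Proof. exact: linear_sumr. Qed.
Lemma ipC x y : '[x, y] = Num.conj '[y, x].
Proof. by rewrite hermC /= expr0 mul1r. Qed.
Lemma ip_eq0C x y : '[x, y] = 0 -> '[y, x] = 0.
Proof. by move=> h; rewrite ipC h rmorph0. Qed.
Lemma ip_self x : '[x, x] = (nm x ^+ 2)%:C.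
Proof. by rewrite -sqr_normE normE rmorphXn. Qed.
Lemma nm_sqr x : nm x ^+ 2 = complex.Re '[x, x].
Proof. by rewrite ip_self. Qed.
Lemma ip_eq0 x : '[x, x] = 0 -> x = 0.
Proof.
by rewrite ip_self => /complexI/eqP; rewrite expf_eq0/= => /eqP/nm_eq0.
Qed.

Lemma nmD_sqr x y :
  nm (x + y) ^+ 2 = nm x ^+ 2 + nm y ^+ 2 + 2 * complex.Re '[x, y].
Proof.
apply: complexI; rewrite -ip_self ipDl !ipDr [ '[y, x] ]ipC !ip_self.
by rewrite !rmorphD/= -addJr; ring.
Qed.

Lemma nmB_sqr x y :
  nm (x - y) ^+ 2 = nm x ^+ 2 + nm y ^+ 2 - 2 * complex.Re '[x, y].
Proof.
apply: complexI; rewrite -ip_self ipBl !ipBr [ '[y, x] ]ipC !ip_self.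
by rewrite !rmorphB !rmorphD/= -addJr; ring.
Qed.

Lemma pythagoras x y : '[x, y] = 0 -> nm (x + y) ^+ 2 = nm x ^+ 2 + nm y ^+ 2.
Proof. by move=> h; rewrite nmD_sqr h mulr0 addr0. Qed.

Lemma parallelogram x y :
  nm (x + y) ^+ 2 + nm (x - y) ^+ 2 = 2 * (nm x ^+ 2 + nm y ^+ 2).
Proof. rewrite nmD_sqr nmB_sqr; ring. Qed.

(** Pythagoras for the component of [x] orthogonal to [y]. *)
Lemma cauchy_schwarz x y : nm '[x, y] <= nm x * nm y.
Proof.
have [->|y0] := eqVneq y 0; first by rewrite ip0r !nm0 mulr0.
have ny := nm_gt0 y0.
pose c := '[x, y] / (nm y ^+ 2)%:C.
have nyC : (nm y ^+ 2)%:C != 0 :> R[i].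
  by rewrite (inj_eq (@complexI _)) expf_neq0// gt_eqF.
have hz : '[x - c *: y, c *: y] = 0.
  rewrite ipBl ipZl !ipZr ip_self.
  have -> : c * (Num.conj c * (nm y ^+ 2)%:C) = Num.conj c * (c * (nm y ^+ 2)%:C).
    by ring.
  by rewrite {3}/c divfK// subrr.
have := pythagoras hz; rewrite subrK nmZ nmM nmV nmR => h.
rewrite -ler_sqr ?nnegrE ?mulr_ge0 ?nm_ge0// exprMn h.
rewrite [`|_|]ger0_norm ?sqr_ge0//.
have -> : (nm '[x, y] / nm y ^+ 2 * nm y) ^+ 2 = nm '[x, y] ^+ 2 / nm y ^+ 2.
  by field; rewrite gt_eqF.
by rewrite mulrDl divfK ?expf_neq0 ?gt_eqF// lerDr mulr_ge0// sqr_ge0.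
Qed.

Lemma ip_ext x y : (forall z, '[x, z] = '[y, z]) -> x = y.
Proof.
by move=> h; apply/subr0_eq/ip_eq0; rewrite ipBl h subrr.
Qed.

Lemma ip_extr x y : (forall z, '[z, x] = '[z, y]) -> x = y.
Proof. by move=> h; apply: ip_ext => z; rewrite ipC h -ipC. Qed.

Lemma nm_le_ip x (B : R) : 0 <= B -> (forall y, nm '[x, y] <= B * nm y) -> nm x <= B.
Proof.
move=> B0 /(_ x); rewrite ip_self nmR ger0_norm ?sqr_ge0// expr2.
have [->|x0] := eqVneq x 0; first by rewrite nm0.
by rewrite ler_pM2r// nm_gt0.
Qed.

End InnerProduct.

(** * Norm limits along filters *)

Section Limits.
Variable R : realType.

(** Convergence measured by [nm], stated for arbitrary filters so that it covers
    both sequences and ultrafilter limits. *)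
Definition tends (T : Type) (F : set_system T) (V : normedZmodType R[i])
    (x : T -> V) (y : V) :=
  forall e : R, 0 < e -> \forall t \near F, nm (x t - y) < e.

Section Laws.
Context {T : Type} {F : set_system T} {FF : ProperFilter F}.

Lemma tends_cst (V : normedZmodType R[i]) (y : V) : tends F (fun=> y) y.
Proof. by move=> e e0; apply: nearW => t; rewrite subrr nm0. Qed.

Lemma tends_near (V : normedZmodType R[i]) (x x' : T -> V) (y : V) :
  (\forall t \near F, x t = x' t) -> tends F x y -> tends F x' y.
Proof.
move=> h hx e e0; near=> t; have <- : x t = x' t by near: t.
by near: t; apply: hx.
Unshelve. all: by end_near. Qed.

Lemma tendsD (V : normedZmodType R[i]) (x x' : T -> V) (y y' : V) :
  tends F x y -> tends F x' y' -> tends F (fun t => x t + x' t) (y + y').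
Proof.
move=> hx hx' e e0; near=> t.
have -> : x t + x' t - (y + y') = (x t - y) + (x' t - y') by rewrite opprD addrACA.
apply: le_lt_trans (nmD _ _) _; rewrite [e]splitr ltrD//.
  by near: t; apply: hx; rewrite divr_gt0.
by near: t; apply: hx'; rewrite divr_gt0.
Unshelve. all: by end_near. Qed.

Lemma tends_le (V W : normedZmodType R[i]) (x : T -> V) (y : V) (x' : T -> W)
    (y' : W) (B : R) : (\forall t \near F, nm (x' t - y') <= B * nm (x t - y)) ->
  tends F x y -> tends F x' y'.
Proof.
move=> h hx e e0.
have B0 : 0 < `|B| + 1 by rewrite ltr_wpDl.
near=> t; apply: (@le_lt_trans _ _ (B * nm (x t - y))); first by near: t.
apply: (@le_lt_trans _ _ ((`|B| + 1) * nm (x t - y))).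
  by rewrite ler_wpM2r ?nm_ge0// (le_trans (ler_norm _))// lerDl.
by rewrite mulrC -ltr_pdivlMr//; near: t; apply: hx; rewrite divr_gt0.
Unshelve. all: by end_near. Qed.

Lemma tendsN (V : normedZmodType R[i]) (x : T -> V) (y : V) :
  tends F x y -> tends F (fun t => - x t) (- y).
Proof.
by apply: (@tends_le _ _ _ _ _ _ 1); near=> t; rewrite -opprD nmN mul1r.
Unshelve. all: by end_near. Qed.

Lemma tendsB (V : normedZmodType R[i]) (x x' : T -> V) (y y' : V) :
  tends F x y -> tends F x' y' -> tends F (fun t => x t - x' t) (y - y').
Proof. by move=> hx hx'; apply: tendsD => //; apply: tendsN. Qed.

Lemma tendsZ (V : normedModType R[i]) (x : T -> V) (y : V) (a : R[i]) :
  tends F x y -> tends F (fun t => a *: x t) (a *: y).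
Proof.
by apply: (@tends_le _ _ _ _ _ _ (nm a)); near=> t; rewrite -scalerBr nmZ.
Unshelve. all: by end_near. Qed.

Lemma tends_sum (V : normedZmodType R[i]) (I : Type) (r : seq I)
    (x : I -> T -> V) (y : I -> V) :
  (forall i, tends F (x i) (y i)) ->
  tends F (fun t => \sum_(i <- r) x i t) (\sum_(i <- r) y i).
Proof.
move=> h; elim: r => [|i r IH].
  by rewrite big_nil; apply: (tends_near _ (tends_cst 0)); apply: nearW => t; rewrite big_nil.
rewrite big_cons; apply: (tends_near _ (tendsD (h i) IH)); apply: nearW => t.
by rewrite big_cons.
Qed.

Lemma tends_uniq (V : normedZmodType R[i]) (x : T -> V) (y y' : V) :
  tends F x y -> tends F x y' -> y = y'.
Proof.
move=> h h'; apply/esym/subr0_eq/nm_eq0/le_anti; rewrite nm_ge0 andbT.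
apply/ler_addgt0Pr => e e0; rewrite add0r; near F => t.
have -> : y' - y = (x t - y) - (x t - y') by rewrite opprB [RHS]addrC addrA subrK.
rewrite [e]splitr; apply: le_trans (nmB _ _) _; apply/ltW/ltrD.
  by near: t; apply: h; rewrite divr_gt0.
by near: t; apply: h'; rewrite divr_gt0.
Unshelve. all: by end_near. Qed.

Lemma tends_nm (V : normedZmodType R[i]) (x : T -> V) (y : V) :
  tends F x y -> tends F (fun t => (nm (x t))%:C) (nm y)%:C.
Proof.
apply: (@tends_le _ _ _ _ _ _ 1); near=> t; rewrite mul1r -rmorphB nmR.
have h1 := nmD (x t - y) y; have h2 := nmB (x t) (x t - y).
rewrite subrK in h1; rewrite subKr in h2.
by rewrite ler_norml; apply/andP; split; lra.
Unshelve. all: by end_near. Qed.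

Lemma tends_ip (H : hilbertType R) (x x' : T -> H) (y y' : H) :
  tends F x y -> tends F x' y' -> tends F (fun t => '[x t, x' t]) '[y, y'].
Proof.
move=> hx hx' e e0.
have B0 : 0 < nm y + nm y' + 1 by rewrite ltr_wpDl ?addr_ge0 ?nm_ge0.
pose d := Num.min 1 (e / (nm y + nm y' + 1)).
have d0 : 0 < d by rewrite lt_min ltr01 divr_gt0.
near=> t.
have h1 : nm (x t - y) < d by near: t; apply: hx.
have h2 : nm (x' t - y') < d by near: t; apply: hx'.
have -> : '[x t, x' t] - '[y, y'] =
    '[x t - y, x' t - y'] + '[x t - y, y'] + '[y, x' t - y'].
  by rewrite !ipBr !ipBl; ring.
have c1 := cauchy_schwarz (x t - y) (x' t - y').
have c2 := cauchy_schwarz (x t - y) y'.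
have c3 := cauchy_schwarz y (x' t - y').
apply: le_lt_trans (nmD _ _) _.
apply: le_lt_trans (lerD (nmD _ _) (lexx _)) _.
have d1 : d <= 1 by rewrite ge_min lexx.
have d2 : d * (nm y + nm y' + 1) <= e by rewrite -ler_pdivlMr// ge_min lexx orbT.
apply: lt_le_trans d2.
have a0 := nm_ge0 (x t - y); have b0 := nm_ge0 (x' t - y').
have y0 := nm_ge0 y; have y'0 := nm_ge0 y'.
apply: le_lt_trans (lerD (lerD c1 c2) c3) _.
have : nm (x t - y) * nm (x' t - y') < d.
  apply: (@le_lt_trans _ _ (nm (x t - y))) => //.
  by rewrite ler_piMr// (le_trans (ltW h2)).
have : nm (x t - y) * nm y' <= d * nm y' by rewrite ler_wpM2r// ltW.
have : nm y * nm (x' t - y') <= nm y * d by rewrite ler_wpM2l// ltW.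
lra.
Unshelve. all: by end_near. Qed.

Lemma complete_tends (H : hilbertType R) (x : T -> H) :
  (forall e : R, 0 < e -> exists z, \forall t \near F, nm (x t - z) < e) ->
  exists y, tends F x y.
Proof.
move=> h.
have cx : cauchy (x @ F).
  apply/cauchyP => e e0.
  have e0' : (complex.Re e)%:C = e by rewrite RRe_real// gtr0_real.
  have /h[z hz] : 0 < complex.Re e by rewrite -ltcR e0'.
  exists z; near_simpl; near=> t.
  rewrite -ball_normE /= -e0' distrC normE ltcR; by near: t.
have cvx : cvg (x @ F) by exact: cauchy_cvg.
have /cvgrPdist_lt hy := cvx; set y := lim _ in hy.
exists y => e e0; have := hy e%:C; rewrite ltcR => /(_ e0).
by apply: filterS => t; rewrite distrC normE ltcR.
Unshelve. all: by end_near. Qed.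

End Laws.

(** Limits along such an ultrafilter replace the extraction of subsequences:
    finitely many precompact sequences converge along it simultaneously. *)
Definition cofinal_ultra (U : set_system nat) :=
  UltraFilter U /\ forall N, U [set n | (N <= n)%N].

Lemma cofinal_ultra_ex : exists U, cofinal_ultra U.
Proof.
have [U [UU sU]] := @ultraFilterLemma nat \oo _.
by exists U; split=> // N; apply: sU; exists N.
Qed.

Lemma ultra_seq (T : Type) (U : set_system T) (I : eqType) (s : seq I)
    (A : I -> set T) : UltraFilter U ->
  U [set t | exists2 i, i \in s & A i t] -> exists2 i, i \in s & U (A i).
Proof.
move=> UU; elim: s => [|i s IH] h.
  have : U set0 by apply: filterS h => t [].
  by move/filter_ex => [].
have [h1|h1] := in_ultra_setVsetC (A i) UU.
  by exists i => //; rewrite inE eqxx.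
have [|j js Aj] := IH; last by exists j => //; rewrite inE js orbT.
apply: filterS (filterI h h1) => t [[j]]; rewrite inE => /orP[/eqP->//|js Aj] _.
by exists j.
Qed.

Lemma small_inv (e : R) : 0 < e -> exists N, forall n, (N <= n)%N -> n.+1%:R^-1 < e.
Proof.
move=> e0; exists (Num.truncn e^-1) => n hn.
rewrite invf_plt ?posrE ?ltr0n//.
apply: (@lt_le_trans _ _ ((Num.truncn e^-1).+1%:R)).
  by have := truncnS_gt e^-1.
by rewrite ler_nat.
Qed.

End Limits.

(** * Bounded linear maps *)

Section Bounded.
Variable R : realType.
Variables H K : hilbertType R.
Implicit Types (T : H -> K).

Definition op_bound T (M : R) := 0 <= M /\ forall x, nm (T x) <= M * nm x.

Section Linear.
Variables (T : H -> K) (L : linear T).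

Lemma linP a x y : T (a *: x + y) = a *: T x + T y.
Proof. exact: L. Qed.
Lemma linD x y : T (x + y) = T x + T y.
Proof. by have := L 1 x y; rewrite !scale1r. Qed.
Lemma lin0 : T 0 = 0.
Proof. by have := linD 0 0; rewrite addr0 => /(congr1 (fun z => z - T 0)); rewrite subrr addrK. Qed.
Lemma linZ a x : T (a *: x) = a *: T x.
Proof. by have := L a x 0; rewrite !addr0 lin0 addr0. Qed.
Lemma linN x : T (- x) = - T x.
Proof. by rewrite -scaleN1r linZ scaleN1r. Qed.
Lemma linB x y : T (x - y) = T x - T y.
Proof. by rewrite linD linN. Qed.
Lemma lin_sum (I : Type) (r : seq I) (P : pred I) (F : I -> H) :
  T (\sum_(i <- r | P i) F i) = \sum_(i <- r | P i) T (F i).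
Proof. by elim/big_rec2: _ => [|i y x _ <-]; rewrite ?lin0 ?linD. Qed.

End Linear.

Lemma bounded_opP T : bounded_op T <-> linear T /\ exists M, op_bound T M.
Proof.
split=> [[L c]|[L [M [M0 hM]]]]; split=> //.
  have /cvgrPdist_lt/(_ 1 ltr01)/nbhs_ballP[e e0 he] := c 0.
  have e0' : (complex.Re e)%:C = e by rewrite RRe_real// gtr0_real.
  have r0 : 0 < complex.Re e by rewrite -ltcR e0'.
  set r := complex.Re e in e0' r0.
  exists (2 / r); split=> [|x]; first by rewrite divr_ge0// ltW.
  have [->|x0] := eqVneq x 0; first by rewrite (lin0 L) !nm0 mulr0.
  have nx := nm_gt0 x0.
  pose t := r / (2 * nm x).
  have t0 : 0 < t by rewrite divr_gt0 ?mulr_gt0.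
  have := he (t%:C *: x).
  rewrite -ball_normE /= sub0r normrN -e0' normE nmZr ?(ltW t0)// ltcR.
  have -> : t * nm x = r / 2 by rewrite /t; field; rewrite gt_eqF.
  rewrite (lin0 L) sub0r normrN norm_lt1 => h.
  have {h} : nm (T (t%:C *: x)) < 1 by apply: h; rewrite ltr_pdivrMr// ltr_pMr// ltr1n.
  rewrite (linZ L) nmZr ?(ltW t0)// => /ltW h.
  suff e1 : t * (2 / r * nm x) = 1 by rewrite -(ler_pM2l t0) e1.
  by rewrite /t; field; rewrite !gt_eqF.
move=> x; apply/cvgrPdist_lt => e e0.
have e0' : (complex.Re e)%:C = e by rewrite RRe_real// gtr0_real.
have r0 : 0 < complex.Re e by rewrite -ltcR e0'.
apply/nbhs_ballP; exists ((complex.Re e / (M + 1))%:C) => /=.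
  by rewrite ltcR divr_gt0// ltr_wpDl.
move=> y; rewrite -ball_normE /= normE ltcR => h.
rewrite -(linB L) normE -e0' ltcR.
apply: le_lt_trans (hM _) _.
apply: (@le_lt_trans _ _ ((M + 1) * nm (x - y))).
  by rewrite ler_wpM2r ?nm_ge0// lerDl.
by rewrite mulrC -ltr_pdivlMr// ltr_wpDl.
Qed.

Lemma tends_bounded T I (F : set_system I) {FF : ProperFilter F} x y :
  bounded_op T -> tends F x y -> tends F (T \o x) (T y).
Proof.
move=> /bounded_opP[L [M [M0 hM]]]; apply: (@tends_le _ _ _ _ _ _ _ _ _ _ M).
by apply: nearW => t /=; rewrite -(linB L).
Qed.

Lemma opnorm_le T B : linear T -> 0 <= B -> (forall x, nm (T x) <= B * nm x) ->
  opnorm T <= B.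
Proof.
move=> L B0 h; apply: ge_sup => [|_ [x /= x1 <-]].
  by exists (nm (T 0)), 0 => //=; rewrite normr0.
apply: le_trans (h x) _; rewrite ler_piMr//.
by rewrite -norm_le1.
Qed.

Lemma le_opnorm T x : bounded_op T -> nm (T x) <= opnorm T * nm x.
Proof.
move=> /bounded_opP[L [M [M0 hM]]].
have [->|x0] := eqVneq x 0; first by rewrite (lin0 L) !nm0 mulr0.
have nx := nm_gt0 x0.
have -> : T x = (nm x)%:C *: T ((nm x)^-1%:C *: x).
  by rewrite (linZ L) scalerA -rmorphM/= divff ?gt_eqF// scale1r.
rewrite nmZr ?nm_ge0// mulrC ler_pM2r//; apply: ub_le_sup.
  exists M => _ [y /= y1 <-]; apply: le_trans (hM y) _; rewrite ler_piMr//.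
  by rewrite -norm_le1.
exists ((nm x)^-1%:C *: x) => //=.
by rewrite norm_le1 nmZr ?invr_ge0 ?nm_ge0// mulVf ?gt_eqF.
Qed.

(** Total boundedness, the usable form of compactness: completeness turns it
    into convergence along every ultrafilter. *)
Lemma compact_opP T : compact_op T <-> bounded_op T /\
  forall e : R, 0 < e -> exists s : seq K, forall x, nm x <= 1 ->
    exists2 y, y \in s & nm (T x - y) < e.
Proof.
split=> [[bT cT]|[bT tb]]; split=> //.
  move=> e e0; move: cT; rewrite precompactE compact_cover.
  move=> /(_ K setT (fun y => ball y e%:C)) [||D _ hD].
  - by move=> y _; apply: ball_open.
  - by move=> y _; exists y => //; apply: ballxx; rewrite ltcR.
  exists (finmap.enum_fset D) => x x1.
  have [|y yD] := hD (T x).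
    apply: subset_closure; exists x => //=.
    by rewrite norm_le1.
  by rewrite -ball_normE /= distrC normE ltcR; exists y.
rewrite precompactE compact_ultra => F FU Fc.
have [|y hy] := @complete_tends R K F _ K id.
  move=> e e0; have [//|s hs] := tb (e / 2); first by rewrite divr_gt0.
  have [|y ys hy] := @ultra_seq K F K s (fun y => [set z | nm (z - y) < e]) FU.
    apply: filterS Fc => z zc /=.
    have [|w [[x x1 <-]]] := zc (ball z (e / 2)%:C).
      by apply: nbhsx_ballx; rewrite ltcR divr_gt0.
    rewrite -ball_normE /= normE ltcR => zx.
    have [|y ys yx] := hs x; first by rewrite -norm_le1.
    exists y => //.
    have -> : z - y = (z - T x) + (T x - y) by rewrite addrA subrK.
    by apply: le_lt_trans (nmD _ _) _; rewrite [e]splitr ltrD.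
  by exists y.
have Fy : F --> y.
  have /cvgrPdist_lt : forall e : R[i], 0 < e -> \forall t \near F, `|y - t| < e.
    move=> e e0; have e0' : (complex.Re e)%:C = e by rewrite RRe_real// gtr0_real.
    have := hy (complex.Re e); rewrite -ltcR e0' => /(_ e0).
    by apply: filterS => t; rewrite -ltcR e0' -normE distrC.
  by [].
exists y; split => //.
move=> B By.
move: By; rewrite nbhsE => -[O [oO Oy] OB].
have FO : F O by apply: Fy; apply: open_nbhs_nbhs.
have [w [wc wO]] := filter_ex (filterI Fc FO).
have [v [vT vO]] := wc O (open_nbhs_nbhs (conj oO wO)).
by exists v; split=> //; apply: OB.
Qed.

Lemma compact_ultra_tends T I (U : set_system I) (x : I -> H) (B : R) :
  compact_op T -> UltraFilter U -> (forall i, nm (x i) <= B) ->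
  exists y, tends U (T \o x) y.
Proof.
move=> /compact_opP[bT tb] UU hx; apply: complete_tends => e e0.
pose B1 := `|B| + 1.
have B1p : 0 < B1 by rewrite ltr_wpDl.
have [|s hs] := tb (e / B1); first by rewrite divr_gt0.
have [|y ys hy] := @ultra_seq I U K s
    (fun y => [set i | nm (T (B1^-1%:C *: x i) - y) < e / B1]) UU.
  apply: filterS filterT => i _; apply: hs.
  rewrite nmZr ?invr_ge0 ?(ltW B1p)// mulrC ler_pdivrMr// mul1r.
  by rewrite (le_trans (hx i))// (le_trans (ler_norm _))// lerDl.
exists (B1%:C *: y); apply: filterS hy => i /= h.
have -> : T (x i) - B1%:C *: y = B1%:C *: (T (B1^-1%:C *: x i) - y).
  rewrite scalerBr (linZ bT.1) scalerA -rmorphM/= divff ?gt_eqF//.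
  by rewrite scale1r.
by rewrite nmZr ?(ltW B1p)// mulrC -ltr_pdivlMr.
Qed.

End Bounded.

(** * Orthogonal projection and adjoints *)

Section Projection.
Variables (R : realType) (H : hilbertType R).
Implicit Types (M : set H).

Definition subsp M := M 0 /\ forall a x y, M x -> M y -> M (a *: x + y).

Definition nclosed M :=
  forall y, (forall e : R, 0 < e -> exists2 x, M x & nm (x - y) < e) -> M y.

Lemma subspZ M a x : subsp M -> M x -> M (a *: x).
Proof. by move=> [M0 MP] Mx; have := MP a _ _ Mx M0; rewrite addr0. Qed.

Lemma subspD M x y : subsp M -> M x -> M y -> M (x + y).
Proof. by move=> [M0 MP] Mx My; have := MP 1 _ _ Mx My; rewrite scale1r. Qed.

Lemma subspB M x y : subsp M -> M x -> M y -> M (x - y).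
Proof.
move=> sM Mx My; apply: subspD => //; rewrite -scaleN1r; exact: subspZ.
Qed.

Lemma nclosed_tends M (T : Type) (F : set_system T) {FF : ProperFilter F}
    (x : T -> H) y : nclosed M -> (forall t, M (x t)) -> tends F x y -> M y.
Proof.
move=> cM Mx h; apply: cM => e e0.
by have [t ht] := filter_ex (h _ e0); exists (x t).
Qed.

(** By the parallelogram law a minimising sequence for the distance to [x] is
    Cauchy; its limit is the foot of the perpendicular. *)
Lemma projection M x : subsp M -> nclosed M ->
  exists2 m, M m & forall y, M y -> '[x - m, y] = 0.
Proof.
move=> sM cM.
pose A := [set nm (x - y) | y in M].
have A0 : has_inf A.
  split; first by exists (nm (x - 0)), 0 => //; case: sM.
  by exists 0 => _ [y _ <-]; apply: nm_ge0.
pose d := inf A.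
have d_le y : M y -> d <= nm (x - y).
  by move=> My; apply: ge_inf; [case: A0 | exists y].
have d0 : 0 <= d by apply: lb_le_inf; [case: A0 | move=> _ [y _ <-]; apply: nm_ge0].
have /choice[m hm] : forall n : nat, exists y, M y /\ nm (x - y) < d + n.+1%:R^-1.
  move=> n; have e0 : 0 < n.+1%:R^-1 :> R by rewrite invr_gt0 ltr0n.
  have [_ [y My <-] h] := inf_adherent e0 A0.
  by exists y.
(* the midpoint of [m p] and [m q] is in [M], hence at distance at least [d] *)
have key p q : nm (m p - m q) ^+ 2 <=
    2 * ((d + p.+1%:R^-1) ^+ 2 + (d + q.+1%:R^-1) ^+ 2) - 4 * d ^+ 2.
  have [Mp hp] := hm p; have [Mq hq] := hm q.
  have := parallelogram (x - m q) (x - m p).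
  have -> : (x - m q) - (x - m p) = m p - m q by rewrite opprB addrC addrA subrK.
  have -> : (x - m q) + (x - m p) = (2%:C) *: (x - (2^-1)%:C *: (m p + m q)).
    rewrite scalerBr scalerA -rmorphM/= divff// scale1r rmorph_nat.
    by rewrite scaler_nat mulr2n [LHS]addrACA opprD [- m q + _]addrC.
  rewrite nmZr// exprMn => h.
  have hd : d <= nm (x - (2^-1)%:C *: (m p + m q)).
    by apply: d_le; apply: subspZ => //; apply: subspD.
  have h1 : nm (x - m q) ^+ 2 <= (d + q.+1%:R^-1) ^+ 2.
    by rewrite ler_sqr ?nnegrE ?nm_ge0 ?addr_ge0 ?invr_ge0 ?ler0n// ltW.
  have h2 : nm (x - m p) ^+ 2 <= (d + p.+1%:R^-1) ^+ 2.
    by rewrite ler_sqr ?nnegrE ?nm_ge0 ?addr_ge0 ?invr_ge0 ?ler0n// ltW.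
  have h3 : d ^+ 2 <= nm (x - (2^-1)%:C *: (m p + m q)) ^+ 2.
    by rewrite ler_sqr ?nnegrE ?nm_ge0.
  move: h h1 h2 h3; set u1 := nm (x - _) ^+ 2; set u2 := nm (_ - _) ^+ 2.
  set u3 := nm (x - m q) ^+ 2; set u4 := nm (x - m p) ^+ 2.
  set v1 := (d + q.+1%:R^-1) ^+ 2; set v2 := (d + p.+1%:R^-1) ^+ 2.
  by set v3 := d ^+ 2; clearbody u1 u2 u3 u4 v1 v2 v3; lra.
have [|y hy] := @complete_tends R nat \oo _ H m.
  move=> e e0.
  pose t := Num.min 1 (e ^+ 2 / (4 * (2 * d + 1)) / 2).
  have t0 : 0 < t by rewrite lt_min ltr01 !divr_gt0 ?exprn_gt0 ?mulr_gt0// ltr_wpDl// mulr_ge0.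
  have [N hN] := small_inv t0.
  exists (m N); exists N => //= n /= nN.
  rewrite -ltr_sqr ?nnegrE ?nm_ge0 ?(ltW e0)//.
  apply: le_lt_trans (key n N) _.
  have hn := hN n nN; have hN0 := hN N (leqnn N).
  have n0 : 0 < n.+1%:R^-1 :> R by rewrite invr_gt0 ltr0n.
  have N0 : 0 < N.+1%:R^-1 :> R by rewrite invr_gt0 ltr0n.
  have hb a : 0 < a -> a < t -> (d + a) ^+ 2 <= d ^+ 2 + t * (2 * d + 1).
    move=> a0 at_; have t1 : t <= 1 by rewrite ge_min lexx.
    have : a * (2 * d) <= t * (2 * d) by rewrite ler_wpM2r ?mulr_ge0// ltW.
    have : a * a <= t * 1.
      by apply: ler_pM; rewrite ?(ltW a0) ?(ltW at_)// (le_trans (ltW at_)).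
    by rewrite sqrrD; lra.
  have b1 := hb _ n0 hn; have b2 := hb _ N0 hN0.
  have : t * (2 * d + 1) * 4 < e ^+ 2.
    have tl : t <= e ^+ 2 / (4 * (2 * d + 1)) / 2 by rewrite ge_min lexx orbT.
    rewrite -mulrA -ltr_pdivlMr; last by rewrite mulr_gt0// ltr_wpDl// mulr_ge0.
    apply: le_lt_trans tl _; rewrite [_ * 4]mulrC ltr_pdivrMr//.
    rewrite ltr_pMr ?ltr1n// divr_gt0 ?exprn_gt0// mulr_gt0// ltr_wpDl// mulr_ge0//.
  move: b1 b2; set v1 := (d + n.+1%:R^-1) ^+ 2; set v2 := (d + N.+1%:R^-1) ^+ 2.
  by set v3 := d ^+ 2; clearbody v1 v2 v3; lra.
have My : M y by apply: (nclosed_tends cM _ hy) => n; case: (hm n).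
exists y => // z Mz.
have dy : nm (x - y) <= d.
  apply/ler_addgt0Pr => e e0.
  have e2 : 0 < e / 2 by rewrite divr_gt0.
  have [N hN] := small_inv e2.
  near \oo => n.
  have -> : x - y = (x - m n) + (m n - y) by rewrite addrA subrK.
  apply: le_trans (nmD _ _) _.
  have h1 : nm (m n - y) < e / 2 by near: n; apply: hy; rewrite divr_gt0.
  have [_ h2] := hm n.
  have h3 : n.+1%:R^-1 < e / 2 by apply: hN; near: n; exists N.
  move: h2 h3; set v1 := n.+1%:R^-1; clearbody v1; lra.
(* otherwise moving [y] along [z] would decrease the distance *)
have [->|z0] := eqVneq z 0; first by rewrite ip0r.
have nz := nm_gt0 z0.
pose c := '[x - y, z] / (nm z ^+ 2)%:C.
have dm : d <= nm (x - y - c *: z).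
  have -> : x - y - c *: z = x - (y + c *: z) by rewrite opprD addrA.
  by apply: d_le; apply: subspD => //; apply: subspZ.
have : d ^+ 2 <= nm (x - y - c *: z) ^+ 2 by rewrite ler_sqr ?nnegrE ?nm_ge0.
rewrite nmB_sqr nmZ ipZr.
have -> : Num.conj c * '[x - y, z] = (nm '[x - y, z] ^+ 2 / nm z ^+ 2)%:C.
  by rewrite /c rmorphM/= fmorphV/= conjR mulrAC [_^* * _]mulrC mulJr -fmorphV -rmorphM.
rewrite /c nmM nmV nmR [`|_|]ger0_norm ?sqr_ge0//=.
have : nm (x - y) ^+ 2 <= d ^+ 2 by rewrite ler_sqr ?nnegrE ?nm_ge0.
have -> : (nm '[x - y, z] / nm z ^+ 2 * nm z) ^+ 2 = nm '[x - y, z] ^+ 2 / nm z ^+ 2.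
  by field; rewrite gt_eqF.
move=> h1 h2.
have : nm '[x - y, z] ^+ 2 / nm z ^+ 2 <= 0 by lra.
rewrite pmulr_lle0 ?invr_gt0 ?exprn_gt0// => h.
by apply/nm_eq0/eqP; rewrite -sqrf_eq0 eq_le h sqr_ge0.
Unshelve. all: by end_near. Qed.

Definition perp (S : set H) := [set x | forall v, S v -> '[x, v] = 0].

Lemma subsp_perp S : subsp (perp S).
Proof.
split=> [v _|a x y hx hy v Sv]; first by rewrite ip0l.
by rewrite ipDl ipZl hx// hy// mulr0 addr0.
Qed.

Lemma nclosed_perp S : nclosed (perp S).
Proof.
move=> y hy v Sv; apply/nm_eq0/le_anti; rewrite nm_ge0 andbT.
apply/ler_addgt0Pr => e e0; rewrite add0r.
have B1 : 0 < nm v + 1 by rewrite ltr_wpDl// nm_ge0.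
have [x hx xy] := hy _ (divr_gt0 e0 B1).
have -> : '[y, v] = - '[x - y, v] by rewrite ipBl hx// sub0r opprK.
rewrite nmN; apply: le_trans (cauchy_schwarz _ _) _.
apply: (@le_trans _ _ (nm (x - y) * (nm v + 1))).
  by rewrite ler_wpM2l ?nm_ge0// lerDl.
by rewrite -ler_pdivlMr// ltW.
Qed.

(** A nonzero functional is determined by a vector orthogonal to its kernel. *)
Lemma riesz (f : H -> R[i]) (B : R) :
  (forall a x y, f (a *: x + y) = a * f x + f y) ->
  (forall x, nm (f x) <= B * nm x) -> exists z, forall x, f x = '[x, z].
Proof.
move=> L hB.
have f0 : f 0 = 0.
  by have := L (-1) 0 0; rewrite scaler0 addr0 mulN1r addNr.
have fB x y : f (x - y) = f x - f y.
  by rewrite addrC -scaleN1r L mulN1r addrC.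
have [h|] := pselect (forall x, f x = 0); first by exists 0 => x; rewrite ip0r h.
move=> /existsNP[x0 /eqP fx0].
pose M := [set x | f x = 0].
have sM : subsp M.
  by split=> // a x y; rewrite /M /= L => -> ->; rewrite mulr0 addr0.
have cM : nclosed M.
  move=> y hy; apply/nm_eq0/le_anti; rewrite nm_ge0 andbT.
  apply/ler_addgt0Pr => e e0; rewrite add0r.
  have B1 : 0 < `|B| + 1 by rewrite ltr_wpDl.
  have [x Mx hx] := hy _ (divr_gt0 e0 B1).
  have -> : f y = - f (x - y) by rewrite fB Mx sub0r opprK.
  rewrite nmN; apply: le_trans (hB _) _.
  apply: (@le_trans _ _ ((`|B| + 1) * nm (x - y))).
    by rewrite ler_wpM2r ?nm_ge0// (le_trans (ler_norm _))// lerDl.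
  by rewrite mulrC -ler_pdivlMr// ltW.
have [m Mm hm] := projection x0 sM cM.
pose w := x0 - m.
have fw : f w != 0 by rewrite /w fB Mm subr0.
have w0 : '[w, w] != 0.
  by apply: contra fw => /eqP/ip_eq0->; rewrite f0.
exists (Num.conj (f w / '[w, w]) *: w) => x.
rewrite ipZr Num.Theory.conjCK.
have : '[w, x - (f x / f w) *: w] = 0.
  apply: hm; rewrite /M /= fB -[_ *: w]addr0 L f0 addr0 divfK// subrr.
  by [].
move=> /ip_eq0C; rewrite ipBl ipZl => /subr0_eq ->.
by field; rewrite fw w0.
Qed.

End Projection.

Section Adjoint.
Variable R : realType.
Variables H K : hilbertType R.
Implicit Types (T : H -> K).

Lemma adjoint_exists T : bounded_op T ->
  exists S : K -> H, forall x y, '[T x, y] = '[x, S y].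
Proof.
move=> /bounded_opP[L [M [M0 hM]]].
suff /choice[S hS] : forall y, exists z, forall x, '[T x, y] = '[x, z].
  by exists S => x y; apply: hS.
move=> y; apply: (@riesz _ _ _ (M * nm y)) => [a x x'|x].
  by rewrite (linP L) ipDl ipZl.
apply: le_trans (cauchy_schwarz _ _) _.
by rewrite mulrAC ler_wpM2r ?nm_ge0.
Qed.

Lemma adjE T x y : bounded_op T -> '[T x, y] = '[x, adjoint T y].
Proof.
move=> /adjoint_exists[S hS]; rewrite /adjoint.
by case: xgetP => [? _ h|/(_ S)//]; apply: h.
Qed.

Lemma adjEr T x y : bounded_op T -> '[adjoint T y, x] = '[y, T x].
Proof. by move=> bT; rewrite ipC -adjE// -ipC. Qed.

Lemma adj_eq T (S : K -> H) : bounded_op T ->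
  (forall x y, '[T x, y] = '[x, S y]) -> adjoint T = S.
Proof.
move=> bT h; apply/funext => y; apply: ip_extr => x.
by rewrite -adjE// h.
Qed.

Lemma bounded_adj T : bounded_op T -> bounded_op (adjoint T).
Proof.
move=> bT; have /bounded_opP[L [M [M0 hM]]] := bT.
apply/bounded_opP; split=> [a x y|].
  apply: ip_extr => z.
  by rewrite -adjE// !ipDr !ipZr -!adjE.
exists M; split=> // y; apply: nm_le_ip => [|x]; first by rewrite mulr_ge0 ?nm_ge0.
rewrite adjEr//; apply: le_trans (cauchy_schwarz _ _) _.
by rewrite mulrC -mulrA [_ * nm x]mulrC mulrA ler_wpM2r ?nm_ge0.
Qed.

End Adjoint.

Section AdjointAlgebra.
Variable R : realType.
Variables H K L : hilbertType R.

Lemma adjK (T : H -> K) : bounded_op T -> adjoint (adjoint T) = T.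
Proof.
move=> bT; apply: adj_eq; first exact: bounded_adj.
by move=> x y; rewrite adjEr.
Qed.

Lemma bounded_comp (S : K -> L) (T : H -> K) :
  bounded_op S -> bounded_op T -> bounded_op (S \o T).
Proof.
move=> /bounded_opP[LS [M [M0 hM]]] /bounded_opP[LT [N [N0 hN]]].
apply/bounded_opP; split=> [a x y|].
  by rewrite /= (linP LT) (linP LS).
exists (M * N); split=> [|x /=]; first by rewrite mulr_ge0.
by apply: le_trans (hM _) _; rewrite -mulrA ler_wpM2l.
Qed.

Lemma adj_comp (S : K -> L) (T : H -> K) : bounded_op S -> bounded_op T ->
  adjoint (S \o T) = adjoint T \o adjoint S.
Proof.
move=> bS bT; apply: adj_eq; first exact: bounded_comp.
by move=> x y /=; rewrite !adjE.
Qed.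

Lemma boundedB (S T : H -> K) :
  bounded_op S -> bounded_op T -> bounded_op (S \- T).
Proof.
move=> /bounded_opP[LS [M [M0 hM]]] /bounded_opP[LT [N [N0 hN]]].
apply/bounded_opP; split=> [a x y|].
  by rewrite /= (linP LT) (linP LS) scalerBr opprD addrACA.
exists (M + N); split=> [|x /=]; first by rewrite addr_ge0.
by rewrite mulrDl; apply: le_trans (nmB _ _) _; rewrite lerD.
Qed.

Lemma boundedD (S T : H -> K) :
  bounded_op S -> bounded_op T -> bounded_op (S \+ T).
Proof.
move=> /bounded_opP[LS [M [M0 hM]]] /bounded_opP[LT [N [N0 hN]]].
apply/bounded_opP; split=> [a x y|].
  by rewrite /= (linP LT) (linP LS) scalerDr addrACA.
exists (M + N); split=> [|x /=]; first by rewrite addr_ge0.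
by rewrite mulrDl; apply: le_trans (nmD _ _) _; rewrite lerD.
Qed.

Lemma bounded_id : bounded_op (@id H).
Proof.
apply/bounded_opP; split=> [a x y //|].
by exists 1; split=> // x; rewrite mul1r.
Qed.

Lemma bounded0 : bounded_op (fun _ : H => 0 : K).
Proof.
apply/bounded_opP; split=> [a x y|]; first by rewrite scaler0 addr0.
by exists 0; split=> // x; rewrite nm0 mul0r.
Qed.

Lemma adj_id : adjoint (@id H) = id.
Proof. by apply: adj_eq => //; apply: bounded_id. Qed.

Lemma adjD (S T : H -> K) : bounded_op S -> bounded_op T ->
  adjoint (S \+ T) = adjoint S \+ adjoint T.
Proof.
move=> bS bT; apply: adj_eq; first exact: boundedD.
by move=> x y /=; rewrite ipDl ipDr !adjE.
Qed.

End AdjointAlgebra.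

(** * Unitary operators moving one family onto another *)

Section Unitary.
Variables (R : realType) (H : hilbertType R).
Implicit Types (U V W : H -> H).

Lemma unitaryI U V : linear U -> (forall x y, '[U x, y] = '[x, V y]) ->
  cancel U V -> cancel V U -> unitary_op U.
Proof.
move=> L adjUV UK VK.
have bU : bounded_op U.
  apply/bounded_opP; split=> //; exists 1; split=> // x.
  rewrite mul1r -ler_sqr ?nnegrE ?nm_ge0//.
  by rewrite !nm_sqr adjUV UK.
have aU : adjoint U = V by apply: adj_eq.
by split=> //; rewrite aU; apply/funext => x /=; rewrite ?UK ?VK.
Qed.

Section Theory.
Variables (U : H -> H) (uU : unitary_op U).

Lemma unitary_bounded : bounded_op U.
Proof. by case: uU. Qed.

Lemma unitary_lin : linear U.
Proof. by case: unitary_bounded. Qed.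

Lemma unitaryK : cancel U (adjoint U).
Proof. by case: uU => _ h _ x; have := congr1 (@^~ x) h. Qed.

Lemma unitaryKV : cancel (adjoint U) U.
Proof. by case: uU => _ _ h x; have := congr1 (@^~ x) h. Qed.

Lemma unitary_ip x y : '[U x, U y] = '[x, y].
Proof. by rewrite adjE ?unitaryK//; exact: unitary_bounded. Qed.

Lemma unitary_nm x : nm (U x) = nm x.
Proof.
by apply/eqP; rewrite -(eqrXn2 (n:=2)) ?nm_ge0// !nm_sqr unitary_ip.
Qed.

Lemma unitary_adj : unitary_op (adjoint U).
Proof.
case: (uU) => bU h1 h2.
by split; rewrite ?adjK//; exact: bounded_adj.
Qed.

End Theory.

Lemma unitary_id : unitary_op (@id H).
Proof. by split; rewrite ?adj_id//; exact: bounded_id. Qed.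

Lemma unitary_comp U V : unitary_op U -> unitary_op V -> unitary_op (U \o V).
Proof.
move=> uU uV; have bU := unitary_bounded uU; have bV := unitary_bounded uV.
split; first exact: bounded_comp.
  by rewrite adj_comp//; apply/funext => x /=; rewrite !unitaryK.
by rewrite adj_comp//; apply/funext => x /=; rewrite !unitaryKV.
Qed.

(** With [w = a - b] and [k = <a, w>], the map [x - (<x, w> / k) w] sends [a]
    to [b]; as [|a| = |b|] gives [k + k^* = |w|^2], it is a rotation of the
    line of [w]. *)
Lemma reflection (a b : H) : nm a = nm b ->
  exists2 W, unitary_op W & W a = b /\ forall x, '[x, a - b] = 0 -> W x = x.
Proof.
move=> hab; have [->|ab] := eqVneq a b.
  by exists id => //; exact: unitary_id.
pose w := a - b; pose k := '[a, w].
have w0 : w != 0 by rewrite subr_eq0.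
have hk : k + Num.conj k = '[w, w].
  rewrite /k -ipC /w !ipBl !ipBr [ '[b, b] ]ip_self -hab -ip_self; ring.
have k0 : k != 0.
  apply: contra w0 => /eqP k0; apply/eqP/ip_eq0.
  by rewrite -hk k0 rmorph0 addr0.
have k0' : Num.conj k != 0 by rewrite conjC_eq0.
exists (fun x => x - ('[x, w] / k) *: w); last first.
  split=> [|x ->]; last by rewrite mul0r scale0r subr0.
  by rewrite divff// scale1r /w subKr.
have key s t x : s + t = '[w, w] -> s != 0 -> t != 0 ->
    x - ('[x, w] / s) *: w - ('[x - ('[x, w] / s) *: w, w] / t) *: w = x.
  move=> st s0 t0; rewrite -addrA -opprD -scalerDl ipBl ipZl -st.
  suff -> : '[x, w] / s + ('[x, w] - '[x, w] / s * (s + t)) / t = 0.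
    by rewrite scale0r subr0.
  by field; rewrite s0 t0.
apply: (@unitaryI _ (fun x => x - ('[x, w] / Num.conj k) *: w)).
- move=> c x y; rewrite ipDl ipZl mulrDl -mulrA scalerDl -scalerA.
  by rewrite (scalerBr c x) opprD; exact: addrACA.
- move=> x y; rewrite ipBl ipBr ipZl ipZr rmorphM/= fmorphV/= Num.Theory.conjCK -ipC.
  by rewrite mulrAC [_ / k * _ in RHS]mulrAC [ '[w, y] * _]mulrC.
- by move=> x /=; apply: key.
- by move=> x /=; apply: key => //; rewrite addrC.
Qed.

Definition same_gram (u v : nat -> H) (n : nat) :=
  forall i j, (i < n)%N -> (j < n)%N -> '[u i, u j] = '[v i, v j].

(** The reflection that corrects the image of the last vector fixes the earlier
    ones: equality of the Gram matrices makes the error orthogonal to them. *)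
Lemma gram_unitary u v n : same_gram u v n ->
  exists2 U, unitary_op U & forall i, (i < n)%N -> U (u i) = v i.
Proof.
elim: n => [|n IH] h; first by exists id => //; exact: unitary_id.
have [i j hi hj|U uU hU] := IH; first by apply: h; exact: ltnW.
have [|W uW [Wa Wx]] := @reflection (U (u n)) (v n).
  rewrite unitary_nm//; apply/eqP.
  by rewrite -(eqrXn2 (n:=2)) ?nm_ge0// !nm_sqr h.
exists (W \o U) => [|i]; first exact: unitary_comp.
rewrite ltnS leq_eqVlt => /orP[/eqP->//|ni] /=.
rewrite hU// Wx// ipBr -{1}(hU i ni) unitary_ip// h ?subrr//.
exact: ltnW.
Qed.

Definition total_seq (u : nat -> H) := forall x (e : R), 0 < e ->
  exists N, exists c : nat -> R[i], nm (x - \sum_(i < N) c i *: u i) < e.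

(** On the dense span the sequence is eventually constant, and unitaries are
    isometric, hence it is Cauchy everywhere. *)
Lemma strong_limit (Un : nat -> H -> H) u v :
  (forall n, unitary_op (Un n)) -> total_seq u ->
  (forall n i, (i < n)%N -> Un n (u i) = v i) ->
  forall x, exists y, tends \oo (fun n => Un n x) y.
Proof.
move=> uU tu hU x; apply: complete_tends => e e0.
have [N [c hc]] := tu x e e0.
exists (\sum_(i < N) c i *: v i); exists N => //= n /= nN.
have L := unitary_lin (uU n).
suff -> : \sum_(i < N) c i *: v i = Un n (\sum_(i < N) c i *: u i).
  by rewrite -(linB L) unitary_nm.
rewrite (lin_sum L); apply: eq_bigr => i _.
by rewrite (linZ L) hU// (leq_trans (ltn_ord i)).
Qed.

(** The unitaries of [gram_unitary] for longer and longer initial segments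
    converge strongly, and so do their inverses. *)
Lemma gram_unitary_total u v : (forall n, same_gram u v n) ->
  total_seq u -> total_seq v ->
  exists2 U, unitary_op U & forall i, U (u i) = v i.
Proof.
move=> h tu tv.
have /choice[Un hUn] : forall n, exists U, unitary_op U /\
    forall i, (i < n)%N -> U (u i) = v i.
  by move=> n; have [U uU hU] := gram_unitary (h n); exists U.
have uUn n : unitary_op (Un n) by case: (hUn n).
have uVn n := unitary_adj (uUn n).
have hU n i : (i < n)%N -> Un n (u i) = v i by case: (hUn n) => _; apply.
have hV n i : (i < n)%N -> adjoint (Un n) (v i) = u i.
  by move=> ni; rewrite -(hU _ _ ni) unitaryK.
have /choice[U Ulim] := strong_limit uUn tu hU.
have /choice[V Vlim] := strong_limit uVn tv hV.
have L : linear U.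
  move=> a x y; apply: (tends_uniq (Ulim _)).
  apply: tends_near (tendsD (tendsZ a (Ulim x)) (Ulim y)).
  by apply: nearW => n; rewrite (linP (unitary_lin (uUn n))).
have key (A B : nat -> H -> H) (A' B' : H -> H) : (forall n, unitary_op (A n)) ->
    (forall n, cancel (B n) (A n)) ->
    (forall x, tends \oo (A ^~ x) (A' x)) -> (forall x, tends \oo (B ^~ x) (B' x)) ->
    cancel B' A'.
  move=> uA AB hA hB x; apply: (tends_uniq (hA _)).
  apply: (tends_le (B := 1) _ (hB x)); apply: nearW => n.
  rewrite mul1r -{2}(AB n x) -(linB (unitary_lin (uA n))) unitary_nm//.
  by rewrite nmBC.
exists U.
  apply: (@unitaryI _ V) => //.
  - move=> x y; apply: (tends_uniq (tends_ip (Ulim x) (tends_cst y))).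
    apply: tends_near (tends_ip (tends_cst x) (Vlim y)).
    by apply: nearW => n; rewrite -adjE//; exact: unitary_bounded.
  - by apply: (key _ _ _ _ uVn _ Vlim Ulim) => n; exact: unitaryK.
  - by apply: (key _ _ _ _ uUn _ Ulim Vlim) => n; exact: unitaryKV.
move=> i; apply: (tends_uniq (Ulim _)).
apply: tends_near (tends_cst _); exists i.+1 => //= n /= ni.
by rewrite hU.
Qed.

End Unitary.

(** * Finite orthonormal families and dimension *)

Section LinearAlgebra.
Variables (K : fieldType) (V : lmodType K).

Lemma underdetermined m p (B : 'M[K]_(m, p)) : (p < m)%N ->
  exists2 c : 'I_m -> K, (exists i, c i != 0) &
    forall j, \sum_i c i * B i j = 0.
Proof.
move=> pm; pose k := nz_row (kermx B).
have k0 : k != 0.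
  rewrite nz_row_eq0 -mxrank_eq0 mxrank_ker subn_eq0 -ltnNge.
  exact: leq_ltn_trans (rank_leq_col B) pm.
exists (fun i => k 0 i).
  by have /rV0Pn[i hi] := k0; exists i.
have /sub_kermxP hk : (k <= kermx B)%MS by apply: nz_row_sub.
by move=> j; have := congr1 (fun M : 'rV_p => M 0 j) hk; rewrite !mxE.
Qed.

(** More vectors than coordinates leave a linear relation among the
    coordinates. *)
Lemma lin_indep_leq m p (v : 'I_m -> V) (w : 'I_p -> V) :
  lin_indep v -> (forall i, exists c, v i = lin_comb w c) -> (m <= p)%N.
Proof.
move=> iv /choice[A hA]; rewrite leqNgt; apply/negP => pm.
have [c [i ci] hc] := underdetermined (\matrix_(i, j) A i j) pm.
case/eqP: ci; apply: (iv c); rewrite /lin_comb.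
under eq_bigr => k _ do rewrite hA /lin_comb scaler_sumr.
rewrite exchange_big big1// => j _.
under eq_bigr => k _ do rewrite scalerA.
rewrite -scaler_suml; have := hc j.
by under eq_bigr => k _ do rewrite mxE; move=> ->; rewrite scale0r.
Qed.

Lemma lin_comb_delta n (v : 'I_n -> V) i :
  v i = lin_comb v (fun j => (j == i)%:R).
Proof.
rewrite /lin_comb (bigD1 i)//= eqxx scale1r big1 ?addr0// => j /negPf->.
by rewrite scale0r.
Qed.

Lemma has_dim_leq (E F : set V) m p :
  has_dim E m -> has_dim F p -> E `<=` F -> (m <= p)%N.
Proof.
move=> [v iv ->] [w _ ->] EF; apply: (lin_indep_leq iv (w := w)) => i.
have [|c _ <-] := EF (v i); last by exists c.
by exists (fun j => (j == i)%:R) => //; rewrite -lin_comb_delta.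
Qed.

Lemma has_dim_uniq (E : set V) m p : has_dim E m -> has_dim E p -> m = p.
Proof.
move=> hm hp; apply/eqP; rewrite eqn_leq.
by rewrite (has_dim_leq hm hp) // (has_dim_leq hp hm).
Qed.

End LinearAlgebra.

Section Orthonormal.
Variables (R : realType) (H : hilbertType R).
Implicit Types (e : nat -> H) (x y : H).

(** Orthogonal vectors of norm [0] or [1]: zero vectors are allowed so that a
    system of eigenvectors can always be indexed by all natural numbers. *)
Definition suborthonormal e n := forall i j, (i < n)%N -> (j < n)%N ->
  '[e i, e j] = ((i == j) && (e i != 0))%:R.

Definition orthonormal_fam e n := forall i j, (i < n)%N -> (j < n)%N ->
  '[e i, e j] = (i == j)%:R.

Lemma orthonormal_neq0 e n i : orthonormal_fam e n -> (i < n)%N -> e i != 0.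
Proof.
move=> oe ni; apply: contra_eq_neq (oe i i ni ni) => ->.
by rewrite ip0l eqxx eq_sym oner_eq0.
Qed.

Lemma orthonormal_sub e n : orthonormal_fam e n -> suborthonormal e n.
Proof.
by move=> oe i j ni nj; rewrite oe// (orthonormal_neq0 oe ni) andbT.
Qed.

Definition proj e n x := \sum_(i < n) '[x, e i] *: e i.

Lemma proj_lin e n : linear (proj e n).
Proof.
move=> a x y; rewrite /proj scaler_sumr -big_split; apply: eq_bigr => i _.
by rewrite ipDl ipZl scalerDl scalerA.
Qed.

Section Sub.
Variables (e : nat -> H) (n : nat) (oe : suborthonormal e n).

Lemma ip_proj x i : (i < n)%N -> '[proj e n x, e i] = '[x, e i].
Proof.
move=> ni; rewrite ip_suml (bigD1 (Ordinal ni))//= big1 ?addr0 => [|j hj].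
  rewrite ipZl oe// eqxx/=; have [->|] := eqVneq (e i) 0.
    by rewrite ip0r mulr0.
  by rewrite mulr1.
rewrite ipZl oe// (_ : (nat_of_ord j == i) = false) ?mulr0//.
by apply/negP => /eqP ji; case/eqP: hj; apply: val_inj.
Qed.

Lemma ip_res x i : (i < n)%N -> '[x - proj e n x, e i] = 0.
Proof. by move=> ni; rewrite ipBl ip_proj// subrr. Qed.

Lemma ip_proj_perp x y : (forall i, (i < n)%N -> '[x, e i] = 0) ->
  '[x, proj e n y] = 0.
Proof. by move=> h; rewrite ip_sumr big1// => i _; rewrite ipZr h// mulr0. Qed.

Lemma ip_res_proj x y : '[x - proj e n x, proj e n y] = 0.
Proof. by apply: ip_proj_perp => i; exact: ip_res. Qed.

Lemma projK x : proj e n (proj e n x) = proj e n x.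
Proof. by apply: eq_bigr => i _; rewrite ip_proj. Qed.

Lemma proj_in i : (i < n)%N -> proj e n (e i) = e i.
Proof.
move=> ni; rewrite /proj (bigD1 (Ordinal ni))//= big1 ?addr0 => [|j hj].
  rewrite oe// eqxx/=; have [->|] := eqVneq (e i) 0; first by rewrite scaler0.
  by rewrite scale1r.
rewrite oe// (_ : (i == nat_of_ord j) = false) ?scale0r//.
by apply/negP => /eqP ji; case/eqP: hj; apply: val_inj.
Qed.

Lemma proj_pythagoras x :
  nm x ^+ 2 = nm (proj e n x) ^+ 2 + nm (x - proj e n x) ^+ 2.
Proof.
rewrite -pythagoras; last by apply: ip_eq0C; exact: ip_res_proj.
by rewrite addrC subrK.
Qed.

Lemma nm_comb (c : nat -> R[i]) : nm (\sum_(i < n) c i *: e i) ^+ 2 =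
  \sum_(i < n) nm (c i) ^+ 2 * nm (e i) ^+ 2.
Proof.
apply: complexI; rewrite -ip_self ip_suml rmorph_sum; apply: eq_bigr => i _.
rewrite ip_sumr (bigD1 i)//= big1 ?addr0 => [|j hj].
  by rewrite ipZl ipZr mulrA mulJr ip_self -rmorphM.
rewrite ipZl ipZr oe// (_ : (nat_of_ord i == j) = false) ?mulr0//.
by apply/negP => /eqP ji; case/eqP: hj; apply: val_inj.
Qed.

Lemma nm_sub_le1 i : (i < n)%N -> nm (e i) <= 1.
Proof.
move=> ni; have := oe ni ni; rewrite eqxx ip_self => h.
rewrite -(ler_sqr) ?nnegrE ?nm_ge0// expr1n -lecR h.
by case: (e i != 0); rewrite ?lexx ?ler01.
Qed.

Lemma proj_ip_nm x i : (i < n)%N -> nm '[x, e i] ^+ 2 * nm (e i) ^+ 2 = nm '[x, e i] ^+ 2.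
Proof.
move=> ni; have := oe ni ni; rewrite eqxx ip_self /=; have [->|_] := eqVneq (e i) 0.
  by rewrite ip0r !nm0 expr0n mul0r.
by move/complexI ->; rewrite mulr1.
Qed.

Lemma nm_proj x : nm (proj e n x) ^+ 2 = \sum_(i < n) nm '[x, e i] ^+ 2.
Proof.
rewrite (nm_comb (fun i => '[x, e i])); apply: eq_bigr => i _.
by rewrite proj_ip_nm.
Qed.

Lemma bessel x : \sum_(i < n) nm '[x, e i] ^+ 2 <= nm x ^+ 2.
Proof. by rewrite -nm_proj [leRHS]proj_pythagoras lerDl sqr_ge0. Qed.

End Sub.

Definition span_of e n := [set x | proj e n x = x].

Lemma subsp_span e n : subsp (span_of e n).
Proof.
rewrite /span_of; split=> [|a x y]; first exact: (lin0 (@proj_lin e n)).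
by rewrite /= (linP (@proj_lin e n)) => -> ->.
Qed.

Lemma proj_subsp (M : set H) e n x : subsp M ->
  (forall i, (i < n)%N -> M (e i)) -> M (proj e n x).
Proof.
move=> sM hM; rewrite /proj; elim/big_ind: _ => //; first by case: sM.
  by move=> y z; apply: subspD.
by move=> i _; apply: subspZ => //; apply: hM.
Qed.

Lemma orthonormal_indep e n : orthonormal_fam e n -> lin_indep (fun i : 'I_n => e i).
Proof.
move=> oe c hc i; have := congr1 (fun z => '[z, e i]) hc.
rewrite ip0l ip_suml (bigD1 i)//= big1 ?addr0 => [|j hj].
  by rewrite ipZl oe// eqxx mulr1.
rewrite ipZl oe// (_ : (nat_of_ord j == i) = false) ?mulr0//.
by apply/negP => /eqP ji; case/eqP: hj; apply: val_inj.
Qed.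

Lemma span_has_dim e n : orthonormal_fam e n -> has_dim (span_of e n) n.
Proof.
move=> oe; exists (fun i : 'I_n => e i); first exact: orthonormal_indep.
apply/seteqP; split=> [x /= <-|_ [c _ <-]].
  by exists (fun i : 'I_n => '[x, e i]).
rewrite /span_of/= /lin_comb (lin_sum (@proj_lin e n)); apply: eq_bigr => i _.
rewrite (linZ (@proj_lin e n)) proj_in//; exact: orthonormal_sub.
Qed.

Lemma orthonormal_leq e n f m : orthonormal_fam e n ->
  (forall i, (i < n)%N -> span_of f m (e i)) -> (n <= m)%N.
Proof.
move=> oe h; apply: (lin_indep_leq (orthonormal_indep oe) (w := fun i : 'I_m => f i)).
by move=> i; exists (fun j : 'I_m => '[e i, f j]); rewrite -[LHS](h i).
Qed.

(** One step of Gram-Schmidt. *)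
Lemma orthonormal_ext e n x : orthonormal_fam e n -> proj e n x != x ->
  exists2 y, orthonormal_fam (fun i => if (i < n)%N then e i else y) n.+1 &
    proj (fun i => if (i < n)%N then e i else y) n.+1 x = x /\
    exists c, y = c *: (x - proj e n x).
Proof.
move=> oe hx; pose r := x - proj e n x.
have r0 : r != 0 by rewrite subr_eq0 eq_sym.
have nr : nm r != 0 by rewrite gt_eqF// nm_gt0.
pose y := (nm r)^-1%:C *: r.
have oe' := orthonormal_sub oe.
have ye i : (i < n)%N -> '[y, e i] = 0 by move=> ni; rewrite ipZl ip_res// mulr0.
have yy : '[y, y] = 1.
  by rewrite ip_self nmZr ?invr_ge0 ?nm_ge0// mulVf// expr1n.
exists y.
  move=> i j; rewrite !ltnS => hi hj.
  move: hi hj; rewrite (leq_eqVlt i) (leq_eqVlt j).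
  move=> /orP[/eqP->|ni] /orP[/eqP->|nj]; rewrite ?ltnn ?ni ?nj ?eqxx//.
  - by rewrite ye// gtn_eqF.
  - by rewrite ip_eq0C ?ye// ltn_eqF.
  - exact: oe.
split; last by exists (nm r)^-1%:C.
rewrite /proj big_ord_recr/= ltnn.
have -> : \sum_(i < n) '[x, if (i < n)%N then e i else y] *:
    (if (i < n)%N then e i else y) = proj e n x.
  by apply: eq_bigr => i _; rewrite ltn_ord.
suff -> : '[x, y] *: y = r by rewrite addrC subrK.
have -> : '[x, y] = '[r, y].
  rewrite ipBl [X in _ - X](_ : _ = 0) ?subr0//; apply: ip_eq0C.
  exact: ip_proj_perp.
rewrite /y ipZr ip_self scalerA conjR -!rmorphM/=.
suff -> : (nm r)^-1 * nm r ^+ 2 * (nm r)^-1 = 1 by rewrite scale1r.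
by field.
Qed.

Lemma proj_eq e e' n x : (forall i, (i < n)%N -> e i = e' i) ->
  proj e n x = proj e' n x.
Proof. by move=> h; apply: eq_bigr => i _; rewrite h. Qed.

Lemma proj_widen e n m x : orthonormal_fam e m -> (n <= m)%N -> proj e n x = x ->
  proj e m x = x.
Proof.
move=> oe nm hx; rewrite -hx; have L := @proj_lin e m.
rewrite (_ : proj e n x = \sum_(i < n) '[x, e i] *: e i)// (lin_sum L); apply: eq_bigr => i _.
rewrite (linZ L) proj_in ?(leq_trans (ltn_ord i))//; exact: orthonormal_sub.
Qed.

(** The last clause says that the new vectors lie in the span of the given ones,
    in the form of every subspace containing these. *)
Lemma gram_schmidt e n (v : nat -> H) k : orthonormal_fam e n ->
  exists m e', [/\ (n <= m <= n + k)%N, orthonormal_fam e' m,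
    forall i, (i < n)%N -> e' i = e i,
    forall i, (i < k)%N -> proj e' m (v i) = v i &
    forall M, subsp M -> (forall i, (i < n)%N -> M (e i)) ->
      (forall i, (i < k)%N -> M (v i)) -> forall i, (i < m)%N -> M (e' i)].
Proof.
move=> oe; elim: k => [|k [m [f [/andP[nm mk] of_ fe hf hM]]]].
  by exists n, e; split; rewrite ?addn0 ?leqnn// => M _ h _.
have [hv|hv] := eqVneq (proj f m (v k)) (v k).
  exists m, f; split=> //.
  - by rewrite nm (leq_trans mk)// leq_add2l.
  - by move=> i; rewrite ltnS leq_eqVlt => /orP[/eqP->//|]; apply: hf.
  - by move=> M sM h1 h2; apply: hM => // i ik; apply: h2; apply: ltnW.
have [y oy [py [c hy]]] := orthonormal_ext of_ hv.
set g := fun i => _ in oy py.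
have gf i : (i < m)%N -> g i = f i by rewrite /g => ->.
exists m.+1, g; split=> //.
- by rewrite (leq_trans nm)// addnS ltnS.
- by move=> i ni; rewrite gf ?fe// (leq_trans ni).
- move=> i; rewrite ltnS leq_eqVlt => /orP[/eqP->//|ik].
  by apply: (proj_widen (n := m)) => //; rewrite (proj_eq _ gf) hf.
- move=> M sM h1 h2 i; have hMf : forall i, (i < m)%N -> M (f i).
    by apply: hM => // j jk; apply: h2; apply: ltnW.
  rewrite ltnS leq_eqVlt => /orP[/eqP->|im]; last by rewrite gf//; exact: hMf.
  rewrite /g ltnn hy; apply: subspZ => //; apply: subspB => //; first exact: h2.
  exact: proj_subsp.
Qed.

Lemma has_dim_subsp (E : set H) n : has_dim E n -> subsp E.
Proof.
move=> [v _ ->]; split.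
  exists (fun=> 0) => //; rewrite /lin_comb big1// => i _; exact: scale0r.
move=> a _ _ [c _ <-] [d _ <-]; exists (fun i => a * c i + d i) => //.
rewrite /lin_comb scaler_sumr -big_split; apply: eq_bigr => i _.
by rewrite scalerDl scalerA.
Qed.

Lemma has_dim_orthonormal (E : set H) n : has_dim E n ->
  exists2 e, orthonormal_fam e n & E = span_of e n.
Proof.
move=> dE; have sE := has_dim_subsp dE; move: dE => [v iv Ev].
pose w i := if insub i is Some j then v j else 0.
have wv (j : 'I_n) : w j = v j by rewrite /w valK.
have Ew i : (i < n)%N -> E (w i).
  move=> ni; rewrite -[X in w X]/(val (Ordinal ni)) wv Ev.
  by exists (fun j => (j == Ordinal ni)%:R) => //; rewrite -lin_comb_delta.
have o0 : orthonormal_fam (fun=> 0) 0 by [].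
have [m [e [/andP[_ mn] oe _ he hM]]] := gram_schmidt w n o0.
have Ee i : (i < m)%N -> E (e i) by apply: hM.
have nm : m = n.
  apply/eqP; rewrite eqn_leq mn andTb.
  apply: (lin_indep_leq iv (w := fun i : 'I_m => e i)) => i.
  by exists (fun j : 'I_m => '[v i, e j]); rewrite -[LHS]wv -he// wv.
rewrite nm in oe he Ee; exists e => //; apply/seteqP; split=> x /=.
  rewrite Ev => -[c _ <-]; rewrite /lin_comb /span_of/= (lin_sum (@proj_lin e n)).
  by apply: eq_bigr => i _; rewrite (linZ (@proj_lin e n)) -wv he.
by move=> <-; apply: proj_subsp.
Qed.

(** Either orthonormal families extending [e] can be made arbitrarily long, or
    some finite one spans the whole space. *)
Lemma orthonormal_extend e n k : orthonormal_fam e n ->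
  (exists2 e', orthonormal_fam e' (n + k) & forall i, (i < n)%N -> e' i = e i) \/
  (exists e' m, orthonormal_fam e' m /\ forall x, proj e' m x = x).
Proof.
move=> oe; elim: k => [|k [[e' oe' he]|]]; last by right.
  by left; exists e => //; rewrite addn0.
have [h|/existsNP[x /eqP hx]] := pselect (forall x, proj e' (n + k) x = x).
  by right; exists e', (n + k)%N.
have [y oy _] := orthonormal_ext oe' hx.
left; eexists; first by rewrite addnS; exact: oy.
by move=> i ni /=; rewrite (leq_trans ni) ?leq_addr// he.
Qed.

End Orthonormal.

(** * Spectral theorem for compact normal operators *)

Section Normal.
Variables (R : realType) (H : hilbertType R).
Implicit Types (T S A : H -> H) (x y : H) (mu : R[i]).

Lemma normal_comm T x : normal_op T -> adjoint T (T x) = T (adjoint T x).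
Proof. by case=> _ /(congr1 (@^~ x)). Qed.

Lemma normal_nm T x : normal_op T -> nm (adjoint T x) = nm (T x).
Proof.
move=> nT; have bT := nT.1; apply/eqP; rewrite -(eqrXn2 (n:=2)) ?nm_ge0// !nm_sqr.
by rewrite adjEr// adjE// normal_comm.
Qed.

(** [T - mu] is normal, hence has the same kernel as its adjoint. *)
Lemma normal_eigen_adj T mu x : normal_op T -> T x = mu *: x ->
  adjoint T x = Num.conj mu *: x.
Proof.
move=> nT Tx; have bT := nT.1; apply/subr0_eq/nm_eq0/eqP.
rewrite -sqrf_eq0 nmB_sqr normal_nm// Tx nmZ nmZ nmJ ipZr Num.Theory.conjCK.
rewrite adjEr// Tx ipZr ip_self mulrA mulJr -rmorphM/= exprMn.
by apply/eqP; ring.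
Qed.

Lemma normal_ker2 T mu y : normal_op T ->
  T (T y - mu *: y) = mu *: (T y - mu *: y) -> T y = mu *: y.
Proof.
move=> nT; have bT := nT.1; set z := T y - mu *: y => Tz.
apply/subr0_eq/ip_eq0; rewrite -/z {1}/z ipBl adjE// (normal_eigen_adj nT Tz).
by rewrite ipZr Num.Theory.conjCK ipZl subrr.
Qed.

(** Normal operators have no nilpotent part, so algebraic and geometric
    multiplicities agree. *)
Lemma normal_gen_eigenspace T mu : normal_op T ->
  gen_eigenspace T mu = [set x | T x = mu *: x].
Proof.
move=> nT; have L := nT.1.1.
pose N y := T y - mu *: y.
have key k x : iter k N x = 0 -> N x = 0.
  elim: k => [/= ->|[|k] IH //]; first by rewrite /N (lin0 L) scaler0 subrr.
  move=> h; apply: IH; rewrite iterS /N; apply/eqP; rewrite subr_eq0; apply/eqP.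
  by apply: normal_ker2 => //; apply/subr0_eq; move: h; rewrite !iterS.
apply/seteqP; split=> x.
  by move=> [k hk]; apply/subr0_eq; exact: (key k).
by move=> /= h; exists 1%N; rewrite /= h subrr.
Qed.

(** A sequential form of compactness that is visibly inherited by sums and by
    dominated operators such as the adjoint of a normal operator. *)
Definition ultra_compact T := forall (U : set_system nat) (x : nat -> H) (B : R),
  UltraFilter U -> (forall n, nm (x n) <= B) -> exists y, tends U (T \o x) y.

Lemma compact_ultra_compact T : compact_op T -> ultra_compact T.
Proof. by move=> cT U x B UU hx; exact: (compact_ultra_tends cT UU hx). Qed.

Lemma ultra_compact_dominated S T : linear S -> linear T -> ultra_compact T ->
  (forall x, nm (S x) <= nm (T x)) -> ultra_compact S.
Proof.
move=> LS LT cT h U x B UU hx; apply: complete_tends => e e0.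
have [y hy] := cT U x B UU hx.
have e2 : 0 < e / 2 by rewrite divr_gt0.
have [m /= hm] := filter_ex (hy _ e2).
exists (S (x m)); apply: filterS (hy _ e2) => n /= hn.
rewrite -(linB LS); apply: le_lt_trans (h _) _; rewrite (linB LT).
rewrite (_ : T (x n) - T (x m) = (T (x n) - y) - (T (x m) - y)).
  by apply: le_lt_trans (nmB _ _) _; rewrite [e]splitr ltrD.
by rewrite opprB addrA subrK.
Qed.

Lemma ultra_compactD S T : ultra_compact S -> ultra_compact T ->
  ultra_compact (S \+ T).
Proof.
move=> cS cT U x B UU hx; have [y hy] := cS U x B UU hx.
have [z hz] := cT U x B UU hx; exists (y + z).
exact: (tendsD hy hz).
Qed.

(** If [|S x|] is nearly maximal among unit vectors then [x] is nearly an
    eigenvector of [S^* S], and compactness yields an exact one. *)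
Lemma norm_attained S (E : set H) : normal_op S -> ultra_compact S ->
  subsp E -> nclosed E -> (forall x, E x -> E (S x)) ->
  (forall x, E x -> E (adjoint S x)) ->
  (forall x, E x -> S x = 0) \/
  exists c : R, [/\ 0 < c, forall x, E x -> nm (S x) <= c * nm x &
    exists x, [/\ E x, x != 0 & adjoint S (S x) = (c ^+ 2)%:C *: x]].
Proof.
move=> nS cS sE cE SE SaE; have bS := nS.1; have L := bS.1.
have [h0|/existsNP[x0 /not_implyP[Ex0 /eqP Sx0]]] := pselect (forall x, E x -> S x = 0).
  by left.
right.
pose A := [set nm (S x) | x in [set x | E x /\ nm x <= 1]].
have supA : has_sup A.
  split; first by exists (nm (S 0)), 0 => //=; rewrite nm0; split; [case: sE|].
  have [_ [M [M0 hM]]] := (bounded_opP _).1 bS.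
  exists M => _ [x [_ x1] <-]; apply: le_trans (hM x) _; exact: ler_piMr.
pose c := sup A.
have hc x : E x -> nm (S x) <= c * nm x.
  have [->|xn0] := eqVneq x 0; first by rewrite (lin0 L) !nm0 mulr0.
  move=> Ex; have nx := nm_gt0 xn0.
  rewrite -ler_pdivrMr// mulrC; apply: ub_le_sup; first by case: supA.
  exists ((nm x)^-1%:C *: x) => /=.
    by split; [exact: subspZ|rewrite nmZr ?invr_ge0 ?nm_ge0// mulVf// gt_eqF].
  by rewrite (linZ L) nmZr ?invr_ge0 ?nm_ge0.
have c0 : 0 < c.
  have := lt_le_trans (nm_gt0 Sx0) (hc _ Ex0).
  rewrite pmulr_lgt0// nm_gt0//; apply: contra Sx0 => /eqP->.
  by rewrite (lin0 L).
exists c; split=> //.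
have /choice[x hx] : forall n : nat, exists x, [/\ E x, nm x <= 1 & c - n.+1%:R^-1 < nm (S x)].
  move=> n; have e0 : 0 < n.+1%:R^-1 :> R by rewrite invr_gt0 ltr0n.
  by have [_ [x [Ex x1] <-] h] := sup_adherent e0 supA; exists x.
have [U [UU Uc]] := cofinal_ultra_ex; have UP : ProperFilter U := @ultra_proper _ U UU.
have [|y hy] := cS U x 1 UU; first by move=> n; case: (hx n).
have hSy : tends U (adjoint S \o (S \o x)) (adjoint S y).
  exact: tends_bounded (bounded_adj bS) hy.
(* expand the square and use that [|S (S x)| <= c |S x|] *)
have dev n : nm (adjoint S (S (x n)) - (c ^+ 2)%:C *: x n) ^+ 2 <= 2 * c ^+ 3 * n.+1%:R^-1.
  have [Ex x1 xc] := hx n.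
  rewrite nmB_sqr nmZr ?sqr_ge0// normal_nm// adjEr// (linZ L) ipZr conjR ip_self.
  rewrite -rmorphM/=.
  have h1 : nm (S (S (x n))) <= c * nm (S (x n)) by apply: hc; exact: SE.
  have h2 : nm (S (x n)) <= c.
    by apply: le_trans (hc _ Ex) _; rewrite ler_piMr// ltW.
  have h3 : nm (S (S (x n))) ^+ 2 <= (c * nm (S (x n))) ^+ 2.
    by rewrite ler_sqr ?nnegrE ?mulr_ge0 ?nm_ge0// ltW.
  have h4 : (c ^+ 2 * nm (x n)) ^+ 2 <= (c ^+ 2) ^+ 2.
    have h4 : c ^+ 2 * nm (x n) <= c ^+ 2 by rewrite ler_piMr ?sqr_ge0.
    by apply: lerXn2r; rewrite ?nnegrE ?mulr_ge0 ?nm_ge0 ?sqr_ge0 ?(ltW c0).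
  move: xc h2 h3 h4; set a := nm (S (x n)); set d := n.+1%:R^-1.
  set u := nm (S (S (x n))) ^+ 2; set v := (c ^+ 2 * nm (x n)) ^+ 2 => xc h2 h3 h4.
  have a0 : 0 <= a by apply: nm_ge0.
  have d0 : 0 <= d by rewrite invr_ge0 ler0n.
  have h5 : c ^+ 2 * ((c - a) * (c + a)) <= c ^+ 2 * (d * (2 * c)).
    rewrite ler_wpM2l ?sqr_ge0//; apply: ler_pM => //; first by rewrite subr_ge0.
    - by rewrite addr_ge0// ltW.
    - by rewrite lerBlDr addrC -lerBlDr ltW.
    - by clearbody a d u v; lra.
  by move: h3 h4 h5; clearbody a d u v; move=> h3 h4 h5; lra.
have devt : tends U (fun n => adjoint S (S (x n)) - (c ^+ 2)%:C *: x n) 0.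
  move=> e e0; have c3 : 0 < 2 * c ^+ 3 by rewrite mulr_gt0 ?exprn_gt0.
  have [N hN] := small_inv (divr_gt0 (exprn_gt0 2 e0) c3).
  apply: filterS (Uc N) => n /= nN; rewrite subr0 -ltr_sqr ?nnegrE ?nm_ge0 ?(ltW e0)//.
  apply: le_lt_trans (dev n) _; rewrite mulrC -ltr_pdivlMr ?mulr_gt0 ?exprn_gt0//.
  exact: hN.
pose z := (c ^+ 2)^-1%:C *: adjoint S y.
have zt : tends U x z.
  rewrite /z -[adjoint S y]subr0.
  apply: tends_near (tendsZ _ (tendsB hSy devt)); apply: nearW => n /=.
  by rewrite subKr scalerA -rmorphM/= mulVf ?scale1r// expf_neq0// gt_eqF.
have Szt : tends U (S \o x) (S z) by exact: tends_bounded.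
have yE : y = S z by apply: tends_uniq hy Szt.
exists z; split.
- by apply: (nclosed_tends cE _ zt) => n; case: (hx n).
- suff : c <= nm (S z).
    move=> h; apply: contraTneq (lt_le_trans c0 h) => ->.
    by rewrite (lin0 L) nm0 ltxx.
  apply/ler_addgt0Pr => e e0.
  have e2 : 0 < e / 2 by rewrite divr_gt0.
  have [N hN] := small_inv e2.
  have [n [/= h1 h2]] := filter_ex (filterI (Uc N) (Szt _ e2)).
  have [_ _ h3] := hx n; have h4 := hN n h1.
  have := nmD (S (x n) - S z) (S z); rewrite subrK /= in h2 * => h5.
  by move: h3 h4; set d := n.+1%:R^-1; clearbody d; lra.
- rewrite -yE /z scalerA -rmorphM/= divff ?scale1r// expf_neq0// gt_eqF//.
Qed.

Lemma subsp_eigen T mu : linear T -> subsp [set x | T x = mu *: x].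
Proof.
move=> L; split=> [|a x y] /=; first by rewrite (lin0 L) scaler0.
by move=> hx hy; rewrite (linP L) hx hy scalerDr !scalerA mulrC.
Qed.

Lemma nclosed_eigen T mu : bounded_op T -> nclosed [set x | T x = mu *: x].
Proof.
move=> /bounded_opP[L [M [M0 hM]]] y hy /=.
apply/subr0_eq/nm_eq0/le_anti; rewrite nm_ge0 andbT.
apply/ler_addgt0Pr => e e0; rewrite add0r.
have B1 : 0 < M + nm mu + 1 by rewrite ltr_wpDl// addr_ge0// nm_ge0.
have [x /= Tx hx] := hy _ (divr_gt0 e0 B1).
have -> : T y - mu *: y = mu *: (x - y) - T (x - y).
  by rewrite (linB L) Tx scalerBr opprB [RHS]addrC addrA subrK.
apply: le_trans (nmB _ _) _; rewrite nmZ.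
apply: (@le_trans _ _ ((M + nm mu + 1) * nm (x - y))).
  have := hM (x - y); have := nm_ge0 (x - y); lra.
by rewrite mulrC -ler_pdivlMr// ltW.
Qed.

Lemma subspI (E F : set H) : subsp E -> subsp F -> subsp (E `&` F).
Proof.
move=> [E0 hE] [F0 hF]; split=> // a x y [Ex Fx] [Ey Fy].
by split; [apply: hE|apply: hF].
Qed.

Lemma nclosedI (E F : set H) : nclosed E -> nclosed F -> nclosed (E `&` F).
Proof.
move=> hE hF y hy; split; [apply: hE|apply: hF] => e e0;
  by have [x [Ex Fx] hx] := hy e e0; exists x.
Qed.

(** From [A^2 x = c^2 x] one factors [(A - c) (A + c) x = 0]. *)
Lemma self_adjoint_eigen A (E : set H) : bounded_op A -> adjoint A = A ->
  ultra_compact A -> subsp E -> nclosed E -> (forall x, E x -> E (A x)) ->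
  (exists2 x, E x & x != 0) ->
  exists b x, [/\ E x, x != 0 & A x = b *: x].
Proof.
move=> bA aA cA sE cE AE [x Ex x0].
have nA : normal_op A by split; rewrite ?aA.
have AaE y : E y -> E (adjoint A y) by rewrite aA; exact: AE.
have [h|[c [c0 _ [y [Ey y0 hy]]]]] := norm_attained nA cA sE cE AE AaE.
  by exists 0, x; rewrite scale0r h.
rewrite aA in hy.
have [h|h] := eqVneq (A y + c%:C *: y) 0.
  by exists (- c%:C), y; split=> //; rewrite scaleNr; apply/eqP; rewrite -addr_eq0 h.
exists c%:C, (A y + c%:C *: y); split=> //.
  by apply: subspD => //; [exact: AE|exact: subspZ].
rewrite (linD bA.1) (linZ bA.1) hy scalerDr scalerA -rmorphM -expr2.
exact: addrC.
Qed.

(** A vector at which [T] attains its norm [c] is an eigenvector of [T^* T], and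
    this eigenspace reduces [T]. There [T + T^*] has an eigenvector [x], and on [x]
    the operator [T] satisfies the quadratic equation [z^2 - b z + c^2 = 0]. *)
Lemma normal_max_eigen T (E : set H) : normal_op T -> ultra_compact T ->
  subsp E -> nclosed E -> (forall x, E x -> E (T x)) ->
  (forall x, E x -> E (adjoint T x)) ->
  exists e mu, [/\ E e, T e = mu *: e, '[e, e] = (mu != 0)%:R &
    forall x, E x -> nm (T x) <= nm mu * nm x].
Proof.
move=> nT cT sE cE TE TaE; have bT := nT.1; have L := bT.1.
have bTa := bounded_adj bT; have La := bTa.1.
have [h|[c [c0 hc [x0 [Ex0 x00 hx0]]]]] := norm_attained nT cT sE cE TE TaE.
  exists 0, 0; split=> [|||x Ex]; first by case: sE.
  - by rewrite scaler0 (lin0 L).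
  - by rewrite ip0l eqxx.
  - by rewrite h// !nm0 mul0r.
have bTT := bounded_comp bTa bT.
pose E1 := E `&` [set x | (adjoint T \o T) x = (c ^+ 2)%:C *: x].
have sE1 : subsp E1 by apply: subspI => //; apply: subsp_eigen; case: bTT.
have cE1 : nclosed E1 by apply: nclosedI => //; apply: nclosed_eigen.
have TE1 x : E1 x -> E1 (T x).
  move=> [Ex /= hx]; split; first exact: TE.
  by rewrite /= (normal_comm (T x))// hx (linZ L).
have TaE1 x : E1 x -> E1 (adjoint T x).
  move=> [Ex /= hx]; split; first exact: TaE.
  by rewrite /= -(normal_comm x)// hx (linZ La).
pose A := T \+ adjoint T.
have bA : bounded_op A by apply: boundedD.
have aA : adjoint A = A.
  by rewrite /A adjD// adjK//; apply/funext => x /=; rewrite addrC.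
have cA : ultra_compact A.
  apply: ultra_compactD => //; apply: (ultra_compact_dominated La L cT) => x.
  by rewrite normal_nm.
have [||b [x [Ex xn0 Ax]]] := self_adjoint_eigen bA aA cA sE1 cE1.
- by move=> x hx; apply: subspD => //; [exact: TE1|exact: TaE1].
- by exists x0.
have TTx : T (T x) = b *: T x - (c ^+ 2)%:C *: x.
  have Txe : T x = b *: x - adjoint T x by rewrite -Ax /A /= addrK.
  rewrite {1}Txe (linB L) (linZ L) -normal_comm//.
  by case: Ex => _ /= ->.
pose D := sqrtC (b ^+ 2 - 4 * (c ^+ 2)%:C).
pose r1 := (b + D) / 2; pose r2 := (b - D) / 2.
have r12 : r1 + r2 = b by rewrite /r1 /r2; field.
have r1r2 : r1 * r2 = (c ^+ 2)%:C.
  have -> : r1 * r2 = (b ^+ 2 - D ^+ 2) / 4 by rewrite /r1 /r2; field.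
  by rewrite sqrtCK; field.
have [mu [z [Ez z0 Tz]]] : exists mu z, [/\ E1 z, z != 0 & T z = mu *: z].
  have [h|h] := eqVneq (T x - r2 *: x) 0.
    by exists r2, x; split=> //; apply/subr0_eq.
  exists r1, (T x - r2 *: x); split=> //.
    by apply: subspB => //; [exact: TE1|exact: subspZ].
  rewrite (linB L) (linZ L) TTx scalerBr scalerA r1r2 -r12 scalerDl.
  by rewrite addrAC addrK.
have nz := nm_gt0 z0.
have nmu : nm mu = c.
  have [_ /= hz] := Ez.
  have : nm (T z) ^+ 2 = (c * nm z) ^+ 2.
    by rewrite nm_sqr -adjEr// hz ipZl ip_self -rmorphM/= exprMn.
  rewrite Tz nmZ => /eqP; rewrite eqrXn2 ?mulr_ge0 ?nm_ge0 ?(ltW c0)// => /eqP.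
  by apply: mulIf; rewrite gt_eqF.
exists ((nm z)^-1%:C *: z), mu; split.
- by apply: subspZ => //; case: Ez.
- by rewrite (linZ L) Tz !scalerA mulrC.
- rewrite ip_self nmZr ?invr_ge0 ?nm_ge0// mulVf ?(gt_eqF nz)// expr1n.
  rewrite (_ : (mu != 0) = true)//; apply: contraTneq c0 => mu0.
  by rewrite -nmu mu0 nm0 ltxx.
- by rewrite nmu.
Qed.

(** The last clause stands for [T = sum_i l_i <., e_i> e_i]. It does not depend
    on the order of the sequence, so the whole notion is invariant under
    permutations of the indices. The index [i] is padding when [l i = 0], and
    then [e i = 0]. *)
Definition diagonalizes T (e : nat -> H) (l : nat -> R[i]) := [/\
  forall i, T (e i) = l i *: e i,
  forall i j, '[e i, e j] = ((i == j) && (l i != 0))%:R &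
  forall eps : R, 0 < eps -> exists N, forall x,
    (forall i, (i < N)%N -> '[x, e i] = 0) -> nm (T x) <= eps * nm x].

(** Eigenvectors are chosen greedily: the next one realises the norm of [T] on
    the orthogonal complement of those already chosen, and [0] is chosen once
    [T] vanishes there. *)
Theorem spectral_theorem T : normal_op T -> compact_op T ->
  exists e l, [/\ diagonalizes T e l, forall n, nm (l n.+1) <= nm (l n) &
    forall n x, (forall i, (i < n)%N -> '[x, e i] = 0) ->
      nm (T x) <= nm (l n) * nm x].
Proof.
move=> nT cT; have bT := nT.1; have L := bT.1; have La := (bounded_adj bT).1.
have ucT := compact_ultra_compact cT.
pose good (s : seq H) := forall v, v \in s -> exists mu, T v = mu *: v.
have /choice[nxt hnxt] : forall s : seq H, exists p : H * R[i], good s ->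
    [/\ perp [set` s] p.1, T p.1 = p.2 *: p.1, '[p.1, p.1] = (p.2 != 0)%:R &
      forall x, perp [set` s] x -> nm (T x) <= nm p.2 * nm x].
  move=> s; have [gs|] := pselect (good s); last by exists (0, 0).
  have [||e [mu h]] := @normal_max_eigen T (perp [set` s]) nT ucT
    (@subsp_perp _ _ _) (@nclosed_perp _ _ _); last by exists (e, mu).
  - move=> x hx v vs; have [mu Tv] := gs v vs.
    by rewrite adjE// (normal_eigen_adj nT Tv) ipZr hx// mulr0.
  - move=> x hx v vs; have [mu Tv] := gs v vs.
    by rewrite adjEr// Tv ipZr hx// mulr0.
pose s n := iter n (fun s => (nxt s).1 :: s) [::].
pose e n := (nxt (s n)).1; pose l n := (nxt (s n)).2.
have sE n v : v \in s n <-> exists2 i, (i < n)%N & v = e i.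
  elim: n => [|n IH]; first by split=> // -[].
  rewrite [s n.+1]/= inE; split.
    move=> /orP[/eqP->|/IH[i ni ->]]; first by exists n.
    by exists i => //; exact: ltnW.
  move=> [k]; rewrite ltnS leq_eqVlt => /orP[/eqP->|kn] vk; first by rewrite vk eqxx.
  by apply/orP; right; apply/IH; exists k.
have gs n : good (s n).
  elim: n => [//|n IH] v; rewrite [s n.+1]/= inE => /orP[/eqP->|/IH//].
  by exists (l n); have [] := hnxt _ IH.
have perpE n x : (forall i, (i < n)%N -> '[x, e i] = 0) -> perp [set` s n] x.
  by move=> h v /sE[i ni ->]; exact: h.
have Te i : T (e i) = l i *: e i by have [] := hnxt _ (gs i).
have ee i : '[e i, e i] = (l i != 0)%:R by have [] := hnxt _ (gs i).
have ei i j : (j < i)%N -> '[e i, e j] = 0.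
  by move=> ji; have [h _ _ _] := hnxt _ (gs i); apply: h; apply/sE; exists j.
have eij i j : '[e i, e j] = ((i == j) && (l i != 0))%:R.
  have [->|] := eqVneq i j; first by rewrite ee.
  rewrite neq_ltn => /orP[ij|ji]/=; last exact: ei.
  by apply: ip_eq0C; apply: ei.
have tail n x : (forall i, (i < n)%N -> '[x, e i] = 0) -> nm (T x) <= nm (l n) * nm x.
  by move=> /perpE; have [_ _ _] := hnxt _ (gs n); apply.
have ne i : l i != 0 -> nm (e i) = 1.
  move=> li; have := ee i; rewrite li ip_self => /complexI/eqP.
  by rewrite -{1}(expr1n _ 2) eqrXn2 ?nm_ge0// => /eqP.
have ne1 i : nm (e i) <= 1.
  have [l0|/ne->//] := eqVneq (l i) 0.
  by have := ee i; rewrite l0 eqxx => /ip_eq0->; rewrite nm0.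
have mono n : nm (l n.+1) <= nm (l n).
  have [->|ln] := eqVneq (l n.+1) 0; first by rewrite nm0 nm_ge0.
  have := tail n (e n.+1); rewrite Te nmZ ne// !mulr1; apply => i ni.
  by apply: ei; rewrite ltnS ltnW.
exists e, l; split=> //; split=> // eps eps0.
(* otherwise the images of the [e n] would stay [eps] apart *)
suff [N hN] : exists N, nm (l N) <= eps.
  by exists N => x /tail h; apply: le_trans h _; rewrite ler_wpM2r ?nm_ge0.
apply: contrapT => /forallNP h.
have {}h n : eps < nm (l n) by rewrite ltNge; apply/negP.
have [U [UU Uc]] := cofinal_ultra_ex; have UP : ProperFilter U := @ultra_proper _ U UU.
have [y hy] := ucT U e 1 UU ne1.
have e2 : 0 < eps / 2 by rewrite divr_gt0.
have [n /= hn] := filter_ex (hy _ e2).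
have [m [/= nm_ hm]] := filter_ex (filterI (Uc n.+1) (hy _ e2)).
have : nm (T (e n) - T (e m)) < eps.
  have -> : T (e n) - T (e m) = (T (e n) - y) - (T (e m) - y).
    by rewrite opprB addrA subrK.
  by rewrite [eps]splitr; apply: le_lt_trans (nmB _ _) _; rewrite ltrD.
have lgt k : l k != 0 by apply: contraTneq (lt_trans eps0 (h k)) => ->; rewrite nm0 ltxx.
rewrite -ltr_sqr ?nnegrE ?nm_ge0 ?(ltW eps0)// nmB_sqr !Te ipZl ipZr.
rewrite (ip_eq0C (ei _ _ nm_)) !mulr0 subr0 !nmZ !ne// !mulr1.
have : eps ^+ 2 < nm (l n) ^+ 2 by rewrite ltr_sqr ?nnegrE ?nm_ge0 ?(ltW eps0).
have := sqr_ge0 (nm (l m)).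
by move=> h1 h2 h3; have := lt_trans h3 h2; rewrite ltNge lerDl h1.
Qed.

End Normal.

(** * Eigenvalue sequences *)

Section FiberBijection.
Variable V : eqType.
Implicit Types l : nat -> V.

Lemma fiber_bijection l l' :
  (forall v, [set n | l n = v] #= [set n | l' n = v])%card ->
  exists2 s : nat -> nat, bijective s & l' \o s = l.
Proof.
move=> h.
have /choice[f hf] : forall v, exists f, set_bij [set n | l n = v] [set n | l' n = v] f.
  by move=> v; apply/card_set_bijP.
exists (fun n => f (l n) n); last first.
  by apply/funext => n /=; have [h1 _ _] := hf (l n); apply: h1.
rewrite -setTT_bijective; split=> //.
- move=> n m _ _ nm; have [h1 h2 _] := hf (l n); have [h1' _ _] := hf (l m).
  have lnm : l m = l n.
    by have := h1' m erefl; rewrite /= -nm; have := h1 n erefl; move=> /= -> .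
  by rewrite lnm in nm; apply: h2 nm; rewrite inE/=.
- move=> n _; have [_ _ h3] := hf (l' n).
  by have [m /= <- <-] := h3 n erefl; exists m.
Qed.

Lemma bijection_fiber l l' (s : nat -> nat) v : bijective s -> l' \o s = l ->
  ([set n | l n = v] #= [set n | l' n = v])%card.
Proof.
move=> [t sK tK] <-; apply/card_set_bijP; exists s; split.
- by move=> n /=.
- by move=> n m _ _; exact: (can_inj sK).
- by move=> n /= h; exists (t n) => /=; rewrite tK.
Qed.

End FiberBijection.

Section Multiplicity.
Variables (R : realType).

(** The unitary invariant of a compact normal operator, comparing operators on
    possibly different spaces. *)
Definition same_mult (H K : hilbertType R) (S : H -> H) (T : K -> K) :=
  forall mu m, mu != 0 ->
    (has_dim (gen_eigenspace S mu) m <-> has_dim (gen_eigenspace T mu) m).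

Lemma same_mult_sym (H K : hilbertType R) (S : H -> H) (T : K -> K) :
  same_mult S T -> same_mult T S.
Proof. by move=> h mu m mu0; split=> /h; apply. Qed.

Lemma eigenvalue_seq_zero (H : hilbertType R) (T : H -> H) l n m :
  is_eigenvalue_seq T l -> l n = 0 -> (n <= m)%N -> l m = 0.
Proof.
move=> [mono _] ln nm; rewrite -(subnKC nm); elim: (m - n)%N => [|k IH].
  by rewrite addn0.
have := mono (n + k)%N; rewrite IH normr0 addnS => h.
by apply/eqP; rewrite -normr_le0.
Qed.

(** Only the zero entries need an argument: a sequence contains a zero exactly
    when it has finitely many nonzero entries, and then infinitely many zeros. *)
Lemma same_mult_fiber (H K : hilbertType R) (S : H -> H) (T : K -> K) l l' :
  is_eigenvalue_seq S l -> is_eigenvalue_seq T l' -> same_mult S T ->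
  forall mu, ([set n | l n = mu] #= [set n | l' n = mu])%card.
Proof.
move=> hl hl' ST.
have nz mu : mu != 0 -> ([set n | l n = mu] #= [set n | l' n = mu])%card.
  move=> mu0; have [m dm cm] := hl.2 _ mu0; have [m' dm' cm'] := hl'.2 _ mu0.
  have mm' : m = m' by apply: (has_dim_uniq _ dm'); apply/ST.
  by apply: card_eq_trans cm _; rewrite mm' card_eq_sym.
have zero (H1 K1 : hilbertType R) (S1 : H1 -> H1) (T1 : K1 -> K1) k k' :
    is_eigenvalue_seq S1 k -> is_eigenvalue_seq T1 k' ->
    (forall mu, mu != 0 -> ([set n | k n = mu] #= [set n | k' n = mu])%card) ->
    (exists n, k n = 0) -> exists n, k' n = 0.
  move=> hk hk' kk' [n0 kn0]; apply: contrapT => /forallNP k'0.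
  have /choice[f hf] : forall n, exists f,
      set_bij [set i | k' i = k' n] [set i | k i = k' n] f.
    move=> n; apply/card_set_bijP; rewrite card_eq_sym; apply: kk'.
    exact/eqP/k'0.
  have /choice[F hF] : forall mu : R[i], exists f, mu != 0 ->
      set_bij [set i | k' i = mu] [set i | k i = mu] f.
    move=> mu; have [->|mu0] := eqVneq mu 0; first by exists id.
    have : ([set i | k' i = mu] #= [set i | k i = mu])%card.
      by rewrite card_eq_sym; apply: kk'.
    by move=> /card_set_bijP[g hg]; exists g.
  have k'n n : k' n != 0 by apply/eqP/k'0.
  have kF n : k (F (k' n) n) = k' n.
    by have [h1 _ _] := hF _ (k'n n); apply: h1.
  have Finj : {in setT &, injective (fun n => F (k' n) n)}.
    move=> n m _ _ nm; have lnm : k' m = k' n by rewrite -(kF n) -(kF m) nm.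
    have [_ h2 _] := hF _ (k'n n); rewrite /= lnm in nm.
    by apply: h2 nm; rewrite inE/=.
  have : infinite_set [set: nat] by exact: infinite_nat.
  apply; have : ([set: nat] #<= `I_n0)%card.
    apply: card_le_trans (subset_card_le _ : (range (fun n => F (k' n) n) #<= `I_n0)%card).
      have := pcard_eq (inj_bij Finj) => h.
      by move: (h); rewrite card_eq_le => /andP[].
    move=> _ [n _ <-] /=; rewrite ltnNge; apply/negP => h.
    by have := kF n; rewrite (eigenvalue_seq_zero hk kn0 h) => /esym/eqP; apply/negP.
  by move=> /card_le_finite; apply; apply: finite_II.
move=> mu; have [->|/nz//] := eqVneq mu 0.
have inf (H1 : hilbertType R) (S1 : H1 -> H1) k n0 : is_eigenvalue_seq S1 k ->
    k n0 = 0 -> ([set n | k n = 0%R] #= [set: nat])%card.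
  move=> hk kn0; apply: eq_card_nat => //.
  apply: (@sub_infinite_set _ ([set: nat] `\` `I_n0)).
    move=> n /= [_ /negP]; rewrite -leqNgt.
    exact: (eigenvalue_seq_zero hk kn0).
  by apply: infinite_setD => //; exact: infinite_nat.
have [[n0 ln0]|h] := pselect (exists n, l n = 0).
  have [n1 l'n1] := zero _ _ _ _ _ _ hl hl' nz (ex_intro _ n0 ln0).
  apply: card_eq_trans (inf _ _ _ _ hl ln0) _; rewrite card_eq_sym.
  exact: (inf _ _ _ _ hl' l'n1).
have h' : ~ exists n, l' n = 0.
  move=> h'; apply: h; apply: (zero _ _ _ _ _ _ hl' hl) => // mu0 /nz.
  by rewrite card_eq_sym.
have -> : [set n | l n = 0] = set0 by apply/seteqP; split=> // n ln; case: h; exists n.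
have -> : [set n | l' n = 0] = set0 by apply/seteqP; split=> // n ln; case: h'; exists n.
exact: card_eqxx.
Qed.

Lemma same_multP (H K : hilbertType R) (S : H -> H) (T : K -> K) l l' :
  is_eigenvalue_seq S l -> is_eigenvalue_seq T l' ->
  same_mult S T <-> exists2 s : nat -> nat, bijective s & l' \o s = l.
Proof.
move=> hl hl'; split=> [ST|[s bs sl] mu m mu0].
  by apply: fiber_bijection; apply: (same_mult_fiber hl hl' ST).
have cc := bijection_fiber mu bs sl.
have [p dp cp] := hl.2 _ mu0; have [q dq cq] := hl'.2 _ mu0.
have pq : p = q.
  apply/card_eq_II; apply: card_eq_trans (card_eq_trans cc cq).
  by rewrite card_eq_sym.
by split=> [/has_dim_uniq /(_ dp) ->|/has_dim_uniq /(_ dq) ->]; rewrite ?pq// -pq.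
Qed.

End Multiplicity.

Section Diagonal.
Variables (R : realType) (H : hilbertType R).
Implicit Types (T : H -> H) (e : nat -> H) (l : nat -> R[i]).

Lemma diag_comp T e l (s : nat -> nat) q : bijective s -> l \o s = q ->
  diagonalizes T e l -> diagonalizes T (e \o s) q.
Proof.
move=> [t sK tK] <- [Te ee tail]; split=> [i|i j|eps eps0].
- exact: Te.
- by rewrite /= ee (inj_eq (can_inj sK)).
have [N hN] := tail _ eps0.
exists (\max_(i < N) (t i).+1)%N => x hx; apply: hN => i iN.
have := hx (t i); rewrite /= tK; apply.
exact: (leq_bigmax (Ordinal iN)).
Qed.

Section Diag.
Variables (T : H -> H) (e : nat -> H) (l : nat -> R[i]).
Hypothesis (dT : diagonalizes T e l).

Lemma diag_eigen i : T (e i) = l i *: e i.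
Proof. by case: dT. Qed.

Lemma diag_ip i j : '[e i, e j] = ((i == j) && (l i != 0))%:R.
Proof. by case: dT. Qed.

Lemma diag_tail (eps : R) : 0 < eps -> exists N, forall x,
  (forall i, (i < N)%N -> '[x, e i] = 0) -> nm (T x) <= eps * nm x.
Proof. by case: dT => _ _; apply. Qed.

Lemma diag_neq0 i : (e i != 0) = (l i != 0).
Proof.
apply/idP/idP; apply: contra => /eqP h.
  by apply/eqP/ip_eq0; rewrite diag_ip h !eqxx.
by have := diag_ip i i; rewrite h ip0l eqxx; case: eqP => // _ /esym/eqP; rewrite oner_eq0.
Qed.

Lemma diag_suborthonormal n : suborthonormal e n.
Proof. by move=> i j _ _; rewrite diag_ip diag_neq0. Qed.

Lemma diag_nm i : l i != 0 -> nm (e i) = 1.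
Proof.
move=> li; have := diag_ip i i; rewrite eqxx li ip_self => /complexI/eqP.
by rewrite -{1}(expr1n _ 2) eqrXn2 ?nm_ge0// => /eqP.
Qed.

Lemma diag_small (eps : R) : 0 < eps ->
  exists N, forall n, (N <= n)%N -> nm (l n) <= eps.
Proof.
move=> eps0; have [N hN] := diag_tail eps0; exists N => n Nn.
have [->|ln] := eqVneq (l n) 0; first by rewrite nm0 ltW.
have := hN (e n); rewrite diag_eigen nmZ diag_nm// !mulr1; apply => i iN.
by rewrite diag_ip gtn_eqF// (leq_trans iN).
Qed.

Hypothesis nT : normal_op T.

(** An eigenvector is orthogonal to every [e i] with a different eigenvalue, so
    its component orthogonal to the others lies in the tails of [T]. *)
Lemma diag_eigenspace mu x : mu != 0 -> T x = mu *: x ->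
  (forall i, l i = mu -> '[x, e i] = 0) -> x = 0.
Proof.
move=> mu0 Tx h; have bT := nT.1.
have xe i : '[x, e i] = 0.
  have [/h//|li] := eqVneq (l i) mu.
  have : '[T x, e i] = l i * '[x, e i].
    by rewrite adjE// (normal_eigen_adj nT (diag_eigen i)) ipZr Num.Theory.conjCK.
  rewrite Tx ipZl => /eqP; rewrite -subr_eq0 -mulrBl mulf_eq0 subr_eq0.
  by rewrite eq_sym (negPf li) => /eqP.
have nmu := nm_gt0 mu0.
have [N hN] := diag_tail (divr_gt0 nmu (ltr0n R 2)).
have := hN x (fun i _ => xe i); rewrite Tx nmZ => hx.
apply/nm_eq0/le_anti; rewrite nm_ge0 andbT.
have := nm_ge0 x; nra.
Qed.

Lemma diag_fiber mu : mu != 0 -> exists m (f : nat -> nat),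
  set_bij `I_m [set n | l n = mu] f.
Proof.
move=> mu0; have nmu := nm_gt0 mu0.
have [N hN] := diag_small (divr_gt0 nmu (ltr0n R 2)).
have : finite_set [set n | l n = mu].
  apply: (@sub_finite_set _ _ `I_N) => // n /= ln; rewrite ltnNge; apply/negP.
  by move=> /hN; rewrite ln; lra.
move=> /finite_setP[m]; rewrite card_eq_sym => /card_set_bijP[f hf].
by exists m, f.
Qed.

Lemma diag_eigenspace_span mu m (f : nat -> nat) : mu != 0 ->
  set_bij `I_m [set n | l n = mu] f ->
  orthonormal_fam (e \o f) m /\ gen_eigenspace T mu = span_of (e \o f) m.
Proof.
move=> mu0 [f1 f2 f3]; have L := nT.1.1.
have lf i : (i < m)%N -> l (f i) = mu by move=> im; exact: f1.
have of_ : orthonormal_fam (e \o f) m.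
  move=> i j im jm; rewrite /= diag_ip lf// mu0 andbT.
  rewrite (_ : (f i == f j) = (i == j))//; apply/eqP/eqP => [|-> //].
  by move=> h; apply: f2 h; rewrite inE.
split=> //; have sof := orthonormal_sub of_.
have eig x : T (proj (e \o f) m x) = mu *: proj (e \o f) m x.
  rewrite (lin_sum L) scaler_sumr; apply: eq_bigr => i _.
  by rewrite (linZ L) /= diag_eigen lf// !scalerA mulrC.
rewrite normal_gen_eigenspace//; apply/seteqP; split=> [x /= Tx|x /= <-]; last exact: eig.
apply/esym/subr0_eq; apply: (diag_eigenspace mu0).
  by rewrite (linB L) eig Tx scalerBr.
move=> i li; have [j /= jm <-] := f3 i li.
exact: (@ip_res _ _ (e \o f)).
Qed.

Lemma diag_mult mu : mu != 0 -> exists2 m, has_dim (gen_eigenspace T mu) m &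
  ([set n | l n = mu] #= `I_m)%card.
Proof.
move=> mu0; have [m [f hf]] := diag_fiber mu0; exists m; last first.
  by rewrite card_eq_sym; apply/card_set_bijP; exists f.
have [of_ ->] := diag_eigenspace_span mu0 hf; exact: span_has_dim.
Qed.

End Diag.

Lemma spectral_eigenvalue_seq T : normal_op T -> compact_op T ->
  exists e l, [/\ diagonalizes T e l, is_eigenvalue_seq T l &
    forall x, nm (T x) <= nm (l 0%N) * nm x].
Proof.
move=> nT cT; have [e [l [dT mono tail]]] := spectral_theorem nT cT.
exists e, l; split=> //; last by move=> x; apply: tail.
split=> [n|mu mu0]; last exact: (diag_mult dT).
by rewrite !normE lecR.
Qed.

Lemma eigenvalue_seqP T : normal_op T -> compact_op T ->
  is_eigenvalue_seq T (eigenvalue_seq T).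
Proof.
move=> nT cT; have [e [l [_ hl _]]] := spectral_eigenvalue_seq nT cT.
exact: (xgetPex (fun=> 0) (ex_intro _ l hl)).
Qed.

(** Eigenvectors can be listed in the order of any prescribed eigenvalue
    sequence, in particular that of another operator with the same
    multiplicities. *)
Lemma diagonalizes_eigenvalue_seq T l : normal_op T -> compact_op T ->
  is_eigenvalue_seq T l -> exists e, diagonalizes T e l.
Proof.
move=> nT cT hl; have [e [q [dT hq _]]] := spectral_eigenvalue_seq nT cT.
have [s bs sl] := (same_multP hl hq).1 (fun _ _ _ => iff_refl _).
by exists (e \o s); apply: diag_comp dT.
Qed.

End Diagonal.

(** * Operator-norm closure of the unitary orbit *)

Section OrbitClosure.
Variables (R : realType) (H : hilbertType R).
Implicit Types (C X S T U : H -> H).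

(** Pointwise form of [|X - U C U^*| <= e]; it is symmetric in [C] and [X] up to
    replacing [U] by its inverse. *)
Definition close_orbit C X U (e : R) :=
  forall x, nm (X x - U (C (adjoint U x))) <= e * nm x.

Lemma bounded_orbit C U : bounded_op C -> unitary_op U ->
  bounded_op (U \o C \o adjoint U).
Proof.
move=> bC uU; have bU := unitary_bounded uU.
by apply: bounded_comp; [exact: bounded_comp|exact: bounded_adj].
Qed.

Lemma opnorm_closureP (E : set (H -> H)) X : (forall Y, E Y -> bounded_op Y) ->
  opnorm_closure E X <-> bounded_op X /\
    forall e : R, 0 < e -> exists2 Y, E Y & forall x, nm (X x - Y x) <= e * nm x.
Proof.
move=> bE; split=> -[bX h]; split=> // e e0.
  have [Y EY hY] := h e e0; exists Y => // x.
  have := le_opnorm x (boundedB bX (bE _ EY)) => /= h1.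
  by apply: le_trans h1 _; rewrite ler_wpM2r ?nm_ge0// ltW.
have e2 : 0 < e / 2 by rewrite divr_gt0.
have [Y EY hY] := h _ e2; exists Y => //.
apply: (@le_lt_trans _ _ (e / 2)); last by lra.
apply: opnorm_le hY; last exact: ltW.
by case: (boundedB bX (bE _ EY)).
Qed.

Lemma orbit_closureP C X : bounded_op C ->
  opnorm_closure (unitary_orbit C) X <-> bounded_op X /\
    forall e : R, 0 < e -> exists2 U, unitary_op U & close_orbit C X U e.
Proof.
move=> bC; split.
  move=> /opnorm_closureP[Y [U uU <-]|bX h]; first exact: bounded_orbit.
  by split=> // e /h[_ [U uU <-] hY]; exists U.
move=> [bX h]; apply/opnorm_closureP; last split=> // e /h[U uU hU].
  by move=> _ [U uU <-]; exact: bounded_orbit.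
by exists (U \o C \o adjoint U) => //; exists U.
Qed.

Lemma close_orbit_adj C X U e : bounded_op C -> bounded_op X -> unitary_op U ->
  0 <= e -> close_orbit C X U e -> close_orbit (adjoint C) (adjoint X) U e.
Proof.
move=> bC bX uU e0 h x; have bU := unitary_bounded uU.
have bUa := bounded_adj bU.
apply: nm_le_ip => [|y]; first by rewrite mulr_ge0 ?nm_ge0.
have -> : '[adjoint X x - U (adjoint C (adjoint U x)), y] =
    '[x, X y - U (C (adjoint U y))].
  rewrite ipBl ipBr adjEr//; congr (_ - _).
  by rewrite (adjE _ _ bU) adjEr// adjEr.
apply: le_trans (cauchy_schwarz _ _) _.
by apply: le_trans (ler_wpM2l (nm_ge0 x) (h y)) _; rewrite mulrCA mulrA.
Qed.

Lemma close_orbit_sym C X U e : unitary_op U ->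
  close_orbit C X U e -> close_orbit X C (adjoint U) e.
Proof.
move=> uU h y; rewrite adjK; last exact: unitary_bounded.
rewrite -(unitary_nm uU) (linB (unitary_lin uU)) unitaryKV// nmBC.
by have := h (U y); rewrite unitaryK// (unitary_nm uU).
Qed.

Lemma close_orbit_seq C X :
  (forall e : R, 0 < e -> exists2 U, unitary_op U & close_orbit C X U e) ->
  exists2 U_ : nat -> H -> H, forall n, unitary_op (U_ n) &
    forall n, close_orbit C X (U_ n) n.+1%:R^-1.
Proof.
move=> h.
have /choice[U_ hU] : forall n : nat, exists U, unitary_op U /\ close_orbit C X U n.+1%:R^-1.
  move=> n; have [|U uU hU] := h n.+1%:R^-1; first by rewrite invr_gt0 ltr0n.
  by exists U.
by exists U_ => n; case: (hU n).
Qed.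

Lemma close_orbit_tends C X (U_ : nat -> H -> H) :
  (forall n, close_orbit C X (U_ n) n.+1%:R^-1) ->
  forall x, tends \oo (fun n => U_ n (C (adjoint (U_ n) x))) (X x).
Proof.
move=> hU x e e0; have x1 : 0 < nm x + 1 by rewrite ltr_wpDl// nm_ge0.
have [N hN] := small_inv (divr_gt0 e0 x1); exists N => //= n /= nN.
rewrite nmBC; apply: le_lt_trans (hU n x) _.
apply: (@le_lt_trans _ _ (n.+1%:R^-1 * (nm x + 1))).
  by rewrite ler_wpM2l ?invr_ge0 ?ler0n// lerDl.
by rewrite -ltr_pdivlMr//; exact: hN.
Qed.

Lemma closure_compact C X : compact_op C -> bounded_op X ->
  (forall e : R, 0 < e -> exists2 U, unitary_op U & close_orbit C X U e) ->
  compact_op X.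
Proof.
move=> /compact_opP[bC tb] bX h; apply/compact_opP; split=> // e e0.
have e2 : 0 < e / 2 by rewrite divr_gt0.
have [U uU hU] := h _ e2; have [s hs] := tb _ e2.
exists (map U s) => x x1.
have [|y ys hy] := hs (adjoint U x).
  by rewrite (unitary_nm (unitary_adj uU)).
exists (U y); first exact: map_f.
have -> : X x - U y = (X x - U (C (adjoint U x))) + U (C (adjoint U x) - y).
  by rewrite (linB (unitary_lin uU)) addrA subrK.
apply: le_lt_trans (nmD _ _) _; rewrite [e]splitr (unitary_nm uU).
apply: ler_ltD => //; apply: le_trans (hU x) _.
by rewrite ler_piMr// ltW.
Qed.

(** Normality is the identity [<T x, T y> = <T^* x, T^* y>], which passes to
    limits. *)
Lemma closure_normal C X : normal_op C -> bounded_op X ->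
  (forall e : R, 0 < e -> exists2 U, unitary_op U & close_orbit C X U e) ->
  normal_op X.
Proof.
move=> nC bX /close_orbit_seq[U_ uU hU]; have bC := nC.1.
have hUa n : close_orbit (adjoint C) (adjoint X) (U_ n) n.+1%:R^-1.
  by apply: close_orbit_adj => //; rewrite invr_ge0 ler0n.
have t1 := close_orbit_tends hU; have t2 := close_orbit_tends hUa.
split=> //; apply/funext => x; apply: ip_ext => y /=.
rewrite adjEr// [RHS]adjE//.
apply: tends_uniq (tends_ip (t1 x) (t1 y)) _.
apply: tends_near (tends_ip (t2 x) (t2 y)); apply: nearW => n.
by rewrite !(unitary_ip (uU n)) adjEr// [RHS]adjE// normal_comm.
Qed.

(** Otherwise unit vectors [z n] orthogonal to the eigenspace would satisfy
    [T (z n) - mu z n -> 0]; by compactness they converge to a unit eigenvector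
    orthogonal to the eigenspace. *)
Lemma spectral_gap T mu : compact_op T -> mu != 0 ->
  exists2 d : R, 0 < d & forall z, (forall y, T y = mu *: y -> '[z, y] = 0) ->
    d * nm z <= nm (T z - mu *: z).
Proof.
move=> cT mu0; apply: contrapT => h; have bT := cT.1; have L := bT.1.
have /choice[z hz] : forall n : nat, exists z,
    [/\ nm z = 1, forall y, T y = mu *: y -> '[z, y] = 0 &
      nm (T z - mu *: z) < n.+1%:R^-1].
  move=> n; apply: contrapT => hn; apply: h.
  have n0 : 0 < n.+1%:R^-1 :> R by rewrite invr_gt0 ltr0n.
  exists n.+1%:R^-1 => // z hz; rewrite leNgt; apply/negP => zn.
  have z0 : z != 0.
    by apply: contraTneq zn => ->; rewrite (lin0 L) scaler0 subrr !nm0 mulr0 ltxx.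
  have nz := nm_gt0 z0; apply: hn; exists ((nm z)^-1%:C *: z); split.
  - by rewrite nmZr ?invr_ge0 ?nm_ge0// mulVf// gt_eqF.
  - by move=> y /hz; rewrite ipZl => ->; rewrite mulr0.
  - rewrite (linZ L) scalerA mulrC -scalerA -scalerBr nmZr ?invr_ge0 ?nm_ge0//.
    by rewrite mulrC ltr_pdivrMr.
have [U [UU Uc]] := cofinal_ultra_ex; have UP : ProperFilter U := @ultra_proper _ U UU.
have [|y hy] := @compact_ultra_compact _ _ _ cT U z 1 UU.
  by move=> n; case: (hz n) => ->.
have dev : tends U (fun n => T (z n) - mu *: z n) 0.
  move=> e e0; have [N hN] := small_inv e0; apply: filterS (Uc N) => n /= /hN nN.
  by rewrite subr0; apply: lt_trans nN; case: (hz n).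
have zt : tends U z (mu^-1 *: y).
  rewrite -[y]subr0; apply: tends_near (tendsZ mu^-1 (tendsB hy dev)).
  by apply: nearW => n /=; rewrite subKr scalerA mulVf// scale1r.
have Tzt : tends U (T \o z) (T (mu^-1 *: y)) by exact: tends_bounded.
have Ty : T (mu^-1 *: y) = mu *: (mu^-1 *: y).
  by rewrite scalerA mulfV// scale1r; apply: tends_uniq Tzt hy.
have yy : '[mu^-1 *: y, mu^-1 *: y] = 0.
  apply: tends_uniq (tends_ip zt (tends_cst _)) _.
  apply: tends_near (tends_cst 0); apply: nearW => n.
  by have [_ -> ] := hz n.
have h1 : tends U (fun n => (nm (z n))%:C) 1%:C.
  by apply: tends_near (tends_cst _); apply: nearW => n; have [-> _ _] := hz n.
have : (nm (mu^-1 *: y))%:C = 1%:C by exact: tends_uniq (tends_nm zt) h1.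
rewrite (ip_eq0 yy) nm0 => /complexI/eqP.
by rewrite eq_sym oner_eq0.
Qed.

(** Vectors orthogonal to the [mu]-eigenspace of [T] are moved by [T - mu] by a
    definite amount, hence an operator close to [T] has at most as many
    independent [mu]-eigenvectors. *)
Lemma close_mult_le S T U mu m p (d e : R) : unitary_op U ->
  close_orbit T S U e -> e < d ->
  (forall z, (forall y, T y = mu *: y -> '[z, y] = 0) ->
    d * nm z <= nm (T z - mu *: z)) ->
  linear S -> linear T ->
  has_dim [set x | S x = mu *: x] m -> has_dim [set x | T x = mu *: x] p ->
  (m <= p)%N.
Proof.
move=> uU cl ed gap LS LT /has_dim_orthonormal[a oa Sa] /has_dim_orthonormal[b ob Tb].
rewrite leqNgt; apply/negP => pm.
have [c [i ci] hc] :=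
  underdetermined (\matrix_(i < m, j < p) '[adjoint U (a i), b j]) pm.
pose x := lin_comb (fun i : 'I_m => a i) c.
have La := unitary_lin (unitary_adj uU).
have x0 : x != 0.
  by apply: contra ci => /eqP hx; apply/eqP; apply: (orthonormal_indep oa hx).
have Sx : S x = mu *: x.
  have Sai (k : 'I_m) : S (a k) = mu *: a k.
    have : span_of a m (a k).
      by apply: proj_in => //; exact: orthonormal_sub.
    by rewrite -Sa.
  rewrite /x /lin_comb (lin_sum LS) scaler_sumr; apply: eq_bigr => k _.
  by rewrite (linZ LS) Sai !scalerA mulrC.
have := gap (adjoint U x); rewrite (unitary_nm (unitary_adj uU)) => {}gap.
have /gap : forall y, T y = mu *: y -> '[adjoint U x, y] = 0.
  move=> y Ty; have <- : proj b p y = y by rewrite -[_ = y]/(span_of b p y) -Tb.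
  apply: ip_proj_perp => j jp; rewrite /x /lin_comb (lin_sum La) ip_suml.
  apply: etrans (hc (Ordinal jp)); apply: eq_bigr => k _.
  by rewrite (linZ La) ipZl mxE.
have nx := nm_gt0 x0.
suff : nm (T (adjoint U x) - mu *: adjoint U x) <= e * nm x.
  by move=> h1 h2; have := le_trans h2 h1; rewrite ler_pM2r// leNgt ed.
rewrite -(unitary_nm uU) (linB (unitary_lin uU)) (linZ (unitary_lin uU)).
by rewrite unitaryKV// -Sx nmBC.
Qed.

Lemma closure_same_mult C X : compact_op C -> normal_op C -> compact_op X ->
  normal_op X ->
  (forall e : R, 0 < e -> exists2 U, unitary_op U & close_orbit C X U e) ->
  same_mult X C.
Proof.
move=> cC nC cX nX h mu m mu0.
have [p dp _] := (eigenvalue_seqP nC cC).2 _ mu0.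
have [q dq _] := (eigenvalue_seqP nX cX).2 _ mu0.
suff pq : p = q.
  by split=> [/has_dim_uniq /(_ dq) ->|/has_dim_uniq /(_ dp) ->]; rewrite -?pq// pq.
have [d d0 gC] := spectral_gap cC mu0; have [d' d'0 gX] := spectral_gap cX mu0.
have dd0 : 0 < Num.min d d' / 2 by rewrite divr_gt0// lt_min d0.
have dd : Num.min d d' / 2 < Num.min d d'.
  by rewrite ltr_pdivrMr// ltr_pMr ?ltr1n// lt_min d0.
have [U uU hU] := h _ dd0.
rewrite !normal_gen_eigenspace// in dp dq.
apply/eqP; rewrite eqn_leq; apply/andP; split.
  apply: (close_mult_le (unitary_adj uU) (close_orbit_sym uU hU) _ gX _ _ dp dq).
  - by rewrite (lt_le_trans dd)// ge_min lexx orbT.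
  - by case: nC.1.
  - by case: nX.1.
apply: (close_mult_le uU hU _ gC _ _ dq dp).
- by rewrite (lt_le_trans dd)// ge_min lexx.
- by case: nX.1.
- by case: nC.1.
Qed.

Lemma same_mult_diag C X : compact_op C -> normal_op C -> compact_op X ->
  normal_op X -> same_mult X C ->
  exists e f l, [/\ is_eigenvalue_seq C l, diagonalizes C e l & diagonalizes X f l].
Proof.
move=> cC nC cX nX XC; have hl := eigenvalue_seqP nC cC.
have [e de] := diagonalizes_eigenvalue_seq nC cC hl.
have [|f df] := @diagonalizes_eigenvalue_seq _ _ X (eigenvalue_seq C) nX cX.
  split; first by case: hl.
  move=> mu mu0; have [m dm cm] := hl.2 _ mu0; exists m => //.
  exact/XC.
by exists e, f, (eigenvalue_seq C).
Qed.

(** If [U] sends the first [N] eigenvectors of [C] to those of [X], the operators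
    [X] and [U C U^*] agree on their span, and the difference involves only the
    components orthogonal to it. *)
Lemma diag_conj_diff C X U e f l N x : linear C -> linear X ->
  diagonalizes C e l -> diagonalizes X f l -> unitary_op U ->
  (forall i, (i < N)%N -> U (e i) = f i) ->
  X x - U (C (adjoint U x)) =
  X (x - proj f N x) - U (C (adjoint U x - proj e N (adjoint U x))).
Proof.
move=> LC LX dC dX uU hU; have LU := unitary_lin uU.
rewrite (linB LX) (linB LC) (linB LU).
suff -> : X (proj f N x) = U (C (proj e N (adjoint U x))).
  by rewrite opprB addrA subrK.
rewrite (lin_sum LX) (lin_sum LC) (lin_sum LU); apply: eq_bigr => i _.
rewrite (linZ LX) (linZ LC) (linZ LU) (diag_eigen dX) (diag_eigen dC) (linZ LU) hU//.
by rewrite adjEr ?hU//; exact: unitary_bounded.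
Qed.

(** The unitary sends the first [N] eigenvectors of [C] to those of [X]; beyond
    them both operators are small. *)
Lemma diag_close C X e f l : normal_op C -> normal_op X ->
  diagonalizes C e l -> diagonalizes X f l ->
  forall eps : R, 0 < eps -> exists2 U, unitary_op U & close_orbit C X U eps.
Proof.
move=> nC nX dC dX eps eps0.
have e2 : 0 < eps / 2 by rewrite divr_gt0.
have [N1 h1] := diag_tail dC e2; have [N2 h2] := diag_tail dX e2.
pose N := maxn N1 N2.
have [|U uU hU] := @gram_unitary _ H e f N.
  by move=> i j _ _; rewrite (diag_ip dC) (diag_ip dX).
exists U => // x; rewrite (diag_conj_diff x nC.1.1 nX.1.1 dC dX uU hU).
have res (g : nat -> H) y : suborthonormal g N ->
    nm (y - proj g N y) <= nm y.
  move=> sg; rewrite -ler_sqr ?nnegrE ?nm_ge0//.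
  by rewrite [leRHS](proj_pythagoras sg) lerDr sqr_ge0.
have se : suborthonormal e N by exact: (diag_suborthonormal dC).
have sf : suborthonormal f N by exact: (diag_suborthonormal dX).
apply: le_trans (nmB _ _) _; rewrite (unitary_nm uU) [eps]splitr mulrDl.
apply: lerD.
  apply: le_trans (h2 _ _) _; last by rewrite ler_wpM2l ?res// ltW.
  by move=> i iN; apply: ip_res => //; rewrite leq_max iN orbT.
rewrite -(unitary_nm (unitary_adj uU) x).
apply: le_trans (h1 _ _) _; last by rewrite ler_wpM2l ?res// ltW.
by move=> i iN; apply: ip_res => //; rewrite leq_max iN.
Qed.

Theorem orbit_closure_same_mult C X : compact_op C -> normal_op C ->
  bounded_op X -> opnorm_closure (unitary_orbit C) X <->
    [/\ compact_op X, normal_op X & same_mult X C].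
Proof.
move=> cC nC bX; have bC := nC.1; split.
  move=> /(orbit_closureP _ bC)[_ h].
  have cX := closure_compact cC bX h; have nX := closure_normal nC bX h.
  by split=> //; exact: closure_same_mult.
move=> [cX nX XC]; apply/orbit_closureP => //; split=> //.
have [e [f [l [_ de df]]]] := same_mult_diag cC nC cX nX XC.
exact: diag_close de df.
Qed.

End OrbitClosure.

(** * Direct sums and orthonormal bases of complements *)

Section Total.
Variables (R : realType) (H : hilbertType R).

Definition fin_span (u : nat -> H) :=
  [set x | exists N, exists c : nat -> R[i], x = \sum_(i < N) c i *: u i].

Lemma subsp_fin_span u : subsp (fin_span u).
Proof.
split; first by exists 0%N, (fun=> 0); rewrite big_ord0.
move=> a x y [N [c ->]] [M [d ->]].
pose trunc n (b : nat -> R[i]) i := if (i < n)%N then b i else 0.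
have widen n (b : nat -> R[i]) m : (n <= m)%N ->
    \sum_(i < n) b i *: u i = \sum_(i < m) trunc n b i *: u i.
  move=> nm; rewrite (big_ord_widen m (fun i => b i *: u i) nm) big_mkcond.
  by apply: eq_bigr => i _; rewrite /trunc; case: ifP => //; rewrite scale0r.
exists (maxn N M), (fun i => a * trunc N c i + trunc M d i).
rewrite (widen _ _ _ (leq_maxl N M)) (widen _ _ _ (leq_maxr N M)).
rewrite scaler_sumr -big_split; apply: eq_bigr => i _.
by rewrite scalerDl scalerA.
Qed.

(** Project onto the closed span. *)
Lemma total_seqP (u : nat -> H) : (forall x, (forall i, '[x, u i] = 0) -> x = 0) -> total_seq u.
Proof.
move=> h x e e0.
pose M := [set x : H | forall d : R, 0 < d -> exists2 y, fin_span u y & nm (x - y) < d].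
have sM : subsp M.
  have sS := subsp_fin_span u; split=> [d d0|a y z hy hz d d0].
    by exists 0; [case: sS|rewrite subrr nm0].
  have a1 : 0 < nm a + 1 by rewrite ltr_wpDl// nm_ge0.
  have [y' Sy hy'] := hy (d / 2 / (nm a + 1)) (divr_gt0 (divr_gt0 d0 (ltr0n R 2)) a1).
  have [z' Sz hz'] := hz (d / 2) (divr_gt0 d0 (ltr0n R 2)).
  exists (a *: y' + z'); first by case: sS => _; apply.
  rewrite opprD addrACA -scalerBr; apply: le_lt_trans (nmD _ _) _.
  rewrite [d]splitr; apply: ler_ltD => //; rewrite nmZ.
  apply: (@le_trans _ _ ((nm a + 1) * nm (y - y'))).
    by rewrite ler_wpM2r ?nm_ge0// lerDl.
  by rewrite mulrC -ler_pdivlMr// ltW.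
have cM : nclosed M.
  move=> y hy d d0; have d2 : 0 < d / 2 by rewrite divr_gt0.
  have [z Mz hz] := hy _ d2; have [w Sw hw] := Mz _ d2.
  exists w => //; have -> : y - w = (y - z) + (z - w) by rewrite addrA subrK.
  by apply: le_lt_trans (nmD _ _) _; rewrite [d]splitr ltrD// nmBC.
have [m Mm hm] := projection x sM cM.
suff xm : x = m by rewrite xm; have [_ [N [c ->]] hy] := Mm e e0; exists N, c.
apply/subr0_eq/h => i; apply: hm => d d0; exists (u i); last by rewrite subrr nm0.
exists i.+1, (fun j => (j == i)%:R); rewrite big_ord_recr/= eqxx scale1r big1 ?add0r//.
by move=> j _; rewrite ltn_eqF// scale0r.
Qed.

Lemma total_ext (K : hilbertType R) (A B : H -> K) (u : nat -> H) : bounded_op A -> bounded_op B ->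
  total_seq u -> (forall i, A (u i) = B (u i)) -> A = B.
Proof.
move=> bA bB tu AB; apply/funext => x; apply/subr0_eq/nm_eq0/le_anti.
rewrite nm_ge0 andbT; have := boundedB bA bB => /bounded_opP[L [M [M0 hM]]].
apply/ler_addgt0Pr => e e0; rewrite add0r.
have M1 : 0 < M + 1 by rewrite ltr_wpDl.
have [N [c hc]] := tu x _ (divr_gt0 e0 M1).
have D0 : (A \- B) (\sum_(i < N) c i *: u i) = 0.
  by rewrite (lin_sum L) big1// => i _; rewrite (linZ L) /= AB subrr scaler0.
rewrite -[A x - B x]/((A \- B) x) -[(A \- B) x]subr0 -D0 -(linB L).
apply: le_trans (hM _) _; apply: (@le_trans _ _ ((M + 1) * nm (x - \sum_(i < N) c i *: u i))).
  by rewrite ler_wpM2r ?nm_ge0// lerDl.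
by rewrite mulrC -ler_pdivlMr// ltW.
Qed.

Lemma separable_seq : separable H ->
  exists d : nat -> H, forall x (e : R), 0 < e -> exists n, nm (x - d n) < e.
Proof.
move=> [D /countable_injP[f finj] dD].
exists (fun n => xget 0 [set x | D x /\ f x = n]) => x e e0.
have [|y [xy Dy]] := dD (ball x e%:C) _ (ball_open _ _).
  by exists x; apply: ballxx; rewrite ltcR.
exists (f y); case: xgetP => [z _ [Dz fz]|/(_ y)[]//].
have -> : z = y by apply: finj; rewrite ?inE.
by move: xy; rewrite -ball_normE /= normE ltcR.
Qed.

(** Gram-Schmidt applied to the projections on [M] of a dense sequence, each
    step adding the first of them that is not yet in the span; an infinite
    dimensional [M] never runs out of such vectors. *)
Lemma complement_basis (M : set H) : separable H -> subsp M -> nclosed M ->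
  (forall n, exists2 a, orthonormal_fam a n & forall i, (i < n)%N -> M (a i)) ->
  exists g : nat -> H, [/\ forall n, orthonormal_fam g n, forall i, M (g i) &
    forall z, M z -> (forall i, '[z, g i] = 0) -> z = 0].
Proof.
move=> /separable_seq[d hd] sM cM infM.
have /choice[w hw] : forall n, exists w, M w /\ forall y, M y -> '[d n - w, y] = 0.
  by move=> n; have [w Mw h] := projection (d n) sM cM; exists w.
have Mw n : M (w n) by case: (hw n).
have w0 z : M z -> (forall n, '[z, w n] = 0) -> z = 0.
  move=> Mz h; have zd n : '[z, d n] = 0.
    rewrite -[d n](subrK (w n)) ipDr h addr0; apply: ip_eq0C.
    by case: (hw n) => _; apply.
  apply/eqP; apply: contraT => z0; have nz := nm_gt0 z0.
  have [n hn] := hd z _ nz; have := cauchy_schwarz z (z - d n).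
  rewrite ipBr zd subr0 ip_self nmR ger0_norm ?sqr_ge0// expr2 ler_pM2l//.
  by rewrite leNgt hn.
pose fam (s : seq H) := nth 0 s.
pose good s := orthonormal_fam (fam s) (size s) /\ forall i, (i < size s)%N -> M (fam s i).
have famE s y i : (i < (size s).+1)%N ->
    (if (i < size s)%N then fam s i else y) = fam (rcons s y) i.
  rewrite /fam nth_rcons; case: (ltngtP i (size s)) => //.
  by rewrite ltnS => h; rewrite leqNgt h.
have /choice[nxt hnxt] : forall s, exists y, good s -> good (rcons s y) /\
    forall n, (forall j, (j < n)%N -> span_of (fam s) (size s) (w j)) ->
      span_of (fam (rcons s y)) (size s).+1 (w n).
  move=> s; have [[os Ms]|] := pselect (good s); last by exists 0.
  have sos := orthonormal_sub os.
  have hex : exists n, ~~ `[< span_of (fam s) (size s) (w n) >].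
    apply: contrapT => /forallNP h.
    have sw n : span_of (fam s) (size s) (w n).
      by have /negP := h n; rewrite negbK => /asboolP.
    have [a oa Ma] := infM (size s).+1.
    suff : (size s < size s)%N by rewrite ltnn.
    apply: (@orthonormal_leq _ _ a _ (fam s) _ oa) => i si; apply/esym/subr0_eq/w0.
      apply: subspB => //; first exact: Ma.
      exact: proj_subsp.
    move=> n; rewrite -(sw n); apply: ip_proj_perp => j js; exact: ip_res.
  case: (ex_minnP hex) => m /asboolP hm mmin.
  have [|y oy [py [c yE]]] := @orthonormal_ext _ _ (fam s) (size s) (w m) os.
    exact/eqP.
  have wm : span_of (fam (rcons s y)) (size s).+1 (w m).
    by rewrite /span_of/= -[RHS]py; apply: proj_eq => i si; rewrite famE.
  have os' : orthonormal_fam (fam (rcons s y)) (size s).+1.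
    by move=> i j si sj; rewrite -!famE// oy.
  exists y => _; split=> [|n hn].
    split; rewrite size_rcons// => i si; rewrite -famE//; case: ifP => [/Ms//|_].
    rewrite yE; apply: subspZ => //; apply: subspB => //; exact: proj_subsp.
  have [nm_|mn|->//] := ltngtP n m; last by case: hm; apply: hn.
  apply: (proj_widen (n := size s)) => //.
  have : span_of (fam s) (size s) (w n).
    apply: contrapT => hn'; have /mmin : ~~ `[< span_of (fam s) (size s) (w n) >].
      exact/asboolP.
    by rewrite leqNgt nm_.
  move=> h; rewrite -[RHS]h; apply: proj_eq => i si.
  by rewrite -famE ?si// ltnS ltnW.
pose gs n := iter n (fun s => rcons s (nxt s)) [::].
pose g n := nxt (gs n).
have gsE n : gs n = mkseq g n by elim: n => [//|n IH]; rewrite mkseqS -IH.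
have sgs n : size (gs n) = n by rewrite gsE size_mkseq.
have famg n i : (i < n)%N -> fam (gs n) i = g i.
  by move=> ni; rewrite /fam gsE nth_mkseq.
have gg n : good (gs n).
  elim: n => [|n IH]; first by split=> // i j.
  by have [] := hnxt _ IH.
have sw n j : (j < n)%N -> span_of (fam (gs n)) n (w j).
  elim: n j => [//|n IH] j; rewrite ltnS => jn.
  have [_] := hnxt _ (gg n); rewrite sgs; apply => k kj; apply: IH.
  exact: leq_trans jn.
exists g; split.
- by move=> n i j ni nj; have [+ _] := gg n; rewrite sgs => /(_ i j ni nj); rewrite !famg.
- by move=> i; have [_ +] := gg i.+1; rewrite sgs => /(_ i (ltnSn i)); rewrite famg.
- move=> z Mz zg; apply: w0 => // n; rewrite -(sw n.+1 n)//.
  by apply: ip_proj_perp => i ni; rewrite famg// zg.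
Qed.

End Total.

Section DirectSum.
Variables (R : realType) (H K : hilbertType R).
Implicit Types (z : hsum H K) (C X : H -> H).

Lemma hsum_ip (z w : hsum H K) : '[z, w] = '[z.1, w.1] + '[z.2, w.2].
Proof. by []. Qed.

Lemma hsum_nm_sqr z : nm z ^+ 2 = nm z.1 ^+ 2 + nm z.2 ^+ 2.
Proof. by apply: complexI; rewrite rmorphD/= -!ip_self. Qed.

Lemma hsum_nm_fst z : nm z.1 <= nm z.
Proof. by rewrite -lecR -!normE hsum_norm_fst. Qed.

Lemma hsum_nm_inl (x : H) : nm ((x, 0) : hsum H K) = nm x.
Proof.
by apply/eqP; rewrite -(eqrXn2 (n:=2)) ?nm_ge0// hsum_nm_sqr/= nm0 expr0n addr0.
Qed.

Lemma hsum_separable : separable H -> separable K -> separable (hsum H K).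
Proof.
move=> /separable_seq[d hd] /separable_seq[k hk].
exists [set ((d p.1, k p.2) : hsum H K) | p in [set: nat * nat]].
  apply: card_le_trans (card_image_le _ _) _; exact: countableP.
move=> O [z Oz] oO.
have /nbhs_ballP[e e0 he] : nbhs z O by apply: open_nbhs_nbhs.
have e0' : (complex.Re e)%:C = e by rewrite RRe_real// gtr0_real.
have r2 : 0 < complex.Re e / 2 by rewrite divr_gt0// -ltcR e0'.
have [n hn] := hd z.1 _ r2; have [m hm] := hk z.2 _ r2.
exists ((d n, k m) : hsum H K); split; last by exists (n, m).
apply: he; rewrite -ball_normE /=; apply: le_lt_trans (hsum_norm_le _) _.
by rewrite -e0' [complex.Re e]splitr rmorphD/= !normE ltrD// ltcR.
Qed.

Lemma hsum_inl_lin (a : R[i]) (x y : H) :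
  ((a *: x + y, 0) : hsum H K) = a *: ((x, 0) : hsum H K) + (y, 0).
Proof.
have E : a *: (0 : K) + 0 = 0 by rewrite scaler0 addr0.
by congr pair; exact: esym E.
Qed.

Local Notation "C (+)0" := (dsum C (fun _ : K => 0)) (at level 2, format "C (+)0").

Lemma dsum_bounded C : bounded_op C -> bounded_op C (+)0.
Proof.
move=> /bounded_opP[L [M [M0 hM]]]; apply/bounded_opP; split=> [a z w|].
  by rewrite /dsum /= (linP L); exact: hsum_inl_lin.
exists M; split=> // z; rewrite /dsum hsum_nm_inl.
by apply: le_trans (hM _) _; rewrite ler_wpM2l// hsum_nm_fst.
Qed.

Lemma dsum_adj C : bounded_op C -> adjoint C (+)0 = (adjoint C)(+)0.
Proof.
move=> bC; apply: adj_eq; first exact: dsum_bounded.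
by move=> z w; rewrite !hsum_ip /= adjE// ip0l ip0r.
Qed.

Lemma dsum_normal C : normal_op C -> normal_op C (+)0.
Proof.
move=> nC; split; first exact: dsum_bounded nC.1.
rewrite (dsum_adj nC.1); apply/funext => z /=; rewrite /dsum /=.
by rewrite normal_comm.
Qed.

Lemma dsum_normal_inv X : bounded_op X -> normal_op X (+)0 -> normal_op X.
Proof.
move=> bX [_]; rewrite dsum_adj// => h; split=> //; apply/funext => x.
by have /(congr1 (fun f => (f ((x, 0) : hsum H K)).1)) := h.
Qed.

Lemma dsum_compact C : compact_op C -> compact_op C (+)0.
Proof.
move=> /compact_opP[bC tb]; apply/compact_opP; split; first exact: dsum_bounded.
move=> e /tb[s hs]; exists [seq ((y, 0) : hsum H K) | y <- s] => z z1.
have [|y ys hy] := hs z.1; first exact: le_trans (hsum_nm_fst _) z1.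
exists ((y, 0) : hsum H K); first exact: map_f.
have -> : C (+)0 z - ((y, 0) : hsum H K) = (C z.1 - y, 0) by congr pair; exact: subrr.
by rewrite hsum_nm_inl.
Qed.

Lemma dsum_compact_inv X : bounded_op X -> compact_op X (+)0 -> compact_op X.
Proof.
move=> bX /compact_opP[_ tb]; apply/compact_opP; split=> // e /tb[s hs].
exists [seq y.1 | y : hsum H K <- s] => x x1.
have [|y ys hy] := hs ((x, 0) : hsum H K); first by rewrite hsum_nm_inl.
exists y.1; first by apply/mapP; exists y.
by apply: le_lt_trans hy; exact: (hsum_nm_fst (X (+)0 (x, 0) - y)).
Qed.

Lemma dsum_mult C : normal_op C -> compact_op C -> same_mult C (+)0 C.
Proof.
move=> nC cC mu m mu0; have [p dp _] := (eigenvalue_seqP nC cC).2 _ mu0.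
suff dp' : has_dim (gen_eigenspace C (+)0 mu) p.
  by split=> [/has_dim_uniq /(_ dp') ->|/has_dim_uniq /(_ dp) ->].
move: dp; rewrite (normal_gen_eigenspace _ nC).
rewrite (normal_gen_eigenspace _ (dsum_normal nC)).
move=> [v iv Ev]; have inlE (c : 'I_p -> R[i]) :
    lin_comb (fun i => (v i, 0) : hsum H K) c = (lin_comb v c, 0).
  rewrite /lin_comb; elim/big_rec2: _ => // i x y _ ->.
  by rewrite hsum_inl_lin.
exists (fun i => (v i, 0) : hsum H K).
  by move=> c; rewrite inlE => /(congr1 fst)/iv.
apply/seteqP; split=> [z /= hz|_ [c _ <-]] /=.
  have hz1 : C z.1 = mu *: z.1 by rewrite -[LHS]/((C (+)0 z).1) hz.
  have hz2 : z.2 = 0.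
    have : mu *: z.2 = 0 by rewrite -[LHS]/((mu *: z).2) -hz.
    by move=> /eqP; rewrite scaler_eq0 (negPf mu0) => /eqP.
  have : [set x | C x = mu *: x] z.1 by [].
  by rewrite Ev => -[c _ cz]; exists c => //; rewrite inlE cz -hz2; case: (z).
rewrite inlE /dsum /=; have : [set x | C x = mu *: x] (lin_comb v c).
  by rewrite Ev; exists c.
move=> /= ->; have E : mu *: (0 : K) = 0 by rewrite scaler0.
by congr pair; exact: esym E.
Qed.

End DirectSum.

(** * Unitary equivalence after adding a null operator *)

Section Dilation.
Variables (R : realType) (H K : hilbertType R).
Implicit Types (C X : H -> H).

Local Notation L := (hsum H K).
Local Notation inl x := ((x, 0) : hsum H K).
Local Notation "C (+)0" := (dsum C (fun _ : K => 0)) (at level 2, format "C (+)0").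

Lemma orbit_sub_closure (H1 : hilbertType R) (C X : H1 -> H1) : bounded_op C ->
  unitary_orbit C X -> opnorm_closure (unitary_orbit C) X.
Proof.
move=> bC hX; apply/orbit_closureP => //; move: hX => [U uU <-].
split=> [|e e0]; first exact: bounded_orbit.
by exists U => // x; rewrite subrr nm0 mulr_ge0 ?nm_ge0// ltW.
Qed.

Lemma infinite_dim_orthonormal : infinite_dim K ->
  forall n, exists a : nat -> K, orthonormal_fam a n.
Proof.
move=> infK n; have o0 : orthonormal_fam (fun=> 0 : K) 0 by [].
have [[a oa _]|[a [m [oa ha]]]] := orthonormal_extend n o0.
  by exists a.
case: (infK m); have := span_has_dim oa.
rewrite (_ : span_of a m = setT)//; apply/seteqP; split=> // x _; exact: ha.
Qed.

(** Completing the eigenvectors to an orthonormal basis: the complement is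
    infinite dimensional because it contains [K]. *)
Lemma eigen_complement C (e : nat -> H) l : separable H -> separable K ->
  infinite_dim K -> linear C -> diagonalizes C e l ->
  exists g : nat -> L, [/\ forall n, orthonormal_fam g n,
    forall i j, '[g i, inl (e j)] = 0, forall i, C (+)0 (g i) = 0 &
    forall z, (forall i, '[z, inl (e i)] = 0) -> (forall i, '[z, g i] = 0) -> z = 0].
Proof.
move=> sH sK infK LC dC.
pose M := [set z : L | forall i, '[z, inl (e i)] = 0].
have ME : M = perp (range (fun i => inl (e i))).
  by apply/seteqP; split=> z hz => [_ [i _ <-]|i]; apply: hz => //; exists i.
have sM : subsp M by rewrite ME; exact: subsp_perp.
have cM : nclosed M by rewrite ME; exact: nclosed_perp.
have infM n : exists2 a, orthonormal_fam a n & forall i, (i < n)%N -> M (a i).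
  have [a oa] := infinite_dim_orthonormal infK n.
  exists (fun i => (0, a i) : L) => [i j ni nj|i ni j].
    by rewrite hsum_ip/= ip0l add0r oa.
  by rewrite hsum_ip/= ip0l ip0r addr0.
have [g [og Mg hg]] := complement_basis (hsum_separable sH sK) sM cM infM.
exists g; split=> //.
move=> i; have : C (g i).1 = 0.
  apply/nm_eq0/le_anti; rewrite nm_ge0 andbT; apply/ler_addgt0Pr => d d0; rewrite add0r.
  have B1 : 0 < nm (g i).1 + 1 by rewrite ltr_wpDl// nm_ge0.
  have [N hN] := diag_tail dC (divr_gt0 d0 B1).
  have := hN (g i).1; rewrite mulrAC ler_pdivlMr// => h.
  have h1 : nm (C (g i).1) * (nm (g i).1 + 1) <= d * nm (g i).1.
    apply: h => j _; have := Mg i j; rewrite hsum_ip/= ip0r addr0.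
    by [].
  have h2 : d * nm (g i).1 <= d * (nm (g i).1 + 1) by rewrite ler_pM2l// lerDl.
  by have := le_trans h1 h2; rewrite ler_pM2r.
by rewrite /dsum => ->.
Qed.

(** The basis vectors of the complements and the eigenvectors are interleaved
    into one sequence, so that a single unitary matches both. *)
Theorem dilation_orbit C X : separable H -> separable K -> infinite_dim K ->
  compact_op C -> normal_op C -> bounded_op X ->
  [/\ compact_op X, normal_op X & same_mult X C] <->
  unitary_orbit C (+)0 X (+)0.
Proof.
move=> sH sK infK cC nC bX; have bC := nC.1.
have cC' := dsum_compact K cC; have nC' := dsum_normal K nC.
have bX' := dsum_bounded K bX; have bC' := nC'.1.
split=> [[cX nX XC]|].
  have [e [f [l [_ de df]]]] := same_mult_diag cC nC cX nX XC.
  have [g [og ge Cg tg]] := eigen_complement sH sK infK bC.1 de.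
  have [h [oh hf Xh th]] := eigen_complement sH sK infK bX.1 df.
  pose weave (a b : nat -> L) n := if odd n then b n./2 else a n./2.
  have weave0 a b k : weave a b k.*2 = a k by rewrite /weave odd_double doubleK.
  have weave1 a b k : weave a b k.*2.+1 = b k.
    by rewrite /weave/= odd_double uphalf_double.
  pose u := weave (fun i => inl (e i)) g; pose v := weave (fun i => inl (f i)) h.
  have gg i j : '[g i, g j] = (i == j)%:R.
    by apply: (og (maxn i j).+1); rewrite ltnS ?leq_maxl ?leq_maxr.
  have hh i j : '[h i, h j] = (i == j)%:R.
    by apply: (oh (maxn i j).+1); rewrite ltnS ?leq_maxl ?leq_maxr.
  have uv i j : '[u i, u j] = '[v i, v j].
    rewrite /u /v /weave; case: (odd i); case: (odd j); rewrite ?gg ?hh//.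
    - by rewrite ge hf.
    - by rewrite (ip_eq0C (ge _ _)) (ip_eq0C (hf _ _)).
    - by rewrite !hsum_ip/= !ip0l (diag_ip de) (diag_ip df).
  have tot (a b : nat -> L) : (forall z, (forall i, '[z, a i] = 0) ->
      (forall i, '[z, b i] = 0) -> z = 0) -> total_seq (weave a b).
    move=> hab; apply: total_seqP => z hz; apply: hab => i.
      by have := hz i.*2; rewrite weave0.
    by have := hz i.*2.+1; rewrite weave1.
  have tu : total_seq u by exact: tot.
  have tv : total_seq v by exact: tot.
  have [|U uU hU] := gram_unitary_total _ tu tv; first by move=> n i j _ _.
  exists U => //; have bU := unitary_bounded uU; have LU := bU.1.
  apply: total_ext tv _ => //; first exact: bounded_orbit.
  move=> i; rewrite /= -(hU i) unitaryK// hU.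
  have dE (A : H -> H) (a : nat -> H) (dA : diagonalizes A a l) k :
      A (+)0 (inl (a k)) = l k *: inl (a k).
    rewrite /dsum /= (diag_eigen dA); have E : l k *: (0 : K) = 0 by rewrite scaler0.
    by congr pair; exact: esym E.
  have := hU i; rewrite /u /v /weave; case: (odd i) => hi.
    by rewrite Cg Xh (lin0 LU).
  by rewrite (dE _ _ de) (dE _ _ df) (linZ LU) hi.
move=> /(orbit_sub_closure bC')/(orbit_closure_same_mult cC' nC' bX')[cX' nX' XC'].
have cX := dsum_compact_inv bX cX'; have nX := dsum_normal_inv bX nX'.
split=> // mu m mu0.
have h1 := dsum_mult K nX cX m mu0; have h2 := dsum_mult K nC cC m mu0.
by have h3 := XC' mu m mu0; split=> [/h1/h3/h2|/h2/h3/h1].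
Qed.

End Dilation.

(** * Compactness of sums, products and finite-rank operators *)

Section CompactAlgebra.
Variable R : realType.

(** Total boundedness of intervals, by a regular grid of mesh [e / 2]. *)
Lemma real_grid (B e : R) : 0 < e -> exists s : seq R, forall t, `|t| <= B ->
  exists2 r, r \in s & `|t - r| < e.
Proof.
move=> e0; exists [seq j%:R * (e / 2) - B | j <- iota 0 (Num.truncn (2 * B / (e / 2))).+1].
move=> t tB; have e2 : 0 < e / 2 by rewrite divr_gt0.
have [t1 t2] : - B <= t /\ t <= B by move: tB; rewrite ler_norml => /andP[].
pose j := Num.truncn ((t + B) / (e / 2)).
have tB0 : 0 <= (t + B) / (e / 2) by apply: divr_ge0; [lra|exact: ltW].
have /andP[j1 j2] := truncn_itv tB0.
exists (j%:R * (e / 2) - B).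
  apply/mapP; exists j => //; rewrite mem_iota/= add0n ltnS.
  by apply: le_truncn; apply: ler_wpM2r; [rewrite invr_ge0 ltW|lra].
move: j1 j2; rewrite -/j ler_pdivlMr// ltr_pdivrMr// -[j.+1%:R]natr1 => j1 j2.
rewrite ltr_norml; move: j1 j2; set v : R := j%:R; clearbody v => j1 j2.
by apply/andP; split; lra.
Qed.

Lemma complex_grid (B e : R) : 0 < e -> exists s : seq R[i], forall z, nm z <= B ->
  exists2 c, c \in s & nm (z - c) < e.
Proof.
move=> e0; have e2 : 0 < e / 2 by rewrite divr_gt0.
have [s hs] := real_grid B e2.
exists [seq (x +i* y)%C | x <- s, y <- s] => z zB.
have nmRe (w : R[i]) : `|complex.Re w| <= nm w.
  by rewrite -lecR -normE normc_ge_Re.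
have nmi : nm ('i%C : R[i]) = 1.
  by apply: complexI; rewrite -normE normc_def /= expr0n expr1n add0r sqrtr1.
have nmIm (w : R[i]) : `|complex.Im w| <= nm w.
  by have := nmRe (w * 'i%C); rewrite ReiNIm normrN nmM nmi mulr1.
have [x xs hx] := hs _ (le_trans (nmRe z) zB).
have [y ys hy] := hs _ (le_trans (nmIm z) zB).
exists (x +i* y)%C; first by apply/allpairsP; exists (x, y).
have -> : z - (x +i* y)%C = (complex.Re z - x)%:C + 'i%C * (complex.Im z - y)%:C.
  by rewrite [LHS]complexE; case: (z) => a b.
by apply: le_lt_trans (nmD _ _) _; rewrite nmM !nmR [e]splitr nmi mul1r ltrD.
Qed.

Variables H K L : hilbertType R.

Lemma compact_comp (S : K -> L) (T : H -> K) : bounded_op S -> compact_op T ->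
  compact_op (S \o T).
Proof.
move=> bS /compact_opP[bT tb]; apply/compact_opP; split; first exact: bounded_comp.
have /bounded_opP[LS [M [M0 hM]]] := bS => e e0.
have M1 : 0 < M + 1 by rewrite ltr_wpDl.
have [s hs] := tb _ (divr_gt0 e0 M1); exists (map S s) => x /hs[y ys hy].
exists (S y); first exact: map_f.
rewrite /= -(linB LS); apply: le_lt_trans (hM _) _.
apply: (@le_lt_trans _ _ ((M + 1) * nm (T x - y))).
  by rewrite ler_wpM2r ?nm_ge0// lerDl.
by rewrite mulrC -ltr_pdivlMr.
Qed.

Lemma compactB (S T : H -> K) : compact_op S -> compact_op T -> compact_op (S \- T).
Proof.
move=> /compact_opP[bS tS] /compact_opP[bT tT].
apply/compact_opP; split=> [|e e0]; first exact: boundedB.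
have e2 : 0 < e / 2 by rewrite divr_gt0.
have [s hs] := tS _ e2; have [t ht] := tT _ e2.
exists [seq y - z | y <- s, z <- t] => x x1.
have [y ys hy] := hs x x1; have [z zt hz] := ht x x1.
exists (y - z); first by apply/allpairsP; exists (y, z).
rewrite /= (_ : S x - T x - (y - z) = (S x - y) - (T x - z)).
  by apply: le_lt_trans (nmB _ _) _; rewrite [e]splitr ltrD.
by rewrite !opprB addrACA [- T x + _]addrC addrACA [z - _]addrC addrACA.
Qed.

Lemma compact0 : compact_op (fun _ : H => 0 : K).
Proof.
apply/compact_opP; split=> [|e e0]; first exact: bounded0.
by exists [:: 0] => x _; exists 0; rewrite ?inE// subrr nm0.
Qed.

Lemma compact_rank1 (u : H) (w : K) : compact_op (fun x => '[x, u] *: w).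
Proof.
have b1 : bounded_op (fun x => '[x, u] *: w).
  apply/bounded_opP; split=> [a x y|].
    by rewrite ipDl ipZl scalerDl scalerA.
  exists (nm u * nm w); split=> [|x]; first by rewrite mulr_ge0 ?nm_ge0.
  rewrite nmZ mulrC [nm u * _]mulrC -mulrA ler_wpM2l ?nm_ge0// mulrC.
  exact: cauchy_schwarz.
apply/compact_opP; split=> // e e0.
have w1 : 0 < nm w + 1 by rewrite ltr_wpDl// nm_ge0.
have [s hs] := complex_grid (nm u) (divr_gt0 e0 w1).
exists [seq c *: w | c <- s] => x x1.
have [|c cs hc] := hs '[x, u].
  by apply: le_trans (cauchy_schwarz _ _) _; rewrite ler_piMl ?nm_ge0.
exists (c *: w); first exact: map_f.
rewrite -scalerBl nmZ; apply: (@le_lt_trans _ _ (nm ('[x, u] - c) * (nm w + 1))).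
  by rewrite ler_wpM2l ?nm_ge0// lerDl.
by rewrite -ltr_pdivlMr.
Qed.

End CompactAlgebra.

Section FiniteRank.
Variables (R : realType) (H : hilbertType R).

(** The shape of a finite-rank operator used throughout: a unitary [U] acts on it
    by acting on the vectors [u i] and [w i]. *)
Definition rank_form r (u w : nat -> H) (C : H -> H) :=
  forall x, C x = \sum_(i < r) '[x, u i] *: w i.

Lemma finite_rank_form C : finite_rank C -> exists r u w, rank_form r u w C.
Proof.
move=> [bC [n /has_dim_orthonormal[q oq qE]]].
exists n, (fun i => adjoint C (q i)), q => x.
have : range C (C x) by exists x.
rewrite qE /span_of/= => <-.
by apply: eq_bigr => i _; rewrite -adjE// -/(proj q n (C x)).
Qed.

Lemma rank_form_compact r u w C : rank_form r u w C -> compact_op C.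
Proof.
move=> /funext ->; elim: r => [|r IH].
  rewrite (_ : (fun _ => _) = fun=> 0); first exact: compact0.
  by apply/funext => x; rewrite big_ord0.
rewrite (_ : (fun _ => _) = (fun x => \sum_(i < r) '[x, u i] *: w i) \-
    (fun x => '[x, u r] *: - w r)).
  by apply: compactB => //; exact: compact_rank1.
by apply/funext => x; rewrite big_ord_recr/= scalerN opprK.
Qed.

Lemma rank_form_orbit r u w C U : unitary_op U -> rank_form r u w C ->
  rank_form r (U \o u) (U \o w) (U \o C \o adjoint U).
Proof.
move=> uU hC x; have bU := unitary_bounded uU.
rewrite /= hC (lin_sum bU.1); apply: eq_bigr => i _.
by rewrite (linZ bU.1) adjEr.
Qed.

Lemma compact_proj (e : nat -> H) n : compact_op (proj e n).
Proof. exact: (@rank_form_compact n e e). Qed.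

End FiniteRank.

(** * Singular values and the trace norm *)

Section TraceNorm.
Variables (R : realType) (H : hilbertType R).
Implicit Types (C S T X Y U : H -> H) (a b e f : nat -> H) (l : nat -> R[i]).

Lemma gram_op_normal S : bounded_op S -> normal_op (adjoint S \o S).
Proof.
move=> bS; have bSa := bounded_adj bS; have b := bounded_comp bSa bS.
by split=> //; rewrite adj_comp// adjK.
Qed.

Lemma gram_op_compact S : compact_op S -> compact_op (adjoint S \o S).
Proof. by move=> cS; apply: compact_comp => //; apply: bounded_adj; case: cS. Qed.

Lemma ip_gram_op S x y : bounded_op S -> '[(adjoint S \o S) x, y] = '[S x, S y].
Proof. by move=> bS; rewrite /= adjEr. Qed.

Lemma singular_ge0 S n : 0 <= singular_value S n.
Proof. exact: sqrtr_ge0. Qed.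

Section Compact.
Variables (S : H -> H) (cS : compact_op S).
Let bS : bounded_op S := cS.1.

Lemma singular_seqP :
  is_eigenvalue_seq (adjoint S \o S) (eigenvalue_seq (adjoint S \o S)).
Proof. by apply: eigenvalue_seqP; [exact: gram_op_normal|exact: gram_op_compact]. Qed.

(** Singular value decomposition: [b i] is the normalised image of [a i]. *)
Lemma singular_system : exists a b, [/\
  diagonalizes (adjoint S \o S) a (eigenvalue_seq (adjoint S \o S)),
  forall i, eigenvalue_seq (adjoint S \o S) i = (singular_value S i ^+ 2)%:C,
  forall i, S (a i) = (singular_value S i)%:C *: b i &
  forall i j, '[b i, b j] = ((i == j) && (singular_value S i != 0))%:R].
Proof.
have nT := gram_op_normal bS; have cT := gram_op_compact cS.
have [a da] := diagonalizes_eigenvalue_seq nT cT singular_seqP.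
have qE i : eigenvalue_seq (adjoint S \o S) i = (singular_value S i ^+ 2)%:C.
  rewrite /singular_value; set q := eigenvalue_seq _ in da *.
  have qE : '[(adjoint S \o S) (a i), a i] = q i.
    rewrite (diag_eigen da) ipZl (diag_ip da) eqxx /=.
    by have [->|_] := eqVneq (q i) 0; rewrite ?mul0r// mulr1.
  rewrite ip_gram_op// ip_self in qE; rewrite -qE /= sqrtr_sqr.
  by rewrite ger0_norm ?nm_ge0.
pose s := singular_value S.
have SS i j : '[S (a i), S (a j)] = ((s i) ^+ 2)%:C * (i == j)%:R.
  rewrite -ip_gram_op// (diag_eigen da) ipZl (diag_ip da) qE.
  have [s0|s0] := eqVneq ((s i) ^+ 2)%:C 0; first by rewrite s0 !mul0r.
  by rewrite andbT.
exists a, (fun i => (s i)^-1%:C *: S (a i)); split=> // [i|i j].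
  have [s0|si] := eqVneq (s i) 0; last first.
    by rewrite scalerA -rmorphM/= divff// scale1r.
  rewrite -/(s i) s0 scale0r; apply: ip_eq0.
  by rewrite SS s0 expr0n mul0r.
rewrite ipZl ipZr SS; have [<-|ij] := eqVneq i j; last by rewrite !mulr0.
rewrite mulr1 conjR -!rmorphM/=; have [s0|si] := eqVneq (s i) 0.
  by rewrite s0 invr0 mul0r.
suff -> : (s i)^-1 * ((s i)^-1 * s i ^+ 2) = 1 by [].
by field.
Qed.

Lemma trace_norm_leP (B : R) :
  (forall n, \sum_(i < n) singular_value S i <= B) -> (trace_norm S <= B%:E)%E.
Proof.
move=> h; apply: lime_le.
  by apply: is_cvg_nneseries => n _ _; rewrite lee_fin singular_ge0.
by apply: nearW => n; rewrite big_mkord sumEFin lee_fin.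
Qed.

Lemma trace_norm_ge n : ((\sum_(i < n) singular_value S i)%:E <= trace_norm S)%E.
Proof.
rewrite -sumEFin -(big_mkord xpredT (fun i => (singular_value S i)%:E)).
by apply: nneseries_lim_ge => i _ _; rewrite lee_fin singular_ge0.
Qed.

Lemma singular_le_trace n : ((singular_value S n)%:E <= trace_norm S)%E.
Proof.
apply: le_trans (trace_norm_ge n.+1); rewrite lee_fin big_ord_recr/= lerDr.
by apply: sumr_ge0 => i _; exact: singular_ge0.
Qed.

(** The partial sums of singular values are themselves pairings, of the
    eigenvectors of [S^* S] with their normalised images. *)
Lemma trace_norm_le (B : R) :
  (forall k a b, suborthonormal a k -> suborthonormal b k ->
    complex.Re (\sum_(i < k) '[S (a i), b i]) <= B) -> (trace_norm S <= B%:E)%E.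
Proof.
move=> h; have [a [b [da qE Sa bb]]] := singular_system; apply: trace_norm_leP => n.
have ba i : '[S (a i), b i] = (singular_value S i)%:C.
  rewrite Sa ipZl bb eqxx /=; have [->|_] := eqVneq (singular_value S i) 0.
    by rewrite mul0r.
  by rewrite mulr1.
have -> : \sum_(i < n) singular_value S i = complex.Re (\sum_(i < n) '[S (a i), b i]).
  by under [in RHS]eq_bigr => i _ do rewrite ba; rewrite -rmorph_sum.
apply: h; first exact: (diag_suborthonormal da).
move=> i j _ _; rewrite bb; congr (_ && _)%:R; apply/idP/idP; apply: contra => /eqP h0.
  apply/eqP; have := bb i i; rewrite h0 ip0l eqxx /=.
  by case: eqP => // _ /esym/eqP; rewrite oner_eq0.
by apply/eqP/ip_eq0; rewrite bb h0 !eqxx.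
Qed.

(** The largest singular value is the operator norm. *)
Lemma trace_norm_lt_bound (e : R) : 0 < e -> (trace_norm S < e%:E)%E ->
  forall x, nm (S x) <= e * nm x.
Proof.
move=> e0 tS x; have nT := gram_op_normal bS; have cT := gram_op_compact cS.
have [a [b [da qE _ _]]] := singular_system.
have [a' [l [_ hl top]]] := spectral_eigenvalue_seq nT cT.
have [s _ sl] := (same_multP hl singular_seqP).1 (fun _ _ _ => iff_refl _).
set t := singular_value S (s 0%N).
have te : t < e by rewrite -lte_fin (le_lt_trans (singular_le_trace _)).
have t0 : 0 <= t by exact: singular_ge0.
apply: (@le_trans _ _ (t * nm x)); last by rewrite ler_wpM2r ?nm_ge0// ltW.
rewrite -ler_sqr ?nnegrE ?mulr_ge0 ?nm_ge0// nm_sqr -ip_gram_op//.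
apply: le_trans (Re_le_nm _) _; apply: le_trans (cauchy_schwarz _ _) _.
apply: le_trans (ler_wpM2r (nm_ge0 _) (top x)) _.
rewrite -sl /= qE nmR ger0_norm ?sqr_ge0// -/t.
by rewrite exprMn -mulrA -expr2.
Qed.

End Compact.

Lemma sum_subseq_le (s : nat -> R) (sg : nat -> nat) n : (forall i, 0 <= s i) ->
  injective sg -> exists N, \sum_(i < n) s (sg i) <= \sum_(j < N) s j.
Proof.
move=> s0 sgI; exists (\max_(i < n) (sg i)).+1.
set N := (\max_(i < n) (sg i)).+1.
pose r := [seq sg i | i <- iota 0 n].
have ur : uniq r by rewrite map_inj_uniq// iota_uniq.
have -> : \sum_(i < n) s (sg i) = \sum_(j <- r) s j.
  by rewrite /r big_map -[n in iota 0 n]subn0 big_mkord.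
have pr : perm_eq r [seq j <- iota 0 N | j \in r].
  apply: uniq_perm => //; first by rewrite filter_uniq// iota_uniq.
  move=> j; rewrite mem_filter mem_iota/= add0n.
  have [/mapP[k]|//] := boolP (j \in r).
  rewrite mem_iota/= add0n => nk ->; rewrite ltnS.
  by rewrite (leq_bigmax (Ordinal nk)).
rewrite (perm_big _ pr) big_filter big_mkcond -[N in iota 0 N]subn0.
rewrite -[iota 0 (N - 0)]/(index_iota 0 N) big_mkord.
by apply: ler_sum => j _; case: ifP.
Qed.

Lemma diag_gram C e l : normal_op C -> diagonalizes C e l ->
  diagonalizes (adjoint C \o C) e (fun n => (nm (l n) ^+ 2)%:C).
Proof.
move=> nC dC; have bC := nC.1; split.
- move=> i; rewrite /= (diag_eigen dC) (linZ (bounded_adj bC).1).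
  by rewrite (normal_eigen_adj nC (diag_eigen dC i)) scalerA mulJr.
- move=> i j; rewrite (diag_ip dC); congr (_ && _)%:R.
  rewrite (inj_eq (@complexI _)) sqrf_eq0; congr (~~ _).
  by apply/eqP/eqP => [->|/nm_eq0//]; rewrite nm0.
- move=> eps eps0; have [_ [M [M0 hM]]] := (bounded_opP _).1 bC.
  have M1 : 0 < M + 1 by rewrite ltr_wpDl.
  have [N hN] := diag_tail dC (divr_gt0 eps0 M1); exists N => x /hN h.
  rewrite /= normal_nm//; apply: le_trans (hM _) _.
  apply: (@le_trans _ _ ((M + 1) * nm (C x))).
    by rewrite ler_wpM2r ?nm_ge0// lerDl.
  by rewrite mulrC -ler_pdivlMr// mulrAC.
Qed.

(** The moduli of the eigenvalues of a normal operator are its singular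
    values. *)
Lemma normal_trace_norm C e l n : normal_op C -> compact_op C ->
  is_eigenvalue_seq C l -> diagonalizes C e l ->
  ((\sum_(i < n) nm (l i))%:E <= trace_norm C)%E.
Proof.
move=> nC cC hl dC; have dT := diag_gram nC dC; have bC := nC.1.
have nT := gram_op_normal bC.
have hq : is_eigenvalue_seq (adjoint C \o C) (fun n => (nm (l n) ^+ 2)%:C).
  split=> [k|mu mu0]; last exact: (diag_mult dT).
  rewrite !normE lecR !nmR !ger0_norm ?sqr_ge0// ler_sqr ?nnegrE ?nm_ge0//.
  by rewrite -lecR -!normE; case: hl.
have [s bs sl] := (same_multP hq (singular_seqP cC)).1 (fun _ _ _ => iff_refl _).
have [a [b [_ qE _ _]]] := singular_system cC.
have nl i : nm (l i) = singular_value C (s i).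
  apply/eqP; rewrite -(eqrXn2 (n:=2)) ?nm_ge0 ?singular_ge0//; apply/eqP.
  by apply: complexI; rewrite -qE; have := congr1 (@^~ i) sl.
have [N hN] := @sum_subseq_le (singular_value C) s n (@singular_ge0 C) (bij_inj bs).
apply: le_trans (trace_norm_ge C N); rewrite lee_fin; apply: le_trans hN.
by under eq_bigr => i _ do rewrite nl.
Qed.

(** Arithmetic-geometric mean and Bessel. *)
Lemma suborthonormal_pairing k a b z : suborthonormal a k -> suborthonormal b k ->
  nm z <= 1 -> \sum_(i < k) nm ('[a i, z] * '[z, b i]) <= 1.
Proof.
move=> oa ob z1.
apply: (@le_trans _ _ (\sum_(i < k) (nm '[z, a i] ^+ 2 + nm '[z, b i] ^+ 2) / 2)).
  apply: ler_sum => i _; rewrite nmM [ '[a i, z] ]ipC nmJ.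
  have := sqr_ge0 (nm '[z, a i] - nm '[z, b i]); rewrite sqrrB.
  by move: (nm _) (nm _) => u v; lra.
rewrite -mulr_suml big_split/=.
have h1 := bessel oa z; have h2 := bessel ob z.
have : nm z ^+ 2 <= 1 by rewrite exprn_ile1 ?nm_ge0.
by move: h1 h2; set u := \sum_(i < k) _; set v := \sum_(i < k) _; lra.
Qed.

(** Expanding in the eigenvectors [f n] with [N <= n < M], the coefficient of
    [l n] is at most [1] by [suborthonormal_pairing]; what lies beyond [M] is
    negligible, as there are only [k] pairings. *)
Lemma diag_pairing X f l N k a b (B : R) : linear X -> diagonalizes X f l ->
  suborthonormal a k -> suborthonormal b k ->
  (forall M, \sum_(N <= n < M) nm (l n) <= B) ->
  nm (\sum_(i < k) '[X (a i - proj f N (a i)), b i]) <= B.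
Proof.
move=> LX dX oa ob hB; apply/ler_addgt0Pr => eps eps0.
have k1 : 0 < k%:R + 1 :> R by rewrite ltr_wpDl.
have [M0 hM0] := diag_tail dX (divr_gt0 eps0 k1).
pose M := maxn M0 N.
have sf : suborthonormal f M by exact: (diag_suborthonormal dX).
have split1 i : '[X (a i - proj f N (a i)), b i] =
    '[X (a i - proj f M (a i)), b i] +
    \sum_(N <= n < M) l n * ('[a i, f n] * '[f n, b i]).
  have -> : a i - proj f N (a i) =
      (a i - proj f M (a i)) + \sum_(N <= n < M) '[a i, f n] *: f n.
    rewrite -addrA; congr (_ + _); apply/eqP; rewrite eq_sym addrC subr_eq eq_sym.
    rewrite addrC subr_eq; apply/eqP.
    rewrite /proj -!(big_mkord xpredT (fun n => '[a i, f n] *: f n)).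
    by rewrite [RHS]addrC -big_cat_nat// leq_maxr.
  rewrite (linD LX) ipDl; congr (_ + _).
  rewrite (lin_sum LX) ip_suml; apply: eq_bigr => n _.
  by rewrite (linZ LX) (diag_eigen dX) scalerA ipZl; ring.
under eq_bigr => i _ do rewrite split1.
rewrite big_split/=.
apply: le_trans (nmD _ _) _; rewrite addrC; apply: lerD.
  rewrite exchange_big/=; apply: le_trans (nm_sum _ _ _) _.
  apply: le_trans (hB M); apply: ler_sum => n _.
  rewrite -mulr_sumr nmM ler_piMr ?nm_ge0//.
  apply: le_trans (nm_sum _ _ _) _; apply: suborthonormal_pairing => //.
  by apply: (nm_sub_le1 (diag_suborthonormal dX (n := n.+1))).
apply: le_trans (nm_sum _ _ _) _.
apply: (@le_trans _ _ (\sum_(i < k) eps / (k%:R + 1))).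
  apply: ler_sum => i _; apply: le_trans (cauchy_schwarz _ _) _.
  apply: (@le_trans _ _ (nm (X (a i - proj f M (a i))))).
    by rewrite ler_piMr ?nm_ge0// (nm_sub_le1 ob).
  apply: (@le_trans _ _ (eps / (k%:R + 1) * nm (a i - proj f M (a i)))).
    by apply: hM0 => j jM; apply: ip_res => //; rewrite leq_max jM.
  rewrite ler_piMr ?(ltW (divr_gt0 eps0 k1))//.
  apply: le_trans (nm_sub_le1 oa (ltn_ord i)).
  rewrite -ler_sqr ?nnegrE ?nm_ge0//.
  by rewrite [leRHS](proj_pythagoras sf) lerDr sqr_ge0.
rewrite sumr_const card_ord -[leLHS]mulr_natl mulrCA ler_piMr ?(ltW eps0)//.
by rewrite ler_pdivrMr// mul1r lerDl.
Qed.

End TraceNorm.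

(** * Trace-norm closure of the unitary orbit *)

Section TraceOrbit.
Variables (R : realType) (H : hilbertType R).
Implicit Types (C S T X Y U V W : H -> H) (a b e f u w : nat -> H).

Lemma orbit_compact C Y : compact_op C -> unitary_orbit C Y -> compact_op Y.
Proof.
move=> cC oY; have bC := cC.1.
have /(orbit_closureP _ bC)[bY h] := orbit_sub_closure bC oY.
exact: closure_compact cC bY h.
Qed.

Lemma trace_orbit_closure C X : compact_op C -> trace_orbit C X ->
  opnorm_closure (unitary_orbit C) X.
Proof.
move=> cC [[cX _] h]; have bC := cC.1; apply/opnorm_closureP.
  by move=> _ [U uU <-]; exact: bounded_orbit.
split=> [|e e0]; first by case: cX.
have [Y oY hY] := h e e0; exists Y => // x.
exact: (trace_norm_lt_bound (compactB cX (orbit_compact cC oY)) e0 hY).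
Qed.

(** As for the operator norm, but now the tails are measured by the pairing
    estimate, which bounds them by the tail of the absolutely convergent sum of
    the eigenvalues. *)
Lemma trace_orbit_normal C X : compact_op C -> normal_op C -> trace_class C ->
  compact_op X -> normal_op X -> same_mult X C -> trace_orbit C X.
Proof.
move=> cC nC [_ tC] cX nX XC; have bC := nC.1; have bX := nX.1.
have [e [f [l [hl de df]]]] := same_mult_diag cC nC cX nX XC.
have [B hB] : exists B : R, forall n, \sum_(i < n) nm (l i) <= B.
  exists (fine (trace_norm C)) => n; rewrite -lee_fin fineK.
    exact: (normal_trace_norm _ nC cC hl de).
  rewrite ge0_fin_numE//; apply: le_trans (trace_norm_ge C 0).
  by rewrite big_ord0.
split.
  split=> //; apply: le_lt_trans (ltry B); apply: trace_norm_le => // k a b oa ob.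
  apply: le_trans (Re_le_nm _) _.
  have := @diag_pairing _ _ X f l 0 k a b B bX.1 df oa ob.
  rewrite /proj; under eq_bigr => i _ do rewrite big_ord0 subr0.
  by apply => M; rewrite big_mkord.
move=> eps eps0; have eps4 : 0 < eps / 4 by rewrite divr_gt0.
have [N hN] : exists N, forall M, \sum_(N <= n < M) nm (l n) <= eps / 4.
  pose A := [set \sum_(i < n) nm (l i) | n in [set: nat]].
  have sA : has_sup A.
    split; first by exists (\sum_(i < 0) nm (l i)), 0%N.
    by exists B => _ [n _ <-].
  have [_ [N _ <-] hN] := sup_adherent eps4 sA.
  exists N => M; have [MN|NM] := leqP M N.
    rewrite big_geq//. exact: ltW.
  have : \sum_(i < M) nm (l i) <= sup A by apply: ub_le_sup; [case: sA|exists M].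
  rewrite -!(big_mkord xpredT (fun i => nm (l i))) in hN *.
  by rewrite (big_cat_nat (n := N))//=; [lra|exact: ltnW].
have [|U uU hU] := @gram_unitary _ H e f N.
  by move=> i j _ _; rewrite (diag_ip de) (diag_ip df).
have oY : unitary_orbit C (U \o C \o adjoint U) by exists U.
exists (U \o C \o adjoint U) => //.
apply: (@le_lt_trans _ _ (eps / 2)%:E); last by rewrite lte_fin; lra.
apply: trace_norm_le => [|k a b oa ob].
  by apply: compactB => //; exact: orbit_compact cC oY.
have bU := unitary_bounded uU; have uUa := unitary_adj uU.
apply: le_trans (Re_le_nm _) _.
under eq_bigr => i _ do
  rewrite /= (diag_conj_diff _ bC.1 bX.1 de df uU hU) ipBl [X in _ - X]adjE//.
rewrite sumrB; apply: le_trans (nmB _ _) _.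
have oaU (g : nat -> H) : suborthonormal g k -> suborthonormal (fun i => adjoint U (g i)) k.
  move=> og i j ik jk; rewrite unitary_ip// og//; congr (_ && ~~ _)%:R.
  apply/eqP/eqP => [->|h]; first by rewrite (lin0 (bounded_adj bU).1).
  by rewrite -(unitaryKV uU (g i)) h (lin0 bU.1).
have h1 := @diag_pairing _ _ X f l N k a b _ bX.1 df oa ob hN.
have h2 := @diag_pairing _ _ C e l N k _ _ _ bC.1 de (oaU _ oa) (oaU _ ob) hN.
by apply: le_trans (lerD h1 h2) _; lra.
Qed.

End TraceOrbit.

(** * Finite rank *)

Section FiniteRankOrbit.
Variables (R : realType) (H : hilbertType R).
Implicit Types (C S T X Y U V W : H -> H) (a b e f p u w : nat -> H).

(** An operator that is a limit of operators of rank [r] cannot be bounded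
    below on a space of dimension [r + 1], so its singular values vanish from
    the [r]-th on. *)
Lemma singular_rank_bound S r : compact_op S ->
  (forall e : R, 0 < e -> exists Y u w, rank_form r u w Y /\
    forall x, nm (S x - Y x) <= e * nm x) ->
  forall n, (r <= n)%N -> singular_value S n = 0.
Proof.
move=> cS h; have [a [b [da qE Sa bb]]] := singular_system cS.
have hq := singular_seqP cS; have L := cS.1.1.
set s := singular_value S in qE Sa bb *.
have s0 i : 0 <= s i by exact: singular_ge0.
have mono n m : (n <= m)%N -> s m <= s n.
  move=> nm_; rewrite -(subnKC nm_); elim: (m - n)%N => [|k IH]; first by rewrite addn0.
  apply: le_trans IH; rewrite addnS.
  have := hq.1 (n + k)%N; rewrite !normE lecR !qE !nmR !ger0_norm ?sqr_ge0//.
  by rewrite ler_sqr ?nnegrE.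
suff sr : s r = 0 by move=> n /mono; rewrite sr => sn; apply/le_anti; rewrite sn s0.
apply/eqP; apply: contraT => srn.
have sr0 : 0 < s r by rewrite lt_def srn s0.
have sp i : (i < r.+1)%N -> s i != 0.
  by rewrite ltnS => /mono h1; rewrite gt_eqF// (lt_le_trans sr0).
have oa : orthonormal_fam a r.+1.
  move=> i j ir _; rewrite (diag_ip da) qE (inj_eq (@complexI _)) sqrf_eq0.
  by rewrite sp// andbT.
have ob : orthonormal_fam b r.+1.
  by move=> i j ir _; rewrite bb sp// andbT.
have [Y [u [w [hY SY]]]] := h (s r / 2) (divr_gt0 sr0 (ltr0n R 2)).
have [c [i ci] hc] := underdetermined (\matrix_(i < r.+1, j < r) '[a i, u j]) (ltnSn r).
pose c' i := if insub i is Some j then c j else 0.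
have c'E (j : 'I_r.+1) : c' j = c j by rewrite /c' valK.
pose x := \sum_(j < r.+1) c' j *: a j.
have Yx : Y x = 0.
  rewrite hY big1// => j _; suff -> : '[x, u j] = 0 by rewrite scale0r.
  rewrite /x ip_suml; apply: etrans (hc j); apply: eq_bigr => k _.
  by rewrite ipZl mxE c'E.
have nmx : nm x ^+ 2 = \sum_(j < r.+1) nm (c' j) ^+ 2.
  rewrite (nm_comb (orthonormal_sub oa)); apply: eq_bigr => j _.
  have := oa j j (ltn_ord j) (ltn_ord j); rewrite eqxx ip_self => /complexI->.
  by rewrite mulr1.
have x0 : 0 < nm x.
  rewrite lt_def nm_ge0 andbT -sqrf_eq0 nmx; apply: contra ci => /eqP hs.
  have /(_ i isT)/eqP := psumr_eq0P (fun (j : 'I_r.+1) _ => sqr_ge0 (nm (c' j))) hs.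
  by rewrite sqrf_eq0 c'E => /eqP/nm_eq0->.
have lower : s r * nm x <= nm (S x).
  rewrite -ler_sqr ?nnegrE ?mulr_ge0 ?nm_ge0// exprMn nmx.
  have -> : S x = \sum_(j < r.+1) (c' j * (s j)%:C) *: b j.
    by rewrite (lin_sum L); apply: eq_bigr => j _; rewrite (linZ L) Sa scalerA.
  rewrite (nm_comb (orthonormal_sub ob) (fun j => c' j * (s j)%:C)) mulr_sumr.
  apply: ler_sum => j _.
  have := ob j j (ltn_ord j) (ltn_ord j); rewrite eqxx ip_self => /complexI->.
  rewrite mulr1 nmM nmR ger0_norm// exprMn mulrC ler_wpM2l ?sqr_ge0//.
  by rewrite ler_sqr ?nnegrE// mono// -ltnS.
have := le_trans lower (_ : _ <= s r / 2 * nm x).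
rewrite -[S x]subr0 -{1}Yx => /(_ (SY x)); rewrite ler_pM2r//; lra.
Qed.

(** [S] vanishes on vectors orthogonal to the eigenvectors of [S^* S] with nonzero
    eigenvalue. *)
Lemma singular_rank_form S r : compact_op S ->
  (forall n, (r <= n)%N -> singular_value S n = 0) ->
  exists a, rank_form r a (S \o a) S.
Proof.
move=> cS s0; have [a [b [da qE _ _]]] := singular_system cS.
have bS := cS.1; have L := bS.1.
exists a => x; have sa : suborthonormal a r by exact: (diag_suborthonormal da).
pose y := x - proj a r x.
have ya i : '[y, a i] = 0.
  have [ir|ri] := ltnP i r; first exact: ip_res.
  suff -> : a i = 0 by rewrite ip0r.
  by apply: ip_eq0; rewrite (diag_ip da) qE s0// expr0n !eqxx.
suff Sy : S y = 0.
  have -> : S x = S (y + proj a r x) by rewrite subrK.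
  rewrite (linD L) Sy add0r (lin_sum L).
  by apply: eq_bigr => i _; rewrite (linZ L).
have Ty : (adjoint S \o S) y = 0.
  apply/nm_eq0/le_anti; rewrite nm_ge0 andbT; apply/ler_addgt0Pr => d d0; rewrite add0r.
  have y1 : 0 < nm y + 1 by rewrite ltr_wpDl// nm_ge0.
  have [N hN] := diag_tail da (divr_gt0 d0 y1).
  apply: le_trans (hN y (fun i _ => ya i)) _.
  by rewrite mulrAC ler_pdivrMr// ler_pM2l// lerDl.
by apply: ip_eq0; rewrite -ip_gram_op// Ty ip0l.
Qed.

Lemma rank_form_trace_class r u w Y : rank_form r u w Y -> trace_class Y.
Proof.
move=> hY; have cY := rank_form_compact hY; split=> //.
have s0 : forall n, (r <= n)%N -> singular_value Y n = 0.
  apply: singular_rank_bound => // e e0; exists Y, u, w; split=> // x.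
  by rewrite subrr nm0 mulr_ge0 ?nm_ge0// ltW.
apply: le_lt_trans (ltry (\sum_(i < r) singular_value Y i)).
apply: trace_norm_leP => n.
have -> : \sum_(i < r) singular_value Y i = \sum_(i < r + n) singular_value Y i.
  rewrite big_split_ord/= [X in _ = _ + X]big1 ?addr0// => i _.
  by rewrite s0// leq_addr.
rewrite addnC big_split_ord/= lerDl; apply: sumr_ge0 => i _; exact: singular_ge0.
Qed.

(** A finite family can be moved into a fixed finite-dimensional space by a
    unitary fixing another given one: each vector is corrected by a reflection
    turning its component outside that space into a new basis direction. *)
Lemma compress p n k (y : nat -> H) : orthonormal_fam p (n + k) ->
  exists W, [/\ unitary_op W, forall i, (i < n)%N -> W (p i) = p i &
    forall i, (i < k)%N -> span_of p (n + k) (W (y i))].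
Proof.
elim: k => [|k IH] op; first by exists id; split=> //; exact: unitary_id.
have op' : orthonormal_fam p (n + k).
  by move=> i j ik jk; apply: op; rewrite addnS ltnW.
have [W [uW Wp Wy]] := IH op'; have so := orthonormal_sub op'.
pose m := (n + k)%N; pose z := W (y k) - proj p m (W (y k)).
have zp i : (i < m)%N -> '[z, p i] = 0 by move=> im; exact: ip_res.
have pp i : (i < m)%N -> '[p i, p m] = 0.
  by move=> im; rewrite op ?addnS ?ltnS// ?(ltnW im)// ltn_eqF.
have npm : nm (p m) = 1.
  have := op m m; rewrite addnS ltnSn eqxx ip_self => /(_ isT isT)/complexI/eqP.
  by rewrite -{1}(expr1n _ 2) eqrXn2 ?nm_ge0// => /eqP.
have [|V uV [Vz Vx]] := @reflection _ H z ((nm z)%:C *: p m).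
  by rewrite nmZr ?nm_ge0// npm mulr1.
have Vp i : (i < m)%N -> V (p i) = p i.
  move=> im; apply: Vx; rewrite ipBr ipZr pp// mulr0 subr0.
  by apply: ip_eq0C; exact: zp.
have LV := unitary_lin uV.
have Vspan x : span_of p m x -> V x = x.
  move=> hx; rewrite -[in LHS]hx -[RHS]hx /proj (lin_sum LV); apply: eq_bigr => i _.
  by rewrite (linZ LV) Vp.
have wide x : span_of p m x -> span_of p (n + k.+1) x.
  by apply: proj_widen => //; rewrite addnS.
exists (V \o W); split=> [|i ni|i]; first exact: unitary_comp.
  by rewrite /= Wp// Vp// (leq_trans ni)// leq_addr.
rewrite ltnS leq_eqVlt => /orP[/eqP->|ik] /=; last first.
  by rewrite Vspan; [apply: wide|]; exact: Wy.
have sS := subsp_span p (n + k.+1).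
have spp : span_of p m (proj p m (W (y k))) by apply: projK.
have -> : W (y k) = z + proj p m (W (y k)) by rewrite subrK.
rewrite (linD LV) Vz (Vspan _ spp); apply: subspD => //; last exact: wide.
apply: subspZ => //; apply: proj_in; first exact: orthonormal_sub.
by rewrite addnS.
Qed.

(** Either a finite-dimensional subspace containing the [a i] has [k] further
    orthonormal directions to spare, or the whole space is finite
    dimensional and nothing has to be moved. *)
Lemma confine a r k : exists P m, forall y : nat -> H, exists W, [/\ unitary_op W,
  forall i, (i < r)%N -> W (a i) = a i &
  forall i, (i < k)%N -> span_of P m (W (y i))].
Proof.
have o0 : orthonormal_fam (fun=> 0 : H) 0 by [].
have [n [p [_ op _ ap _]]] := gram_schmidt a r o0.
have [[P oP Pp]|[P [m [oP hP]]]] := orthonormal_extend k op; last first.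
  exists P, m => y; exists id; split=> //; first exact: unitary_id.
  by move=> i _; exact: hP.
exists P, (n + k)%N => y; have [W [uW WP Wy]] := compress y oP.
exists W; split=> // i ir; have LW := unitary_lin uW.
rewrite -(ap i ir) /proj (lin_sum LW); apply: eq_bigr => j _.
by rewrite (linZ LW) -Pp// WP.
Qed.

Lemma tendsZl (T : Type) (F : set_system T) (FF : ProperFilter F)
    (c : T -> R[i]) c0 (x : T -> H) x0 :
  tends F c c0 -> tends F x x0 -> tends F (fun t => c t *: x t) (c0 *: x0).
Proof.
move=> hc hx e e0; have e2 : 0 < e / 2 by rewrite divr_gt0.
have n1 : 0 < nm c0 + 1 by rewrite ltr_wpDl// nm_ge0.
have n2 : 0 < nm x0 + 1 by rewrite ltr_wpDl// nm_ge0.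
near=> t.
have h1 : nm (c t - c0) < 1 by near: t; apply: hc.
have h2 : nm (c t - c0) < e / 2 / (nm x0 + 1) by near: t; apply: hc; rewrite divr_gt0.
have h3 : nm (x t - x0) < e / 2 / (nm c0 + 1) by near: t; apply: hx; rewrite divr_gt0.
have -> : c t *: x t - c0 *: x0 = c t *: (x t - x0) + (c t - c0) *: x0.
  by rewrite scalerBr scalerBl addrA subrK.
apply: le_lt_trans (nmD _ _) _; rewrite !nmZ [e]splitr; apply: ler_ltD.
  have cb : nm (c t) <= nm c0 + 1.
    by rewrite -[c t](subrK c0) addrC; apply: le_trans (nmD _ _) _; rewrite lerD2l ltW.
  apply: (@le_trans _ _ ((nm c0 + 1) * nm (x t - x0))); first by rewrite ler_wpM2r ?nm_ge0.
  by rewrite mulrC -ler_pdivlMr// ltW.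
apply: (@le_lt_trans _ _ (nm (c t - c0) * (nm x0 + 1))).
  by rewrite ler_wpM2l ?nm_ge0// lerDl.
by rewrite -ltr_pdivlMr.
Unshelve. all: by end_near. Qed.

(** The approximating unitaries matter only through the images of the finitely
    many vectors that describe [C]. Composed with unitaries commuting with [X],
    they keep these images in one finite-dimensional space, where an
    ultrafilter limit exists; it has the same Gram matrix, hence comes from a
    unitary. *)
Theorem rank_form_orbit_closed r u w C X : rank_form r u w C ->
  opnorm_closure (unitary_orbit C) X -> unitary_orbit C X.
Proof.
move=> hC clX; have cC := rank_form_compact hC; have bC := cC.1.
have [bX h] := (orbit_closureP X bC).1 clX.
have cX := closure_compact cC bX h.
have [a hX] : exists a, rank_form r a (X \o a) X.
  apply: singular_rank_form => //; apply: singular_rank_bound => // e e0.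
  have [U uU hU] := h e e0.
  exists (U \o C \o adjoint U), (U \o u), (U \o w); split=> //.
  exact: rank_form_orbit.
pose join (s t : nat -> H) i := if (i < r)%N then s i else t (i - r)%N.
have joinl s t i : (i < r)%N -> join s t i = s i by rewrite /join => ->.
have joinr s t i : join s t (r + i)%N = t i by rewrite /join ltnNge leq_addr addKn.
pose v := join u w.
have [P [m hP]] := confine (join a (X \o a)) (r + r) (r + r).
have [V_ uV hV] := close_orbit_seq h.
have /choice[W_ hW] : forall n, exists W, [/\ unitary_op W,
    forall i, (i < r + r)%N -> W (join a (X \o a) i) = join a (X \o a) i &
    forall i, (i < r + r)%N -> span_of P m (W (V_ n (v i)))].
  by move=> n; exact: hP.
(* [W_ n] commutes with [X], so [Q n] approximates [X] as well as [V_ n] does *)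
pose Q n := W_ n \o V_ n.
have uQ n : unitary_op (Q n) by apply: unitary_comp => //; case: (hW n).
have WX n x : W_ n (X (adjoint (W_ n) x)) = X x.
  have [uW Wf _] := hW n; have bW := unitary_bounded uW.
  have Wa i : (i < r)%N -> W_ n (a i) = a i.
    by move=> ir; rewrite -(joinl a (X \o a) i ir) Wf// ltn_addr.
  have WXa i : (i < r)%N -> W_ n (X (a i)) = X (a i).
    move=> ir; have := Wf (r + i)%N; rewrite joinr ltn_add2l; exact.
  rewrite !hX (lin_sum bW.1); apply: eq_bigr => i _.
  by rewrite (linZ bW.1) /= WXa// adjEr// Wa.
have hQ n : close_orbit C X (Q n) n.+1%:R^-1.
  move=> x; have [uW _ _] := hW n; have bW := unitary_bounded uW.
  have uWa := unitary_adj uW.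
  rewrite /Q adj_comp//; last exact: unitary_bounded.
  rewrite -(WX n x) /= -(linB bW.1) (unitary_nm uW) -(unitary_nm uWa x).
  exact: hV.
have [U [UU Uc]] := cofinal_ultra_ex; have UP : ProperFilter U := @ultra_proper _ U UU.
have /choice[F hF] : forall i, exists F, (i < r + r)%N -> tends U (fun n => Q n (v i)) F.
  move=> i; have [ir|_] := ltnP i (r + r); last by exists 0.
  have cP := compact_ultra_compact (compact_proj P m).
  have [|F hF] := cP U (fun n => Q n (v i)) (nm (v i)) UU.
    by move=> n; rewrite (unitary_nm (uQ n)).
  exists F => _; apply: tends_near hF; apply: nearW => n /=.
  by have [_ _ hs] := hW n; exact: hs.
have [|V uV' hVF] := @gram_unitary _ H v F (r + r).
  move=> i j ir jr; apply: tends_uniq (tends_ip (hF _ ir) (hF _ jr)).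
  by apply: tends_near (tends_cst _); apply: nearW => n; rewrite (unitary_ip (uQ n)).
exists V => //; apply/funext => x; apply/esym.
have lim1 : tends U (fun n => Q n (C (adjoint (Q n) x))) (X x).
  move=> e e0; have [N _ hN] := close_orbit_tends hQ x e0.
  by apply: filterS (Uc N) => n /= /hN.
apply: tends_uniq lim1 _.
rewrite (rank_form_orbit uV' hC x).
apply: tends_near (tends_sum (index_enum 'I_r) (x := fun i n => '[x, Q n (u i)] *: Q n (w i)) _).
  by apply: nearW => n; rewrite -(rank_form_orbit (uQ n) hC x).
move=> i /=; have ui : (i < r + r)%N by rewrite ltn_addr.
have wi : (r + i < r + r)%N by rewrite ltn_add2l.
have -> : V (u i) = F i by rewrite -hVF// /v joinl.
have -> : V (w i) = F (r + i)%N by rewrite -hVF// /v joinr.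
have hu := hF _ ui; have hw := hF _ wi.
rewrite /v joinl// in hu; rewrite /v joinr in hw.
by apply: tendsZl => //; apply: tends_ip => //; exact: tends_cst.
Qed.

Lemma orbit_trace_orbit r u w C X : rank_form r u w C ->
  unitary_orbit C X -> trace_orbit C X.
Proof.
move=> hC oX; have [U uU XE] := oX.
split; first by rewrite -XE; exact: rank_form_trace_class (rank_form_orbit uU hC).
move=> e e0; exists X => //; have cX := orbit_compact (rank_form_compact hC) oX.
apply: (@le_lt_trans _ _ 0%:E); last by rewrite lte_fin.
apply: trace_norm_le => [|k a b _ _]; first exact: compactB.
by rewrite big1// => i _ /=; rewrite subrr ip0l.
Qed.

End FiniteRankOrbit.

(** * Characterisations of the closed unitary orbit *)

Theorem proposition3p1 (R : realType) (H : hilbertType R) (sepH : separable H) :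
  (forall C X : H -> H,
    bounded_op C -> compact_op C -> normal_op C -> bounded_op X ->
    [/\ opnorm_closure (unitary_orbit C) X <->
          (compact_op X /\ normal_op X) /\
          (exists2 s : nat -> nat, bijective s &
             eigenvalue_seq X \o s = eigenvalue_seq C),
        forall K : hilbertType R, separable K -> infinite_dim K ->
          (opnorm_closure (unitary_orbit C) X <->
           unitary_orbit (dsum C (fun _ : K => 0))
             (dsum X (fun _ : K => 0)))
      & trace_class C ->
          (opnorm_closure (unitary_orbit C) X <-> trace_orbit C X)]) /\
  (forall C : H -> H, bounded_op C -> finite_rank C ->
     opnorm_closure (unitary_orbit C) = trace_orbit C /\
     trace_orbit C = unitary_orbit C).
Proof.
split=> [C X bC cC nC bX|C bC /finite_rank_form[r [u [w hC]]]]; last first.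
  have cC := rank_form_compact hC.
  have clo X := @rank_form_orbit_closed R H r u w C X hC.
  have tro X := @orbit_trace_orbit R H r u w C X hC.
  split; apply/seteqP; split=> X hX.
  - by apply: tro; exact: clo.
  - exact: trace_orbit_closure.
  - by apply: clo; exact: trace_orbit_closure.
  - exact: tro.
have iP := orbit_closure_same_mult cC nC bX; split.
- split=> [/iP[cX nX XC]|[[cX nX] [s bs sXC]]].
    split=> //; apply: (same_multP _ _).1 (same_mult_sym XC); exact: eigenvalue_seqP.
  apply/iP; split=> //; apply: same_mult_sym.
  by apply: ((same_multP _ _).2 (ex_intro2 _ _ s bs sXC)); exact: eigenvalue_seqP.
- move=> K sepK infK; apply: (iff_trans iP); exact: dilation_orbit.
- move=> tC; split=> [/iP[cX nX XC]|]; last exact: trace_orbit_closure.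
  exact: trace_orbit_normal.
Qed.
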